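(* Let $\mathbb K\subset\mathbb R$ be a Cantor set and let $f:\Omega\times\mathbb K\to\mathbb K$ be a random map of $C^1$ diffeomorphisms of $\mathbb K$, where $\Omega=T^{\mathbb N}$ with $T$ finite. If $f$ has no common invariant probability measure, then $f$ is mostly contracting. Moreover, there exists $\alpha_0>0$ such that the annealed Koopman operator $P\varphi(x)=\int\varphi(f_\omega(x))\,d\mathbb P$ is quasi-compact on $C^\alpha(\mathbb K)$ for any $0<\alpha\le\alpha_0$, and: (a) $1$ is a simple eigenvalue of $P$ if and only if $f$ is uniquely ergodic; (b) $1$ is the unique eigenvalue of $P$ with modulus $1$ if and only if $f$ is aperiodic; (c) $P$ has a spectral gap if and only if $f$ is mingled.
   Context: $(\Omega,\mathscr F,\mathbb P)=(T^{\mathbb N},\mathscr A^{\mathbb N},p^{\mathbb N})$ is a Bernoulli product space. A random map on a compact metric space $X$ (here $X=\mathbb K$ with the distance of $\mathbb R$) is a measurable $f:\Omega\times X\to X$ with $f_\omega:=f(\omega,\cdot)=f_{\omega_0}$ for $\mathbb P$-a.e. $\omega$; $f^n_\omega=f_{\omega_{n-1}}\circ\cdots\circ f_{\omega_0}$. A $C^1$ diffeomorphism of $\mathbb K$ is a homeomorphism $g:\mathbb K\to\mathbb K$ such that for every $x\in\mathbb K$ there are an open interval $I_x\ni x$ and a $C^1$ diffeomorphism $\tilde g_x:I_x\to\tilde g_x(I_x)\subset\mathbb R$ with $\tilde g_x=g$ on $I_x\cap\mathbb K$; a random map of $C^1$ diffeomorphisms of $\mathbb K$ is one with $f_\omega$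 such a map for $\mathbb P$-a.e. $\omega$. A common invariant probability measure is a $\mu$ with $(f_\omega)_*\mu=\mu$ for $\mathbb P$-a.e. $\omega$. $\mu$ is $f$-stationary if $\mathbb P\times\mu$ is invariant under $(\omega,x)\mapsto(\sigma\omega,f_\omega(x))$. $f$ is mostly contracting if $\int\log^+\mathrm{Lip}(f_\omega)\,d\mathbb P<\infty$ and $\sup_\mu\lambda(\mu)<0$ over stationary $\mu$, where $\lambda(\mu)=\lim_n\frac1n\int\log Lf^n_\omega(x)\,d\mathbb P\,d\mu$, $Lg(z)=\lim_{r\to0^+}\mathrm{Lip}(g|_{B(z,r)})$. A closed $Y\subset X$ is $f^k$-invariant if $f^k_\omega(Y)\subset Y$ a.s. $f$ is uniquely ergodic if it has a unique stationary probability measure; mingled if for every $k\ge1$ there are no two disjoint non-empty closed $f^k$-invariant sets; aperiodic if there do not exist $p\ge2$ and pairwise disjoint non-empty closed $F_1,\dots,F_p$ with $f_\omega(F_i)\subset F_{i+1}$ ($i<p$) and $f_\omega(F_p)\subset F_1$ a.s. $P$ is quasi-compact on $C^\alpha(X)$ ($\alpha$-Hölder functions) if it is bounded there and $\|P^n-R\|_{\rm op}<1$ for some $n$ and compact operator $R$; it has a spectral gap if moreover $P\varphi=\lambda\varphi$, $|\lambda|=1$, $\varphi\ne0$ forces $\lambda=1$ and $\varphi$ constant. Eigenvalues refer to $P$ acting on (complex-valued) $C^\alpha(X)$. *)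

(* Defs.v *)
From HB Require Import structures.
From mathcomp Require Import all_boot all_order all_algebra.
From mathcomp Require Import all_classical all_reals all_analysis.
From mathcomp Require Import complex.

Set Implicit Arguments.
Unset Strict Implicit.
Unset Printing Implicit Defensive.

Import Order.TTheory GRing.Theory Num.Theory.
Import numFieldNormedType.Exports.
Import ComplexField.Normc.

Local Open Scope classical_set_scope.
Local Open Scope ring_scope.

(* In MathComp-Analysis every measurable type is pointed, so a metric space
   must be pointed (i.e. nonempty) to carry its Borel sigma-algebra. *)
#[short(type="pmetricType")]
HB.structure Definition PMetric (K : numDomainType) :=
  {M of Metric K M & Pointed M}.

Definition borel (R : realType) (X : pmetricType R) : Type :=
  g_sigma_algebraType (@open X).
HB.instance Definition _ (R : realType) (X : pmetricType R) :=
  Measurable.on (borel X).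

Section BernoulliSpace.
Context {R : realType} {d : measure_display}.

Definition coord_cylinders (T : measurableType d) : set (set (nat -> T)) :=
  [set C | exists i A, measurable A /\ C = [set w | A (w i)]].

Definition pathSpace (T : measurableType d) : Type :=
  g_sigma_algebraType (@coord_cylinders T).
HB.instance Definition _ (T : measurableType d) := Measurable.on (pathSpace T).

(* P = p^N: by Dynkin's lemma the values on cylinders determine P. The library
   has no infinite product measure, so P is a variable subject to this
   predicate. *)
Definition is_bernoulli (T : measurableType d) (p : probability T R)
    (P : probability (pathSpace T) R) : Prop :=
  forall (n : nat) (A : nat -> set T), (forall i, measurable (A i)) ->
    P [set w | forall i, (i < n)%N -> A i (w i)] =
    (\prod_(i < n) p (A i))%E.

Definition path_shift (T : measurableType d) (w : pathSpace T) : pathSpace T :=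
  fun n => w n.+1.

End BernoulliSpace.

Section Lipschitz.
Context {R : realType} {X : pmetricType R}.
Local Open Scope ereal_scope.

(* Pairs with x = y contribute 0, because 0 / 0 = 0. *)
Definition Lip_on (A : set X) (g : X -> X) : \bar R :=
  ereal_sup [set (mdist (g u.1) (g u.2) / mdist u.1 u.2)%R%:E
            | u in A `*` A].

Definition Lip (g : X -> X) : \bar R := Lip_on setT g.

Definition Llip (g : X -> X) (z : X) : \bar R :=
  lim (Lip_on (ball z r) g @[r --> (0%R : R)^'+]).

End Lipschitz.

Section RandomMap.
Context {R : realType} {d : measure_display} {T : measurableType d}.
Context {X : pmetricType R} (P : probability (pathSpace T) R).
Implicit Types (f : pathSpace T -> X -> X) (mu : probability (borel X) R).

Definition random_map f : Prop :=
  measurable_fun [set: pathSpace T * borel X]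
    (fun z : pathSpace T * borel X => f z.1 z.2 : borel X) /\
  exists g : T -> X -> X, {ae P, forall w, f w = g (w 0%N)}.

Fixpoint fiter f (n : nat) (w : pathSpace T) (x : X) : X :=
  if n is m.+1 then f (iter m (@path_shift _ T) w) (fiter f m w x) else x.

Definition common_invariant f mu : Prop :=
  {ae P, forall w, forall A : set (borel X), measurable A ->
    pushforward mu (f w : borel X -> borel X) A = mu A}.

Definition stationary f mu : Prop :=
  forall A : set (pathSpace T * borel X), measurable A ->
    pushforward (P \x mu)%E
      (fun z : pathSpace T * borel X => (path_shift z.1, f z.1 z.2 : borel X)) A =
    (P \x mu)%E A.

Definition lyapunov f mu : \bar R :=
  limn (fun n : nat =>
    (n%:R^-1)%:E * \int[P \x mu]_z lne (Llip (fiter f n z.1) z.2))%E.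

Definition mostly_contracting f : Prop :=
  (\int[P]_w maxe 0 (lne (Lip (f w))) < +oo)%E /\
  (ereal_sup [set lyapunov f mu | mu in stationary f] < 0)%E.

Definition set_invariant f (k : nat) (Y : set X) : Prop :=
  {ae P, forall w, fiter f k w @` Y `<=` Y}.

(* Uniqueness is stated on measurable sets: a term of type [probability] is a
   function on all sets, whose values off the sigma-algebra are irrelevant. *)
Definition uniquely_ergodic f : Prop :=
  exists2 mu, stationary f mu &
    forall nu, stationary f nu ->
      forall A : set (borel X), measurable A -> nu A = mu A.

Definition mingled f : Prop :=
  forall k : nat, (1 <= k)%N ->
    ~ exists Y Z : set X,
        [/\ closed Y /\ Y !=set0, closed Z /\ Z !=set0, Y `&` Z = set0,
            set_invariant f k Y & set_invariant f k Z].

(* [ordS] is the cyclic successor on 'I_q, so F_q is mapped into F_1. *)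
Definition aperiodic f : Prop :=
  ~ exists (q : nat) (F : 'I_q -> set X),
      [/\ (2 <= q)%N, (forall i, closed (F i) /\ F i !=set0),
          (forall i j, i != j -> F i `&` F j = set0) &
          forall i, {ae P, forall w, f w @` F i `<=` F (ordS i)}].

Definition koopman f (phi : X -> R[i]) (x : X) : R[i] :=
  Complex (\int[P]_w complex.Re (phi (f w x)))
          (\int[P]_w complex.Im (phi (f w x))).

End RandomMap.

(* The complex normed space C^alpha(X), with norm
   sup |phi| + sup |phi x - phi y| / dist(x, y)^alpha. *)
Section Holder.
Context {R : realType} (X : pmetricType R) (a : R).
Local Notation C := R[i].

(* Boundedness is automatic when X is compact and 0 < a. *)
Definition is_holder (phi : X -> C^o) : Prop :=
  exists M : R, (forall x, normc (phi x) <= M) /\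
    (forall x y, normc (phi x - phi y) <= M * mdist x y `^ a).

Definition holder_pred : {pred X -> C^o} := fun phi => `[< is_holder phi >].

Record holder : Type := Holder {
  holder_fun :> X -> C^o;
  holder_funP : holder_fun \in holder_pred }.

HB.instance Definition _ := [isSub for holder_fun].
HB.instance Definition _ := [Choice of holder by <:].

Lemma normc_ge0 (z : C) : 0 <= normc z.
Proof. by case: z => x y; exact: sqrtr_ge0. Qed.
#[local] Hint Resolve normc_ge0 : core.

Lemma holder_submod : submod_closed holder_pred.
Proof.
split=> [|c u v /asboolP[M [Mb Mh]] /asboolP[N [Nb Nh]]]; apply/asboolP.
  exists 0; split=> [x|x y]; first by rewrite normc0.
  by rewrite [_ - _]subrr normc0 mul0r.
have E z : (c *: u + v) z = c * u z + v z by [].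
exists (normc c * M + N); split=> [x|x y].
  rewrite E; apply: le_trans (le_normcD _ _) _; apply: lerD (Nb x).
  by rewrite normcM ler_wpM2l.
have -> : (c *: u + v) x - (c *: u + v) y = c * (u x - u y) + (v x - v y).
  by rewrite !E mulrBr opprD addrACA.
apply: le_trans (le_normcD _ _) _; rewrite mulrDl; apply: lerD (Nh x y).
by rewrite normcM -mulrA ler_wpM2l.
Qed.

HB.instance Definition _ :=
  GRing.isSubmodClosed.Build C (X -> C^o) holder_pred holder_submod.
HB.instance Definition _ := [SubChoice_isSubLmodule of holder by <:].

Definition sup_norm (phi : holder) : R :=
  sup [set normc (phi x) | x in [set: X]].

(* Pairs with x = y contribute 0. *)
Definition holder_seminorm (phi : holder) : R :=
  sup [set normc (phi u.1 - phi u.2) / mdist u.1 u.2 `^ a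
      | u in [set: X * X]].

Definition holder_norm (phi : holder) : R := sup_norm phi + holder_seminorm phi.

Lemma holder_ratio_le (phi : holder) M :
  (forall x y, normc (phi x - phi y) <= M * mdist x y `^ a) ->
  forall x y, normc (phi x - phi y) / mdist x y `^ a <= Num.max M 0.
Proof.
move=> h x y; have [d0|d0] := ltP 0 (mdist x y `^ a).
  rewrite ler_pdivrMr//; apply: le_trans (h x y) _.
  by rewrite ler_pM2r// le_max lexx.
have -> : mdist x y `^ a = 0 by apply/eqP; rewrite eq_le d0 powR_ge0.
by rewrite invr0 mulr0 le_max lexx orbT.
Qed.

Lemma sup_norm_ub (phi : holder) x : normc (phi x) <= sup_norm phi.
Proof.
have /asboolP[M [Mb _]] := holder_funP phi.
by apply: ub_le_sup; [exists M => _ [y _ <-]; exact: Mb | exists x].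
Qed.

Lemma holder_seminorm_ub (phi : holder) x y :
  normc (phi x - phi y) / mdist x y `^ a <= holder_seminorm phi.
Proof.
have /asboolP[M [_ Mh]] := holder_funP phi.
apply: ub_le_sup; last by exists (x, y).
by exists (Num.max M 0) => _ [[z t] _ <-]; exact: holder_ratio_le.
Qed.

Lemma sup_norm_le (phi : holder) M :
  (forall x, normc (phi x) <= M) -> sup_norm phi <= M.
Proof.
by move=> h; apply: ge_sup => [|_ [x _ <-]//]; exists (normc (phi point)), point.
Qed.

Lemma holder_seminorm_le (phi : holder) M :
  (forall x y, normc (phi x - phi y) / mdist x y `^ a <= M) ->
  holder_seminorm phi <= M.
Proof.
move=> h; apply: ge_sup => [|_ [[x y] _ <-]//].
by eexists; exists (point, point).
Qed.

Lemma holder_seminorm_ge0 (phi : holder) : 0 <= holder_seminorm phi.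
Proof.
by apply: le_trans (holder_seminorm_ub phi point point); rewrite divr_ge0// powR_ge0.
Qed.

Lemma sup_norm_ge0 (phi : holder) : 0 <= sup_norm phi.
Proof. exact: le_trans (sup_norm_ub phi point). Qed.

#[local] Hint Resolve sup_norm_ub holder_seminorm_ge0 sup_norm_ge0 : core.

Lemma holder_normD (phi psi : holder) :
  holder_norm (phi + psi) <= holder_norm phi + holder_norm psi.
Proof.
rewrite /holder_norm addrACA lerD//.
  apply: sup_norm_le => x; apply: le_trans (le_normcD _ _) _.
  exact: lerD.
apply: holder_seminorm_le => x y.
have -> : (phi + psi) x - (phi + psi) y = (phi x - phi y) + (psi x - psi y).
  by rewrite [LHS]/(phi x + psi x - (phi y + psi y)) opprD addrACA.
apply: le_trans (lerD (holder_seminorm_ub phi x y) (holder_seminorm_ub psi x y)).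
by rewrite -mulrDl ler_wpM2r ?invr_ge0 ?powR_ge0 ?le_normcD.
Qed.

Lemma holder_normZle (c : C) (phi : holder) :
  holder_norm (c *: phi) <= normc c * holder_norm phi.
Proof.
rewrite /holder_norm mulrDr lerD//.
  by apply: sup_norm_le => x; rewrite [(c *: phi) x]/(c * phi x) normcM ler_wpM2l.
apply: holder_seminorm_le => x y.
have -> : (c *: phi) x - (c *: phi) y = c * (phi x - phi y).
  by rewrite [LHS]/(c * phi x - c * phi y) mulrBr.
by rewrite normcM -mulrA ler_wpM2l// holder_seminorm_ub.
Qed.

Lemma holder_normZ (c : C) (phi : holder) :
  holder_norm (c *: phi) = normc c * holder_norm phi.
Proof.
apply/eqP; rewrite eq_le holder_normZle/=.
have [->|c0] := eqVneq c 0.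
  by rewrite normc0 mul0r addr_ge0.
have nc0 : 0 < normc c.
  by rewrite lt_neqAle normc_ge0 andbT eq_sym; apply: contra c0 => /eqP/eq0_normc ->.
rewrite -ler_pdivlMl// -normcV; apply: le_trans (holder_normZle _ _).
by rewrite scalerA mulVf// scale1r.
Qed.

Definition holder_cnorm (phi : holder) : C := (holder_norm phi)%:C%C.

Lemma holder_cnormD (phi psi : holder) :
  holder_cnorm (phi + psi) <= holder_cnorm phi + holder_cnorm psi.
Proof. by rewrite /holder_cnorm -rmorphD lecR holder_normD. Qed.

Lemma holder_cnormZ (c : C) (phi : holder) :
  holder_cnorm (c *: phi) = `|c| * holder_cnorm phi.
Proof. by rewrite /holder_cnorm holder_normZ rmorphM. Qed.

Lemma holder_cnorm0_eq0 (phi : holder) : holder_cnorm phi = 0 -> phi = 0.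
Proof.
move=> [] /eqP; rewrite paddr_eq0// => /andP[/eqP s0 _].
apply/val_inj/funext => x; apply: eq0_normc; apply/eqP.
by rewrite eq_le normc_ge0 -{1}s0 sup_norm_ub.
Qed.

(* The norm of a complex normed module is valued in R[i], hence the embedding of
   [holder_norm]. *)
HB.instance Definition _ :=
  Lmodule_isNormed.Build C holder holder_cnormD holder_cnormZ holder_cnorm0_eq0.

End Holder.

Section Operators.
Context {R : realType} {V : normedModType R[i]}.
Implicit Types L : {linear V -> V}.

Definition op_norm (Q : V -> V) : \bar R :=
  ereal_sup [set (complex.Re `|Q v|)%:E | v in [set v : V | `|v| <= 1]].

Definition compact_operator L : Prop :=
  compact (closure (L @` [set v : V | `|v| <= 1])).

Definition quasi_compact L : Prop :=
  (op_norm L < +oo)%E /\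
  exists (n : nat) (Q : {linear V -> V}),
    [/\ (1 <= n)%N, compact_operator Q &
        (op_norm (fun v => iter n L v - Q v)%R < 1)%E].

Definition eigenvalue_of L (z : R[i]) : Prop :=
  exists2 v : V, v != 0 & L v = z *: v.

(* Algebraic multiplicity one: the generalized eigenspace is a line. *)
Definition simple_eigenvalue L (z : R[i]) : Prop :=
  exists v : V, [/\ v != 0, L v = z *: v &
    forall (n : nat) (u : V), iter n (fun t => L t - z *: t) u = 0 ->
      exists c : R[i], u = c *: v].

Definition unique_unimodular_eigenvalue L (z : R[i]) : Prop :=
  forall y : R[i], `|y| = 1 /\ eigenvalue_of L y <-> y = z.

End Operators.

Definition spectral_gap (R : realType) (X : pmetricType R) (a : R)
    (L : {linear holder X a -> holder X a}) : Prop :=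
  quasi_compact L /\
  forall (z : R[i]) (phi : holder X a), phi != 0 -> `|z| = 1 ->
    L phi = z *: phi -> z = 1 /\ exists c : R[i], forall x, phi x = c.

Definition is_cantor_set (R : realType) (K : set R) : Prop :=
  [/\ K !=set0, compact K, perfect_set K & totally_disconnected K].

Record cantorSet (R : realType) := CantorSet {
  cantor_set : set R;
  cantor_setP : is_cantor_set cantor_set }.

Section CantorSpace.
Context {R : realType} (K : cantorSet R).

Definition cantor_pt : Type := set_type (cantor_set K).

Definition cantor_point : cantor_pt.
Proof.
have h : exists x : R, x \in cantor_set K.
  by have [[x Kx] _ _ _] := cantor_setP K; exists x; exact: mem_set.
exact: (exist _ (projT1 (cid h)) (projT2 (cid h))).
Defined.

HB.instance Definition _ := PseudoMetric.copy cantor_pt (set_type (cantor_set K)).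
HB.instance Definition _ := isPointed.Build cantor_pt cantor_point.

Definition cantor_dist (x y : cantor_pt) : R := `|val x - val y|.

Lemma cantor_dist_ge0 x y : 0 <= cantor_dist x y.
Proof. exact: normr_ge0. Qed.

Lemma cantor_dist_eq0 x y : cantor_dist x y = 0 -> x = y.
Proof. by move/normr0_eq0/eqP; rewrite subr_eq0 => /eqP/val_inj. Qed.

Lemma cantor_ballE (x : cantor_pt) (r : R) :
  ball x r = [set y | cantor_dist x y < r].
Proof. by []. Qed.

HB.instance Definition _ := PseudoMetric_isMetric.Build R cantor_pt
  cantor_dist_ge0 cantor_dist_eq0 cantor_ballE.

End CantorSpace.

Coercion cantor_pt : cantorSet >-> Sortclass.

Section Diffeomorphism.
Context {R : realType}.

Definition C1_on (U : set R) (g : R -> R) : Prop :=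
  (forall x, U x -> derivable g x 1) /\ {within U, continuous (derive1 g)}.

Definition C1_diffeo_on (U : set R) (g : R -> R) : Prop :=
  [/\ C1_on U g, open (g @` U) &
      exists2 h : R -> R, {in U, cancel g h} & C1_on (g @` U) h].

Definition homeomorphism (X : topologicalType) (g : X -> X) : Prop :=
  continuous g /\
  exists h : X -> X, [/\ cancel g h, cancel h g & continuous h].

Definition C1_diffeo (K : cantorSet R) (g : K -> K) : Prop :=
  homeomorphism g /\
  forall x : K, exists (I : set R) (gt : R -> R),
    [/\ open I, is_interval I, I (val x), C1_diffeo_on I gt &
        forall y : K, I (val y) -> gt (val y) = val (g y)].

End Diffeomorphism.

Definition random_C1_diffeos (R : realType) (d : measure_display)
    (T : measurableType d) (P : probability (pathSpace T) R) (K : cantorSet R)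
    (f : pathSpace T -> K -> K) : Prop :=
  random_map P f /\ {ae P, forall w, C1_diffeo (f w)}.

(* Such an L exists, and is then unique, exactly when phi |-> koopman P f phi
   maps C^a(X) linearly to itself; L is that operator. *)
Definition koopman_on (R : realType) (d : measure_display)
    (T : measurableType d) (P : probability (pathSpace T) R) (X : pmetricType R)
    (f : pathSpace T -> X -> X) (a : R) (L : {linear holder X a -> holder X a}) :
    Prop :=
  forall (phi : holder X a) (x : X), L phi x = koopman P f phi x.

(* Main.v *)
Require Import Defs.
From HB Require Import structures.
From mathcomp Require Import all_boot all_order all_algebra.
From mathcomp Require Import all_classical all_reals all_analysis.
From mathcomp Require Import complex.
From mathcomp Require Import measurable_realfun.
From mathcomp Require Import zify ring lra.

(* Since T is finite, f is almost surely given by finitely many C^1 diffeomorphisms g_j of K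
   with weights q_j. Let u(x) be the sum of the q_j log |g_j'(x)| and let m be a stationary
   mean maximizing m(u).

   If m(u) >= 0, then every g_j preserves m. Let I_r(x) be minus the logarithm of the mass of
   the r-chain component of x. As g_j maps components of radius r to components of radius
   about r |g_j'|, one step of the walk changes I_r by a change of scale, by u, and by minus
   the logarithm of a Jacobian, whose mean is the relative entropy of m with respect to its
   pullback by g_j. A positive relative entropy would make the mean of I_r grow linearly in
   log(1/r) faster than the number of components, of order 1/r because K lies on the line,
   and the nonnegative drift permit. Hence without a common invariant measure m(u) < 0, and
   some iterate contracts distances logarithmically in average, uniformly in x.

   A power of the distance with small exponent is then contracted in average, which gives a
   Lasota-Yorke inequality on C^a, hence quasi-compactness: the finite rank operators apply
   an iterate to the function frozen on each chain component. An eigenfunction of modulus 1 has constant ratio z along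
   every g_j on the set where its modulus is maximal; contracting words make it locally
   constant there, so z is a root of unity and its level sets are cyclically permuted.
   Conversely, disjoint invariant or cyclic sets carry locally constant functions, whose
   (twisted) Cesaro averages are eigenfunctions. *)

Set Implicit Arguments.
Unset Strict Implicit.
Unset Printing Implicit Defensive.

Import Order.TTheory GRing.Theory Num.Theory.
Import numFieldNormedType.Exports ComplexField.Normc.

Local Open Scope classical_set_scope.
Local Open Scope ring_scope.

(** * Chain components of a Cantor set *)

(** The obstacle in the invariance principle is a correlation. The change of scale caused by [u] is
    weighted by [I_r], so summing the one-step inequalities over scales brings in the mean of
    [u * I_r], about which [m u >= 0] says nothing. Maximality of [m] repairs this: it bounds the
    N-step averages of [u] by [m u + e] at every point, so bound minus average is a nonnegative
    function of mean [e]. As [I_r] exceeds [log (1 / r)] only by a tail of bounded mean, the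
    correlation costs about [e * log (1 / r)]. Replacing [u] by its N-step average is allowed
    because [I_r] moves little in mean along the maps at scales where its mean does not jump, and
    there are arbitrarily small such scales.

    Means are only finitely additive: entropy lives on finite partitions. Countable additivity
    enters when a mean has to become a Borel measure; the order of the line then supplies a quantile
    map. Almost sure statements become statements about all finite words, because every word occurs
    with positive probability. *)

Section Classes.
Context {R : realType} (K : cantorSet R).
Implicit Types (x y z : K) (r e : R) (S : set K).
Local Notation dist := (@cantor_dist R K).

Definition pos x : R := val x.

Lemma distE x y : dist x y = `|pos x - pos y|. Proof. by []. Qed.

Lemma posP x : cantor_set K (pos x). Proof. exact: set_valP. Qed.

Lemma distxx x : dist x x = 0.
Proof. by rewrite distE subrr normr0. Qed.

Lemma distC x y : dist x y = dist y x.
Proof. exact: distrC. Qed.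

Lemma dist_triangle y x z : dist x z <= dist x y + dist y z.
Proof. exact: ler_distD. Qed.

Lemma dist_gt0 x y : (0 < dist x y) = (x != y).
Proof.
rewrite lt_neqAle cantor_dist_ge0 andbT eq_sym; congr (~~ _).
by apply/idP/idP => /eqP; [move/cantor_dist_eq0=> ->|move=> ->; rewrite distxx].
Qed.

Definition saturated r S := forall y z, S y -> dist y z < r -> S z.

(* The component of [x] for chains with steps shorter than [r]. These components are open,
   finite in number for each [r], and shrink to points because K is totally disconnected. *)
Definition chain_class r x : set K :=
  [set y | forall S, saturated r S -> S x -> S y].

Lemma chain_class_saturated r x : saturated r (chain_class r x).
Proof. by move=> y z xy yz S sS Sx; apply: (sS y) => //; exact: xy. Qed.

Lemma chain_class_refl r x : chain_class r x x.
Proof. by []. Qed.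

Lemma chain_class_sub r x S : saturated r S -> S x -> chain_class r x `<=` S.
Proof. by move=> sS Sx y; exact. Qed.

Lemma chain_class_trans r y x z :
  chain_class r x y -> chain_class r y z -> chain_class r x z.
Proof. by move=> xy yz S sS Sx; apply: yz => //; exact: xy. Qed.

Lemma chain_class_sym r x y : chain_class r x y -> chain_class r y x.
Proof.
move=> /(_ [set z | chain_class r z x]); apply=> // z t /= zx zt.
apply: chain_class_trans zx; apply: (@chain_class_saturated r t t) => //.
by rewrite distC.
Qed.

Lemma chain_class_eq r x y : chain_class r x y -> chain_class r x = chain_class r y.
Proof.
move=> xy; apply/seteqP; split=> z; apply: chain_class_trans => //.
exact: chain_class_sym.
Qed.

Lemma saturatedW r r' S : r <= r' -> saturated r' S -> saturated r S.
Proof. by move=> rr sS y z Sy yz; apply: (sS y) => //; exact: lt_le_trans yz rr. Qed.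

Lemma chain_class_mono r r' x : r <= r' -> chain_class r x `<=` chain_class r' x.
Proof.
by move=> rr; apply: chain_class_sub => //; apply: saturatedW rr _; exact: chain_class_saturated.
Qed.

Lemma saturatedC r S : saturated r S -> saturated r (~` S).
Proof. by move=> sS y z nSy yz Sz; apply: nSy; apply: (sS z) => //; rewrite distC. Qed.

Lemma saturatedI r S S' : saturated r S -> saturated r S' -> saturated r (S `&` S').
Proof. by move=> sS sS' y z [Sy S'y] yz; split; [apply: sS yz|apply: sS' yz]. Qed.

(** Chosen from the class as a set, so equal classes get the same point; it serves as the label of a
    finite partition. *)
Definition class_rep r x : K := get (chain_class r x).

Lemma class_repP r x : chain_class r x (class_rep r x).
Proof. by apply: getPex; exists x. Qed.

Lemma class_rep_eq r x y : chain_class r x y -> class_rep r x = class_rep r y.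
Proof. by move=> xy; rewrite /class_rep (chain_class_eq xy). Qed.

Lemma class_rep_id r x : class_rep r (class_rep r x) = class_rep r x.
Proof. by apply/esym/class_rep_eq; exact: class_repP. Qed.

Lemma class_repE r x y : (class_rep r x = class_rep r y) <-> chain_class r x y.
Proof.
split=> [xy|]; last exact: class_rep_eq.
apply: (@chain_class_trans r (class_rep r x)); first exact: class_repP.
by rewrite xy; apply: chain_class_sym; exact: class_repP.
Qed.

Lemma cantor_bounded : exists b : R, forall x, `|pos x| <= b.
Proof.
have [_ cK _ _] := cantor_setP K.
have [M [_ HM]] := compact_bounded cK.
exists (M + 1) => x; apply: (HM (M + 1)); first by rewrite ltrDl.
exact: posP.
Qed.

(** A strict upper bound of all distances rather than the exact diameter; the added 1 makes it
    positive. *)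
Definition diam : R := projT1 (cid cantor_bounded) *+ 2 + 1.

Lemma diam_gt0 : 0 < diam.
Proof.
rewrite /diam; case: cid => b /= hb; apply: ltr_wpDl => //.
by apply: mulrn_wge0; apply: le_trans (hb point); exact: normr_ge0.
Qed.

Lemma dist_lt_diam x y : dist x y < diam.
Proof.
rewrite /diam; case: cid => b /= hb; apply: le_lt_trans (ler_normB _ _) _.
by rewrite ltr_pwDr// mulr2n lerD.
Qed.

(** Two points in one cell of a grid of mesh [r] are chained in one step, so classes are at most as
    many as cells. This count later bounds the information of the classes by the logarithm of
    [1 / r]. *)
Lemma finite_class_reps r : 0 < r -> exists s : seq K,
  [/\ uniq s, (forall x, class_rep r x \in s),
      (forall c, c \in s -> class_rep r c = c) &
      (size s)%:R <= diam / r + 1].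
Proof.
move=> r0.
have [lo [lo0 hi]] : exists lo : R, (forall x, 0 <= pos x - lo) /\ forall x, pos x - lo < diam.
  rewrite /diam; case: cid => b /= hb; exists (- b); split=> x.
    by have := hb x; rewrite opprK ler_norml => /andP[h _]; rewrite -lerBlDr sub0r.
  have := hb x; rewrite ler_norml => /andP[_ h].
  by rewrite opprK mulr2n ltr_pwDr// lerD2r.
pose cell x : nat := Num.truncn ((pos x - lo) / r).
have cell_ge0 x : 0 <= (pos x - lo) / r by rewrite divr_ge0// ltW.
have cellP x y : cell x = cell y -> dist x y < r.
  move=> xy; have /andP[h1 h2] := truncn_itv (cell_ge0 x).
  have /andP[h3 h4] := truncn_itv (cell_ge0 y).
  rewrite -/(cell x) in h1 h2; rewrite -/(cell y) -xy in h3 h4.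
  have -> : dist x y = `|(pos x - lo) / r - (pos y - lo) / r| * r.
    rewrite -mulrBl normrM (gtr0_norm (_ : 0 < r^-1)) ?invr_gt0// mulfVK ?gt_eqF//.
    by rewrite opprB addrA subrK.
  rewrite gtr_pMl// ltr_norml; rewrite -natr1 in h2 h4; lra.
pose N := Num.truncn (diam / r).
have cellN x : (cell x < N.+1)%N.
  by rewrite ltnS; apply: le_truncn; rewrite ler_pM2r ?invr_gt0// ltW.
pose pick i : K := get [set x | cell x = i].
exists (undup [seq class_rep r (pick i) | i <- iota 0 N.+1]); split.
- exact: undup_uniq.
- move=> x; rewrite mem_undup; apply/mapP; exists (cell x); first by rewrite mem_iota add0n; exact: cellN.
  apply: class_rep_eq; apply: (@chain_class_saturated r x x) => //.
  by apply: cellP; apply/esym; apply: (@getPex _ [set y | cell y = cell x]); exists x.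
- by move=> c; rewrite mem_undup => /mapP[i _ ->]; exact: class_rep_id.
- apply: (@le_trans _ _ N.+1%:R).
    by rewrite ler_nat; apply: leq_trans (size_undup _) _; rewrite size_map size_iota.
  by rewrite -natr1 lerD2r truncn_le divr_ge0// ltW// diam_gt0.
Qed.

(** Otherwise the middle third of the interval would be a nontrivial segment, hence a connected
    subset, of K. *)
Lemma cantor_gap (a b : R) : a < b -> exists2 t, a < t < b & ~ cantor_set K t.
Proof.
move=> ab; apply: contrapT => H.
have [_ _ _ tdK] := cantor_setP K.
pose a' := (a *+ 2 + b) / 3; pose b' := (a + b *+ 2) / 3.
have [aa bb ab'] : [/\ a < a', b' < b & a' < b'] by rewrite /a' /b'; split; lra.
have sK : `[a', b'] `<=` cantor_set K.
  move=> t /=; rewrite in_itv/= => /andP[t1 t2]; apply: contrapT => nKt.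
  by apply: H; exists t => //; apply/andP; split; lra.
have aI : [set` `[a', b']] a' by rewrite /= in_itv/= lexx ltW.
have bI : [set` `[a', b']] b' by rewrite /= in_itv/= lexx ltW.
have := connected_component_max aI sK (@segment_connected _ a' b') bI.
rewrite tdK; last exact: sK.
by move=> /= E; move: ab'; rewrite E ltxx.
Qed.

Lemma cantor_compl_ball (t : R) : ~ cantor_set K t ->
  exists2 e : R, 0 < e & forall x, e <= `|pos x - t|.
Proof.
move=> nKt; have [_ _ [clK _] _] := cantor_setP K.
have : open (~` cantor_set K) by exact: closed_openC.
move=> /(_ t nKt)/nbhs_ballP[e /= e0 he]; exists e => // x.
rewrite leNgt; apply/negP => h; apply: (he (pos x)); last exact: posP.
by rewrite /ball/= distrC.
Qed.

(** Each cell of a grid of mesh [e / 2] contains a point outside K. A chain whose steps are shorter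
    than the distance from K to these points cannot cross any of them, and two points at distance
    [e] have a whole cell between them. *)
Lemma chain_class_small e : 0 < e ->
  exists2 r : R, 0 < r & forall x y, chain_class r x y -> dist x y < e.
Proof.
move=> e0.
have [b hb] := cantor_bounded.
have e20 : 0 < e / 2 by rewrite divr_gt0.
pose p j : R := - b + e / 2 * j%:R.
have pS j : p j.+1 = p j + e / 2 by rewrite /p -[j.+1%:R]natr1 mulrDr mulr1 addrA.
have cut n : exists2 r : R, 0 < r & forall j x y, (j < n)%N -> pos x <= p j ->
    p j.+1 <= pos y -> ~ chain_class r x y.
  elim: n => [|n [r r0 IH]]; first by exists 1.
  have [|t /andP[t1 t2] nKt] := @cantor_gap (p n) (p n.+1); first by rewrite pS ltrDl.
  have [d d0 hd] := cantor_compl_ball nKt.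
  exists (Num.min r d); first by rewrite lt_min r0.
  move=> j x y; rewrite ltnS leq_eqVlt => /orP[/eqP ->|jn] hx hy; last first.
    move=> xy; apply: (IH j x y jn hx hy).
    by apply: chain_class_mono xy; rewrite ge_min lexx.
  move=> /(_ [set z | pos z < t]) /=; have -> : pos y < t = false by lra.
  move=> H; suff : false by []; apply: H; last by lra.
  move=> u v /= ut uv; have := hd u; have := hd v; move: uv.
  rewrite lt_min => /andP[_]; rewrite distE => uv.
  rewrite (ltr0_norm (_ : pos u - t < 0)) ?subr_lt0//.
  case: (ltP (pos v) t) => // tv; rewrite ger0_norm ?subr_ge0//.
  by move: uv; rewrite ltr_norml => /andP[]; lra.
pose N := (Num.truncn (b *+ 2 / (e / 2))).+1.
have [r r0 hr] := cut N; exists r => //.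
have main x y : chain_class r x y -> pos y - pos x < e.
  move=> xy; rewrite ltNge; apply/negP => h.
  have h0 z : 0 <= (pos z + b) / (e / 2).
    by have := hb z; rewrite ler_norml => /andP[h1 h2]; apply: divr_ge0; lra.
  pose j := Num.truncn ((pos x + b) / (e / 2)).
  have /andP[j1 j2] := truncn_itv (h0 x).
  rewrite -/j ler_pdivlMr// ltr_pdivrMr// -[j.+1%:R]natr1 in j1 j2.
  have hy : pos y <= b by have := hb y; rewrite ler_norml => /andP[].
  have jN : (j.+1 < N)%N.
    rewrite ltnS truncn_ge_nat; last first.
      by apply: divr_ge0; [rewrite mulrn_wge0// (le_trans _ (hb x))|exact: ltW].
    rewrite ler_pdivlMr// -[j.+1%:R]natr1; lra.
  apply: (hr j.+1 x y jN) => //; rewrite !pS /p; lra.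
move=> x y xy; rewrite distE ltr_norml; apply/andP; split.
  by have := main x y xy; lra.
by have := main y x (chain_class_sym xy); lra.
Qed.

Lemma cantor_perfect x e : 0 < e -> exists2 y, x != y & dist x y < e.
Proof.
move=> e0; have [_ _ [_ pK] _] := cantor_setP K.
have : limit_point (cantor_set K) (pos x) by rewrite pK; exact: posP.
move=> /(_ (ball (pos x) e) (nbhsx_ballx _ _ e0))[t [tx Kt bt]].
exists (exist _ t (mem_set Kt)); last exact: bt.
by apply: contra tx => /eqP ->.
Qed.

Lemma compact_cantor : compact [set: K].
Proof.
move=> F FF _; have [_ cK _ _] := cantor_setP K.
have FK : (pos @ F) (cantor_set K).
  by apply: (@filterS _ F _ setT); [move=> x _; exact: (posP x)|exact: filterT].
have [p [Kp clp]] := cK _ _ FK.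
exists (exist _ p (mem_set Kp)); split=> // A B FA /nbhs_ballP[e /= e0 eB].
have [|_ [[a Aa <-] ba]] := clp (pos @` A) (ball p e) _ (nbhsx_ballx _ _ e0).
  by apply: (@filterS _ F _ A) => // a Aa; exists a.
by exists a; split=> //; exact: eB.
Qed.

End Classes.

(** * Means and ultrafilter limits *)

Definition bounded_fun {T : Type} {R : numDomainType} (F : T -> R) : Prop :=
  exists B : R, forall t, `|F t| <= B.

Section BoundedFun.
Context {T : Type} {R : realType}.
Implicit Types F G : T -> R.

Lemma bounded_cst c : bounded_fun (fun _ : T => c : R).
Proof. by exists `|c|. Qed.

Lemma bounded_funD F G : bounded_fun F -> bounded_fun G ->
  bounded_fun (fun x => F x + G x).
Proof.
by move=> [B hB] [C hC]; exists (B + C) => x; apply: le_trans (ler_normD _ _) _; exact: lerD.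
Qed.

Lemma bounded_funM F G : bounded_fun F -> bounded_fun G ->
  bounded_fun (fun x => F x * G x).
Proof. by move=> [B hB] [C hC]; exists (B * C) => x; rewrite normrM ler_pM. Qed.

Lemma bounded_funN F : bounded_fun F -> bounded_fun (fun x => - F x).
Proof. by move=> [B hB]; exists B => x; rewrite normrN. Qed.

Lemma bounded_funB F G : bounded_fun F -> bounded_fun G ->
  bounded_fun (fun x => F x - G x).
Proof. by move=> bF bG; apply: bounded_funD => //; exact: bounded_funN. Qed.

Lemma bounded_fun_sum (I : Type) (s : seq I) (P : pred I) (F : I -> T -> R) :
  (forall i, bounded_fun (F i)) -> bounded_fun (fun x => \sum_(i <- s | P i) F i x).
Proof.
move=> bF; elim: s => [|i s IH].
  by exists 0 => x; rewrite big_nil normr0.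
have [B hB] : bounded_fun (fun x => F i x + \sum_(i <- s | P i) F i x) by exact: bounded_funD.
have [C hC] := IH.
exists (B + C) => x; rewrite big_cons.
have B0 : 0 <= B by apply: le_trans (hB x).
have C0 : 0 <= C by apply: le_trans (hC x).
by case: ifP => _; [apply: le_trans (hB x) _|apply: le_trans (hC x) _]; rewrite ?lerDl ?lerDr.
Qed.

Lemma bounded_fun_comp (U : Type) (h : U -> T) F :
  bounded_fun F -> bounded_fun (fun x => F (h x)).
Proof. by move=> [B hB]; exists B. Qed.

Lemma bounded_fun_norm F : bounded_fun F -> bounded_fun (fun x => `|F x|).
Proof. by move=> [B hB]; exists B => x; rewrite normr_id. Qed.

Lemma bounded_fun_max F G : bounded_fun F -> bounded_fun G ->
  bounded_fun (fun x => Num.max (F x) (G x)).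
Proof.
move=> [B hB] [C hC]; exists (B + C) => x.
have := hB x; have := hC x; have := normr_ge0 (F x); have := normr_ge0 (G x).
by case: (leP (F x) (G x)) => _; lra.
Qed.

Lemma bounded_indic (A : set T) : bounded_fun (\1_A : T -> R).
Proof. by exists 1 => x; rewrite indicE; case: (_ \in _); rewrite ?normr1 ?normr0. Qed.

End BoundedFun.

Lemma fmap_ultra (S T : Type) (f : S -> T) (U : set_system S) :
  UltraFilter U -> UltraFilter (f x @[x --> U]).
Proof.
move=> UU; split; first exact: fmap_proper_filter.
move=> G PG UG; apply/seteqP; split=> // A GA.
have [//|nA] := in_ultra_setVsetC (f @^-1` A) UU.
have : G (A `&` ~` A) by apply: filterI => //; exact: UG.
by rewrite setICr => /filter_not_empty.
Qed.

Section UltraLimit.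
Context {R : realType}.
Implicit Types a b : nat -> R.

Lemma nat_ultrafilter : exists U : set_system nat, UltraFilter U /\ \oo `<=` U.
Proof. exact: ultraFilterLemma. Qed.

Definition oo_ultra : set_system nat := projT1 (cid nat_ultrafilter).

#[export] Instance oo_ultra_filter : UltraFilter oo_ultra.
Proof. by rewrite /oo_ultra; case: cid => U []. Qed.

#[export] Instance oo_ultra_proper : ProperFilter oo_ultra.
Proof. exact: ultra_proper. Qed.

Lemma oo_ultra_sub : \oo `<=` oo_ultra.
Proof. by rewrite /oo_ultra; case: cid => U []. Qed.

(** A linear and multiplicative limit on all bounded sequences; it extends the usual limit because
    [oo_ultra] refines [\oo]. *)
Definition ulim a : R := lim (a n @[n --> oo_ultra]).

Lemma ulim_cvg a : bounded_fun a -> a n @[n --> oo_ultra] --> ulim a.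
Proof.
move=> [B hB].
have := @segment_compact R (- B) B; rewrite compact_ultra.
move=> /(_ (a n @[n --> oo_ultra]) _)[||l [_ al]].
- exact: fmap_ultra.
- by apply: (@filterS _ oo_ultra _ setT) => [n _|]; [rewrite /= in_itv/= -ler_norml|exact: filterT].
- by apply: (cvgP l).
Qed.

Lemma ulimE a l : a n @[n --> \oo] --> l -> ulim a = l.
Proof.
move=> al; apply: cvg_lim => //.
by apply: cvg_trans al => A; exact: oo_ultra_sub.
Qed.

Lemma ulim_eq a l : a n @[n --> oo_ultra] --> l -> ulim a = l.
Proof. by move=> al; exact: cvg_lim. Qed.

Lemma ulim_cst (c : R) : ulim (fun=> c) = c.
Proof. by apply: ulim_eq; exact: cvg_cst. Qed.

Lemma ulimD a b : bounded_fun a -> bounded_fun b ->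
  ulim (fun n => a n + b n) = ulim a + ulim b.
Proof. by move=> ba bb; apply: ulim_eq; apply: cvgD; exact: ulim_cvg. Qed.

Lemma ulimM a b : bounded_fun a -> bounded_fun b ->
  ulim (fun n => a n * b n) = ulim a * ulim b.
Proof. by move=> ba bb; apply: ulim_eq; apply: cvgM; exact: ulim_cvg. Qed.

Lemma ulim_le a b : bounded_fun a -> bounded_fun b -> (forall n, a n <= b n) ->
  ulim a <= ulim b.
Proof.
move=> ba bb ab; apply: ler_cvg_to (ulim_cvg ba) (ulim_cvg bb) _.
exact: nearW.
Qed.

End UltraLimit.

Arguments class_repP {R K} r x.

Lemma ler_sum_mem {R : realType} (T : eqType) (t : seq T) (F : T -> R) c :
  c \in t -> (forall i, 0 <= F i) -> F c <= \sum_(i <- t) F i.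
Proof. by move=> ct F0; rewrite (big_rem c)//= lerDl sumr_ge0. Qed.

(* A finite family of maps with probability weights. Differentiability enters only through
   [ifs_dlogP]: [ifs_dlog j x] is log |g_j'(x)|, and the estimate is uniform in [x], as for
   C^1 diffeomorphisms of a compact set. *)
Record cantor_ifs (R : realType) (K : cantorSet R) := CantorIfs {
  ifs_idx : finType;
  ifs_wt : ifs_idx -> R;
  ifs_map : ifs_idx -> K -> K;
  ifs_inv : ifs_idx -> K -> K;
  ifs_dlog : ifs_idx -> K -> R;
  ifs_wt_gt0 : forall j, 0 < ifs_wt j;
  ifs_wt_sum : \sum_j ifs_wt j = 1;
  ifs_mapK : forall j, cancel (ifs_map j) (ifs_inv j);
  ifs_invK : forall j, cancel (ifs_inv j) (ifs_map j);
  ifs_dlogP : forall e : R, 0 < e -> exists2 eta : R, 0 < eta &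
    forall j x y, cantor_dist x y < eta ->
      expR (ifs_dlog j x - e) * cantor_dist x y <=
        cantor_dist (ifs_map j x) (ifs_map j y) <=
      expR (ifs_dlog j x + e) * cantor_dist x y;
  ifs_invP : forall e : R, 0 < e -> exists2 eta : R, 0 < eta &
    forall j x y, cantor_dist (ifs_map j x) (ifs_map j y) < eta ->
      cantor_dist x y < e }.

(** * The transfer operator and the log dilation along words *)

Section Transfer.
Context {R : realType} {K : cantorSet R} (s : cantor_ifs K).
Local Notation dist := (@cantor_dist R K).
Local Notation I := (ifs_idx s).
Local Notation q := (@ifs_wt R K s).
Local Notation g := (@ifs_map R K s).
Local Notation u := (@ifs_dlog R K s).
Implicit Types (x y z : K) (r e : R) (F G : K -> R).

Lemma ifs_wt_ge0 j : 0 <= q j. Proof. exact/ltW/ifs_wt_gt0. Qed.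
#[local] Hint Resolve ifs_wt_ge0 : core.

Definition transfer F x : R := \sum_j q j * F (g j x).

Fixpoint word_map (w : seq I) x : K := if w is j :: w' then word_map w' (g j x) else x.

Fixpoint word_dlog (w : seq I) x : R :=
  if w is j :: w' then u j x + word_dlog w' (g j x) else 0.

(** Expectation over words of [n] independent letters of law [q]; the head of a word is the map
    applied first. *)
Fixpoint word_mean n (F : seq I -> R) : R :=
  if n is m.+1 then \sum_j q j * word_mean m (fun w => F (j :: w)) else F [::].

Lemma word_mean_le n (F G : seq I -> R) :
  (forall w, size w = n -> F w <= G w) -> word_mean n F <= word_mean n G.
Proof.
elim: n F G => [|n IH] F G FG /=; first exact: FG.
apply: ler_sum => j _; apply: ler_wpM2l => //; apply: IH => w wn.
by apply: FG; rewrite /= wn.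
Qed.

Lemma word_mean_eq n (F G : seq I -> R) :
  (forall w, size w = n -> F w = G w) -> word_mean n F = word_mean n G.
Proof. by move=> FG; apply/eqP; rewrite eq_le !word_mean_le// => w /FG ->. Qed.

Lemma word_meanZ n c (F : seq I -> R) :
  word_mean n (fun w => c * F w) = c * word_mean n F.
Proof.
elim: n F => //= n IH F; rewrite mulr_sumr; apply: eq_bigr => j _.
by rewrite IH mulrCA.
Qed.

Lemma word_meanD n (F G : seq I -> R) :
  word_mean n (fun w => F w + G w) = word_mean n F + word_mean n G.
Proof.
elim: n F G => //= n IH F G; rewrite -big_split; apply: eq_bigr => j _.
by rewrite IH mulrDr.
Qed.

Lemma word_mean_cst n c : word_mean n (fun=> c) = c.
Proof.
by elim: n => //= n ->; rewrite -mulr_suml ifs_wt_sum mul1r.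
Qed.

Lemma word_mean_norm n (F : seq I -> R) :
  `|word_mean n F| <= word_mean n (fun w => `|F w|).
Proof.
elim: n F => //= n IH F; apply: le_trans (ler_norm_sum _ _ _) _.
apply: ler_sum => j _; rewrite normrM (ger0_norm (ifs_wt_ge0 j)).
exact: ler_wpM2l.
Qed.

Lemma iter_transferE n F x :
  iter n transfer F x = word_mean n (fun w => F (word_map w x)).
Proof.
elim: n x => //= n IH x; apply: eq_bigr => j _; by rewrite IH.
Qed.

Lemma transferD F G x : transfer (fun y => F y + G y) x = transfer F x + transfer G x.
Proof. by rewrite /transfer -big_split; apply: eq_bigr => j _; rewrite mulrDr. Qed.

Lemma transferZ c F x : transfer (fun y => c * F y) x = c * transfer F x.
Proof. by rewrite /transfer mulr_sumr; apply: eq_bigr => j _; rewrite mulrCA. Qed.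

Lemma transfer_sum (J : Type) (t : seq J) (P : pred J) (F : J -> K -> R) x :
  transfer (fun y => \sum_(i <- t | P i) F i y) x = \sum_(i <- t | P i) transfer (F i) x.
Proof.
by rewrite /transfer exchange_big; apply: eq_bigr => j _; rewrite mulr_sumr.
Qed.

Lemma transfer_norm_le F B : (forall x, `|F x| <= B) -> forall x, `|transfer F x| <= B.
Proof.
move=> FB x; apply: le_trans (@word_mean_norm 1 (fun w => F (word_map w x))) _.
by rewrite -(word_mean_cst 1 B); apply: word_mean_le => w _; exact: FB.
Qed.

Lemma iter_transfer_norm_le n F B : (forall x, `|F x| <= B) ->
  forall x, `|iter n transfer F x| <= B.
Proof. by move=> FB; elim: n => //= n IH; exact: transfer_norm_le. Qed.

Lemma bounded_transfer F : bounded_fun F -> bounded_fun (transfer F).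
Proof. by move=> [B hB]; exists B; exact: transfer_norm_le. Qed.

Lemma bounded_iter_transfer n F : bounded_fun F -> bounded_fun (iter n transfer F).
Proof. by move=> [B hB]; exists B; exact: iter_transfer_norm_le. Qed.

(** The dilation estimates at [(x, y)] and at [(y, x)] concern the same two distances; comparing the
    lower bound of one with the upper bound of the other controls the variation of [u]. *)
Lemma dlog_cont e : 0 < e -> exists2 eta : R, 0 < eta &
  forall j x y, dist x y < eta -> `|u j x - u j y| <= e.
Proof.
move=> e0; have [|eta eta0 h] := @ifs_dlogP _ _ s (e / 2); first by rewrite divr_gt0.
exists eta => // j x y xy; have [->|nxy] := eqVneq x y; first by rewrite subrr normr0 ltW.
have d0 : 0 < dist x y by rewrite dist_gt0.
have /andP[h1 h2] := h j x y xy.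
rewrite distC in xy; have /andP[h3 h4] := h j y x xy.
rewrite (distC y x) (distC (g j y)) in h3 h4.
have := le_trans h1 h4; rewrite ler_pM2r// ler_expR => k1.
have := le_trans h3 h2; rewrite ler_pM2r// ler_expR => k2.
rewrite ler_norml; lra.
Qed.

Lemma dlog_bounded : exists2 B : R, 0 < B & forall j x, `|u j x| <= B.
Proof.
have [eta eta0 h] := dlog_cont (@ltr01 R).
have [r r0 hr] := chain_class_small K eta0.
have [t [_ ht _ _]] := finite_class_reps K r0.
exists (1 + \sum_j \sum_(c <- t) `|u j c|).
  by rewrite ltr_pwDl// sumr_ge0// => j _; rewrite sumr_ge0.
move=> j x; have := h j x (class_rep r x) (hr _ _ (class_repP r x)).
move=> h1; have : `|u j (class_rep r x)| <= \sum_j \sum_(c <- t) `|u j c|.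
  rewrite (bigD1 j)//=.
  have /le_trans := @ler_sum_mem _ _ t (fun c => `|u j c|) _ (ht x) (fun=> normr_ge0 _); apply.
  by rewrite lerDl sumr_ge0// => k _; rewrite sumr_ge0.
move=> h2; have := ler_distD (u j (class_rep r x)) (u j x) 0; rewrite !subr0; lra.
Qed.

Lemma word_dlog_bounded : exists2 B : R, 0 < B &
  forall w x, `|word_dlog w x| <= B *+ size w.
Proof.
have [B B0 hB] := dlog_bounded; exists B => //.
elim=> /= [|j w IH] x; first by rewrite normr0 mulr0n.
by rewrite mulrS; apply: le_trans (ler_normD _ _) _; apply: lerD.
Qed.

Lemma word_dist n e : 0 < e -> exists2 eta : R, 0 < eta &
  forall w x y, size w = n -> dist x y < eta ->
    expR (word_dlog w x - e *+ n) * dist x y <= dist (word_map w x) (word_map w y)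
      <= expR (word_dlog w x + e *+ n) * dist x y.
Proof.
move=> e0; elim: n => [|n [eta eta0 IH]].
  exists 1 => // w x y /size0nil -> _ /=.
  by rewrite mulr0n subr0 addr0 expR0 mul1r lexx.
have [B B0 hB] := dlog_bounded.
have [eta1 eta10 h] := @ifs_dlogP _ _ s e e0.
(* One map expands by at most [expR (B + e)], so the images stay within reach of the induction
   hypothesis. *)
exists (Num.min eta1 (eta / expR (B + e))).
  by rewrite lt_min eta10/= divr_gt0// expR_gt0.
move=> [|j w]//= x y [wn]; rewrite lt_min => /andP[xy1 xy2].
have /andP[h1 h2] := h j x y xy1.
have gxy : dist (g j x) (g j y) < eta.
  apply: le_lt_trans h2 _; rewrite -ltr_pdivlMl ?expR_gt0//.
  apply: lt_le_trans xy2 _; rewrite mulrC ler_pM2r// lef_pV2 ?posrE ?expR_gt0//.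
  by rewrite ler_expR lerD2r; apply: le_trans (ler_norm _) (hB j x).
have /andP[h3 h4] := IH w (g j x) (g j y) wn gxy.
apply/andP; split.
  apply: le_trans h3.
  have -> : u j x + word_dlog w (g j x) - e *+ n.+1 =
    (word_dlog w (g j x) - e *+ n) + (u j x - e) by rewrite mulrS; ring.
  by rewrite expRD -mulrA ler_pM2l ?expR_gt0.
apply: le_trans h4 _.
have -> : u j x + word_dlog w (g j x) + e *+ n.+1 =
    (word_dlog w (g j x) + e *+ n) + (u j x + e) by rewrite mulrS; ring.
by rewrite (expRD (_ + e *+ n)) -mulrA ler_pM2l ?expR_gt0.
Qed.

(** Close points obey the dilation estimate; at distance at least [eta] the ratio is at most
    [diam K / eta]. *)
Lemma ifs_lip : exists2 M : R, 1 <= M &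
  forall j x y, dist (g j x) (g j y) <= M * dist x y.
Proof.
have [B B0 hB] := dlog_bounded.
have [eta eta0 h] := @ifs_dlogP _ _ s 1 ltr01.
exists (Num.max (expR (B + 1)) (diam K / eta)).
  by rewrite le_max; apply/orP; left; rewrite -[leLHS]expR0 ler_expR; lra.
move=> j x y; have [xy|xy] := ltP (dist x y) eta.
  have /andP[_ h2] := h j x y xy; apply: le_trans h2 _.
  apply: ler_wpM2r; first exact: cantor_dist_ge0.
  rewrite le_max; apply/orP; left.
  by rewrite ler_expR lerD2r; apply: le_trans (ler_norm _) (hB j x).
apply: (@le_trans _ _ (diam K / eta * dist x y)); last first.
  by apply: ler_wpM2r; [exact: cantor_dist_ge0|rewrite le_max lexx orbT].
apply: le_trans (ltW (dist_lt_diam _ _)) _.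
by rewrite -mulrA ler_peMr ?(ltW (diam_gt0 K))// mulrC ler_pdivlMr// mul1r.
Qed.

Definition mean_dlog x : R := \sum_j q j * u j x.

(** The expected log dilation at [x] of a random word of length [n] ([word_mean_dlog]), in the form
    of a Birkhoff sum. *)
Definition drift n x : R := \sum_(k < n) iter k transfer mean_dlog x.

Lemma driftS n x : drift n.+1 x = mean_dlog x + transfer (drift n) x.
Proof.
by rewrite /drift big_ord_recl /= transfer_sum; congr (_ + _).
Qed.

Lemma word_mean_dlog n x : word_mean n (fun w => word_dlog w x) = drift n x.
Proof.
elim: n x => [|n IH] x; first by rewrite /drift big_ord0.
rewrite driftS /mean_dlog /transfer -big_split /=; apply: eq_bigr => j _.
by rewrite word_meanD word_mean_cst IH mulrDr.
Qed.

Lemma bounded_mean_dlog : bounded_fun mean_dlog.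
Proof.
have [B B0 hB] := dlog_bounded; exists B => x.
apply: le_trans (ler_norm_sum _ _ _) _.
rewrite -[leRHS]mul1r -(ifs_wt_sum s) mulr_suml; apply: ler_sum => j _.
by rewrite normrM (ger0_norm (ifs_wt_ge0 j)) ler_wpM2l.
Qed.

Lemma bounded_drift n : bounded_fun (drift n).
Proof. by apply: bounded_fun_sum => k; apply: bounded_iter_transfer; exact: bounded_mean_dlog. Qed.

End Transfer.

(* Stationary measures are replaced by finitely additive means on all bounded functions;
   they exist as ultrafilter limits of Cesaro averages, without any measurability. *)
Record is_mean {R : realType} {X : Type} (m : (X -> R) -> R) : Prop := IsMean {
  meanD : forall F G, bounded_fun F -> bounded_fun G ->
    m (fun x => F x + G x) = m F + m G;
  meanZ : forall c F, bounded_fun F -> m (fun x => c * F x) = c * m F;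
  mean_le : forall F G, bounded_fun F -> bounded_fun G ->
    (forall x, F x <= G x) -> m F <= m G;
  mean_cst : forall c, m (fun=> c) = c }.

Section MeanTheory.
Context {R : realType} {X : Type} (m : (X -> R) -> R) (mm : is_mean m).
Implicit Types F G : X -> R.

Lemma meanN F : bounded_fun F -> m (fun x => - F x) = - m F.
Proof.
move=> bF; rewrite -mulN1r -(meanZ mm)//.
by congr m; apply/funext => x; rewrite mulN1r.
Qed.

Lemma meanB F G : bounded_fun F -> bounded_fun G ->
  m (fun x => F x - G x) = m F - m G.
Proof. by move=> bF bG; rewrite (meanD mm) ?meanN//; exact: bounded_funN. Qed.

Lemma mean_sum (J : Type) (t : seq J) (P : pred J) (F : J -> X -> R) :
  (forall i, bounded_fun (F i)) ->
  m (fun x => \sum_(i <- t | P i) F i x) = \sum_(i <- t | P i) m (F i).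
Proof.
move=> bF; elim: t => [|i t IH].
  by rewrite big_nil -[RHS](mean_cst mm); congr m; apply/funext => x; rewrite big_nil.
rewrite big_cons -IH; case: ifP => Pi.
  by rewrite -(meanD mm)//; [congr m; apply/funext => x; rewrite big_cons Pi
    |exact: bounded_fun_sum].
by congr m; apply/funext => x; rewrite big_cons Pi.
Qed.

Lemma mean_ge0 F : bounded_fun F -> (forall x, 0 <= F x) -> 0 <= m F.
Proof.
by move=> bF F0; rewrite -[leLHS](mean_cst mm); apply: (mean_le mm) => //; exact: bounded_cst.
Qed.

Lemma mean_norm F : bounded_fun F -> `|m F| <= m (fun x => `|F x|).
Proof.
move=> bF; rewrite ler_norml -meanN; last exact: bounded_fun_norm.
apply/andP; split; apply: (mean_le mm) => //; try exact: bounded_fun_norm.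
- by apply: bounded_funN; exact: bounded_fun_norm.
- by move=> x; have := lerNnormlW (lexx `|F x|); lra.
- by move=> x; exact: ler_norm.
Qed.

End MeanTheory.

Section Stationary.
Context {R : realType} {K : cantorSet R} (s : cantor_ifs K).
Local Notation L := (transfer s).
Implicit Types (F G : K -> R) (B c e : R).

Record stationary_mean (m : (K -> R) -> R) : Prop := StationaryMean {
  stationary_is_mean : is_mean m;
  mean_transfer : forall F, bounded_fun F -> m (L F) = m F }.

Definition cesaro n F (x : K) : R := n.+1%:R^-1 * \sum_(k < n.+1) iter k L F x.

(** The starting point may change with [n]: this is how points that are extremal at each time are
    followed to the limit. *)
Definition krylov (x : nat -> K) F : R := ulim (fun n => cesaro n F (x n)).

Lemma cesaro_norm_le n F B : (forall x, `|F x| <= B) -> forall x, `|cesaro n F x| <= B.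
Proof.
move=> FB x; rewrite /cesaro normrM ger0_norm ?invr_ge0//.
rewrite ler_pdivrMl ?ltr0n//; apply: le_trans (ler_norm_sum _ _ _) _.
rewrite mulr_natl -[in leRHS](card_ord n.+1) -sumr_const; apply: ler_sum => i _.
exact: iter_transfer_norm_le.
Qed.

Lemma bounded_cesaro F (x : nat -> K) : bounded_fun F ->
  bounded_fun (fun n => cesaro n F (x n)).
Proof. by move=> [B hB]; exists B => n; exact: cesaro_norm_le. Qed.

Lemma iter_transferD k F G x :
  iter k L (fun y => F y + G y) x = iter k L F x + iter k L G x.
Proof. by rewrite !iter_transferE word_meanD. Qed.

Lemma iter_transferZ k c F x : iter k L (fun y => c * F y) x = c * iter k L F x.
Proof. by rewrite !iter_transferE word_meanZ. Qed.

Lemma iter_transfer_cst k c x : iter k L (fun=> c) x = c.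
Proof. by rewrite !iter_transferE word_mean_cst. Qed.

Lemma iter_transfer_le k F G x : (forall y, F y <= G y) -> iter k L F x <= iter k L G x.
Proof. by move=> FG; rewrite !iter_transferE; apply: word_mean_le. Qed.

Lemma cesaroD n F G x : cesaro n (fun y => F y + G y) x = cesaro n F x + cesaro n G x.
Proof.
by rewrite /cesaro -mulrDr -big_split; congr (_ * _); apply: eq_bigr => k _; rewrite iter_transferD.
Qed.

Lemma cesaroZ n c F x : cesaro n (fun y => c * F y) x = c * cesaro n F x.
Proof.
rewrite /cesaro [RHS]mulrCA; congr (_ * _); rewrite mulr_sumr; apply: eq_bigr => k _.
exact: iter_transferZ.
Qed.

Lemma cesaro_cst n c x : cesaro n (fun=> c) x = c.
Proof.
rewrite /cesaro (eq_bigr (fun=> c)) => [|k _]; last exact: iter_transfer_cst.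
by rewrite sumr_const card_ord -[c *+ _]mulr_natl mulKf.
Qed.

Lemma cesaro_le n F G x : (forall y, F y <= G y) -> cesaro n F x <= cesaro n G x.
Proof.
move=> FG; rewrite ler_wpM2l ?invr_ge0//; apply: ler_sum => k _; exact: iter_transfer_le.
Qed.

Lemma cesaro_transfer n F x :
  cesaro n (L F) x = cesaro n F x + n.+1%:R^-1 * (iter n.+1 L F x - F x).
Proof.
rewrite /cesaro -mulrDr; congr (_ * _).
rewrite [in RHS]big_ord_recl big_ord_recr /= -iterSr.
rewrite (eq_bigr (fun k : 'I_n => iter k.+1 L F x)) => [|k _]; last by rewrite -iterSr.
set S := \sum_(i < n) _; change (S + iter n.+1 L F x = F x + S + (iter n.+1 L F x - F x)).
ring.
Qed.

Lemma krylov_stationary x : stationary_mean (krylov x).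
Proof.
split; first split.
- move=> F G bF bG; rewrite /krylov -ulimD; try exact: bounded_cesaro.
  by congr ulim; apply/funext => n; rewrite cesaroD.
- move=> c F bF; rewrite /krylov -[in RHS](ulim_cst c) -ulimM; last exact: bounded_cesaro.
    by congr ulim; apply/funext => n; rewrite cesaroZ.
  exact: bounded_cst.
- move=> F G bF bG FG; apply: ulim_le => [| |n]; try exact: bounded_cesaro.
  exact: cesaro_le.
- by move=> c; rewrite /krylov -[RHS]ulim_cst; congr ulim; apply/funext => n; rewrite cesaro_cst.
- move=> F bF; have [B hB] := bF.
  (* The averages of [F] and of [L F] differ by this boundary term, whatever the points [x n]. *)
  have d0 : n.+1%:R^-1 * (iter n.+1 L F (x n) - F (x n)) @[n --> \oo] --> (0 : R).
    apply/norm_cvg0P; apply: (@squeeze_cvgr _ _ _ _ (fun=> 0) (fun n => n.+1%:R^-1 * (B + B))).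
    + near=> n; rewrite normr_ge0 normrM ger0_norm ?invr_ge0//= ler_wpM2l ?invr_ge0//.
      by apply: le_trans (ler_normB _ _) _; apply: lerD => //; exact: (iter_transfer_norm_le s n.+1 hB).
    + exact: cvg_cst.
    + by rewrite -[X in _ --> X](mul0r (B + B)); apply: cvgMl; exact: cvg_harmonic.
  rewrite /krylov -[RHS]addr0 -(ulimE d0) -ulimD; last 2 first.
  + exact: bounded_cesaro.
  + exists (B + B) => n; rewrite normrM ger0_norm ?invr_ge0// ler_pdivrMl//.
    apply: le_trans (ler_normB _ _) _; apply: (@le_trans _ _ (1 * (B + B))).
      by rewrite mul1r; apply: lerD => //; exact: (iter_transfer_norm_le s n.+1 hB).
    by apply: ler_wpM2r; [rewrite addr_ge0// (le_trans _ (hB (x n)))|rewrite ler1n].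
  by congr ulim; apply/funext => n; exact: cesaro_transfer.
Unshelve. all: by end_near. Qed.

Lemma mean_iter_transfer m k F : stationary_mean m -> bounded_fun F -> m (iter k L F) = m F.
Proof.
move=> sm bF; elim: k => //= k IH; rewrite (mean_transfer sm)//.
exact: bounded_iter_transfer.
Qed.

Lemma mean_drift m n : stationary_mean m -> m (drift s n) = n%:R * m (mean_dlog s).
Proof.
move=> sm; have mm := stationary_is_mean sm.
rewrite /drift (mean_sum mm) => [|k]; last by apply: bounded_iter_transfer; exact: bounded_mean_dlog.
rewrite (eq_bigr (fun=> m (mean_dlog s))) => [|k _].
  by rewrite sumr_const card_ord mulr_natl.
by apply: mean_iter_transfer => //; exact: bounded_mean_dlog.
Qed.

(** The supremum of [m (mean_dlog s)] is attained by a Krylov limit along points whose averages are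
    nearly the supremum; they exist because a stationary mean does not see the averaging. If for
    every [n] some average exceeded the supremum by [e], a Krylov limit along those points would
    beat it. *)
Lemma maximal_stationary_mean : exists2 m, stationary_mean m &
  forall e, 0 < e -> exists2 n, (0 < n)%N &
    forall x, drift s n x <= n%:R * (m (mean_dlog s) + e).
Proof.
pose E := [set c | exists2 m, stationary_mean m & c = m (mean_dlog s)].
have [B hB] := bounded_mean_dlog s.
have ubE : has_sup E.
  split; first by exists (krylov (fun=> point) (mean_dlog s)), (krylov (fun=> point)) => //; exact: krylov_stationary.
  exists B => _ [m sm ->]; have mm := stationary_is_mean sm.
  rewrite -(mean_cst mm B); apply: (mean_le mm); [exact: bounded_mean_dlog|exact: bounded_cst|].
  by move=> x; apply: le_trans (ler_norm _) (hB x).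
have /choice[x hx] n : exists x, sup E - n.+1%:R^-1 <= cesaro n (mean_dlog s) x.
  have n0 : 0 < n.+1%:R^-1 :> R by rewrite invr_gt0.
  have [_ [m sm ->] hm] := sup_adherent n0 ubE.
  apply: contrapT => /forallNP nx.
  have mm := stationary_is_mean sm.
  have : m (cesaro n (mean_dlog s)) <= sup E - n.+1%:R^-1.
    rewrite -[leRHS](mean_cst mm); apply: (mean_le mm); [|exact: bounded_cst|].
      by exists B; exact: cesaro_norm_le.
    by move=> x; rewrite ltW// ltNge; exact/negP.
  rewrite (_ : cesaro n _ = fun x => n.+1%:R^-1 * drift s n.+1 x)// (meanZ mm) ?mean_drift//.
    by rewrite mulKf// leNgt hm.
  exact: bounded_drift.
exists (krylov x); first exact: krylov_stationary.
have supE : sup E <= krylov x (mean_dlog s).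
  have h0 : (sup E - n.+1%:R^-1 : R) @[n --> \oo] --> sup E.
    by rewrite -[X in _ --> X]subr0; apply: cvgB; [exact: cvg_cst|exact: cvg_harmonic].
  rewrite -(ulimE h0); apply: ulim_le => //; last by apply: bounded_cesaro; exact: bounded_mean_dlog.
  apply: bounded_funB; first exact: bounded_cst.
  by exists 1 => n; rewrite ger0_norm ?invr_ge0// invf_le1// ler1n.
move=> e e0; apply: contrapT => ne.
have /choice[y hy] n : exists y, sup E + e <= cesaro n (mean_dlog s) y.
  apply: contrapT => /forallNP ny; apply: ne; exists n.+1 => // y.
  rewrite -ler_pdivrMl//; apply: (@le_trans _ _ (sup E + e)); last by rewrite lerD2r.
  by rewrite ltW// ltNge; apply/negP; exact: ny.
have : krylov y (mean_dlog s) <= sup E.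
  by apply: ub_le_sup; [exact: (proj2 ubE)|exists (krylov y) => //; exact: krylov_stationary].
apply/negP; rewrite -ltNge; apply: (@lt_le_trans _ _ (sup E + e)); first by rewrite ltrDl.
rewrite -(ulim_cst (sup E + e)); apply: ulim_le => //; first exact: bounded_cst.
by apply: bounded_cesaro; exact: bounded_mean_dlog.
Qed.

End Stationary.

(** * Relative entropy and the invariance principle *)

Section MeanLabels.
Context {R : realType} {X : Type}.
Implicit Types (m n : (X -> R) -> R) (F G : X -> R).

Lemma mean_indic_ge0 m (A : set X) : is_mean m -> 0 <= m (\1_A).
Proof.
move=> mm; apply: (mean_ge0 mm); first exact: bounded_indic.
by move=> x; rewrite indicE; case: (_ \in _).
Qed.

Lemma mean_indic_le m (A B : set X) : is_mean m -> A `<=` B -> m (\1_A) <= m (\1_B).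
Proof.
move=> mm AB; apply: (mean_le mm); try exact: bounded_indic.
move=> x; rewrite !indicE ler_nat; case: (boolP (x \in A)) => // /set_mem/AB/mem_set -> //.
Qed.

Lemma mean_indic_le1 m (A : set X) : is_mean m -> m (\1_A) <= 1.
Proof.
move=> mm; rewrite -[leRHS](mean_cst mm); apply: (mean_le mm).
- exact: bounded_indic.
- exact: bounded_cst.
- by move=> x; rewrite indicE; case: (_ \in _).
Qed.

Lemma mean_le_ae m F G (Z : set X) : is_mean m -> bounded_fun F -> bounded_fun G ->
  m (\1_Z) = 0 -> (forall x, ~ Z x -> F x <= G x) -> m F <= m G.
Proof.
move=> mm bF bG mZ FG; have [B hB] := bF; have [C hC] := bG.
have -> : m G = m (fun x => G x + (B + C) * \1_Z x).
  rewrite (meanD mm)//; last by apply: bounded_funM; [exact: bounded_cst|exact: bounded_indic].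
  by rewrite (meanZ mm) ?mZ ?mulr0 ?addr0//; exact: bounded_indic.
apply: (mean_le mm) => //.
  by apply: bounded_funD => //; apply: bounded_funM; [exact: bounded_cst|exact: bounded_indic].
move=> x; rewrite indicE; case: (boolP (x \in Z)) => [_|/negP xZ].
  rewrite mulr1; have := hB x; have := hC x; rewrite !ler_norml; lra.
by rewrite mulr0 addr0; apply: FG => Zx; apply: xZ; exact: mem_set.
Qed.

Lemma mean_null_setU m (Y Z : set X) : is_mean m -> m (\1_Y) = 0 -> m (\1_Z) = 0 ->
  m (\1_(Y `|` Z)) = 0.
Proof.
move=> mm Y0 Z0; apply/eqP; rewrite eq_le mean_indic_ge0// andbT.
rewrite -[leRHS]addr0 -{1}Y0 -Z0 -(meanD mm); try exact: bounded_indic.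
apply: (mean_le mm); [exact: bounded_indic|by apply: bounded_funD; exact: bounded_indic|].
move=> x; rewrite !indicE in_setU; case: (x \in Y); case: (x \in Z); rewrite //= ?addr0 ?add0r//; lra.
Qed.

Context {T : eqType} (rho : X -> T) (t : seq T).
Hypotheses (ut : uniq t) (rt : forall x, rho x \in t).

Definition cell (a : T) : set X := [set x | rho x = a].

Lemma label_expand (F : T -> R) x : F (rho x) = \sum_(a <- t) F a * \1_(cell a) x.
Proof.
rewrite (bigD1_seq (rho x))//= big1 => [|a /negPf ax].
  by rewrite addr0 indicE mem_set// mulr1.
by rewrite indicE memNset ?mulr0// => h; move: ax; rewrite -h eqxx.
Qed.

Lemma bounded_label (F : T -> R) : bounded_fun (fun x => F (rho x)).
Proof.
have [B hB] : bounded_fun (fun x => \sum_(a <- t) F a * \1_(cell a) x).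
  by apply: bounded_fun_sum => a; apply: bounded_funM; [exact: bounded_cst|exact: bounded_indic].
by exists B => x; rewrite label_expand.
Qed.

Lemma mean_label m (F : T -> R) : is_mean m ->
  m (fun x => F (rho x)) = \sum_(a <- t) F a * m (\1_(cell a)).
Proof.
move=> mm; transitivity (m (fun x => \sum_(a <- t) F a * \1_(cell a) x)).
  by congr m; apply/funext => x; rewrite label_expand.
rewrite (mean_sum mm) => [|a]; last by apply: bounded_funM; [exact: bounded_cst|exact: bounded_indic].
by apply: eq_bigr => a _; rewrite (meanZ mm)//; exact: bounded_indic.
Qed.

Lemma mean_label_sum m : is_mean m -> \sum_(a <- t) m (\1_(cell a)) = 1.
Proof.
move=> mm; rewrite -(mean_cst mm 1) (mean_label (fun=> 1) mm).
by apply: eq_bigr => a _; rewrite mul1r.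
Qed.

Lemma mean_null_cells m : is_mean m -> m (\1_[set x | m (\1_(cell (rho x))) = 0]) = 0.
Proof.
move=> mm; pose F (a : T) : R := (m (\1_(cell a)) == 0)%:R.
rewrite (_ : \1__ = (fun x => F (rho x))); last first.
  by apply/funext => x; rewrite indicE /F; congr ((nat_of_bool _)%:R); apply/idP/eqP => [/set_mem|/mem_set].
rewrite (mean_label F mm) big1// => a _; rewrite /F.
by case: eqP => [->|_]; rewrite ?mulr0 ?mul0r.
Qed.

(** The density of [n] with respect to [m] on a finite partition. It is 0 on cells that [m] does not
    charge, so mass of [n] may be lost there and [mean_likelihood_le] is only an inequality. *)
Definition likelihood m n (a : T) : R := n (\1_(cell a)) / m (\1_(cell a)).

Lemma likelihood_ge0 m n a : is_mean m -> is_mean n -> 0 <= likelihood m n a.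
Proof. by move=> mm mn; rewrite divr_ge0// mean_indic_ge0. Qed.

Lemma mean_likelihood_le m n (G : T -> R) : is_mean m -> is_mean n ->
  (forall a, 0 <= G a) ->
  m (fun x => likelihood m n (rho x) * G (rho x)) <= n (fun x => G (rho x)).
Proof.
move=> mm mn G0; rewrite (mean_label (fun a => likelihood m n a * G a) mm) (mean_label G mn).
apply: ler_sum => a _; rewrite mulrAC mulrC ler_wpM2l// /likelihood.
have := mean_indic_ge0 (cell a) mm; rewrite le_eqVlt => /orP[/eqP <-|m0].
  by rewrite mulr0 mean_indic_ge0.
by rewrite divfK// gt_eqF.
Qed.

(** A cell of mass [y] contributes at most [expR (- c)], because [- ln y - c <= expR (- ln y - c) =
    expR (- c) / y]. *)
Lemma mean_entropy_tail m c : is_mean m ->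
  m (fun x => Num.max 0 (- ln (m (\1_(cell (rho x)))) - c)) <= (size t)%:R * expR (- c).
Proof.
move=> mm; rewrite (mean_label (fun a => Num.max 0 (- ln (m (\1_(cell a))) - c)) mm).
have -> : (size t)%:R * expR (- c) = \sum_(a <- t) expR (- c).
  by rewrite big_const_seq count_predT iter_addr_0 mulr_natl.
apply: ler_sum => a _; have := mean_indic_ge0 (cell a) mm.
set y := m _; rewrite le_eqVlt => /orP[/eqP <-|y0].
  by rewrite mulr0 expR_ge0.
have [|h] := leP (- ln y - c) 0; first by rewrite mul0r expR_ge0.
have h2 := expR_ge1Dx (- ln y - c).
have e : expR (- ln y - c) = y^-1 * expR (- c) by rewrite expRD expRN lnK.
rewrite e in h2; rewrite -ler_pdivlMr// mulrC; lra.
Qed.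

End MeanLabels.

Lemma ln_lt_sub1 {R : realType} (x : R) : 0 < x -> x != 1 -> ln x < x - 1.
Proof.
move=> x0 x1; have lx : ln x != 0 by rewrite ln_eq0.
by have := expR_gt1Dx lx; rewrite lnK// => h; lra.
Qed.

Lemma ln_le_sub1 {R : realType} (x : R) : 0 < x -> ln x <= x - 1.
Proof. by move=> x0; have := expR_ge1Dx (ln x); rewrite lnK// => h; lra. Qed.

Section RelativeEntropy.
Context {R : realType} {X : Type} (m n : (X -> R) -> R).
Hypotheses (mm : is_mean m) (mn : is_mean n).
Context (c : R) (c0 : 0 < c) (dom : forall A, c * m (\1_A) <= n (\1_A)).

(** The domination [dom] plays the role of absolute continuity of [m] with respect to [n]:
    logarithms of likelihoods are genuine on every cell charged by [m]. *)
Lemma likelihood_gt0 (T : eqType) (rho : X -> T) a :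
  0 < m (\1_(cell rho a)) -> 0 < likelihood rho m n a.
Proof.
by move=> m0; rewrite divr_gt0//; apply: lt_le_trans (dom _); rewrite mulr_gt0.
Qed.

(** Relative entropy grows under refinement. With [J] the fine and [sg] the coarse likelihood,
    [ln (J / sg) <= J / sg - 1], and [J / sg] has mean at most 1 since [1 / sg] is the coarse
    likelihood with [m] and [n] exchanged. *)
Lemma mean_likelihood_refine (T U : eqType) (rho : X -> T) (t : seq T) (f : T -> U)
    (tU : seq U) :
  uniq t -> (forall x, rho x \in t) -> uniq tU -> (forall x, f (rho x) \in tU) ->
  m (fun x => ln (likelihood rho m n (rho x))) <=
  m (fun x => ln (likelihood (f \o rho) m n (f (rho x)))).
Proof.
move=> ut rt uU rU; pose sg a := likelihood (f \o rho) m n (f a).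
have b1 := bounded_label ut rt (fun a => ln (sg a)).
have b2 := bounded_label ut rt (fun a => likelihood rho m n a * (sg a)^-1).
apply: (@le_trans _ _ (m (fun x => ln (sg (rho x)) +
    (likelihood rho m n (rho x) * (sg (rho x))^-1 - 1)))).
  have b3 := bounded_label ut rt (fun a => ln (likelihood rho m n a)).
  have b4 := bounded_label ut rt (fun a => ln (sg a) + (likelihood rho m n a * (sg a)^-1 - 1)).
  apply: (mean_le_ae mm b3 b4 (mean_null_cells ut rt mm)).
  move=> x /= /eqP xm.
  have m0 : 0 < m (\1_(cell rho (rho x))) by rewrite lt_neqAle eq_sym xm mean_indic_ge0.
  have J0 := likelihood_gt0 m0.
  have s0 : 0 < sg (rho x).
    apply: likelihood_gt0; apply: lt_le_trans m0 _; apply: mean_indic_le => //.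
    by move=> y /=; rewrite /cell/= => ->.
  have := @ln_le_sub1 _ (likelihood rho m n (rho x) * (sg (rho x))^-1) (mulr_gt0 J0 _).
  rewrite invr_gt0 => /(_ s0); rewrite lnM ?posrE ?invr_gt0// lnV ?posrE//; lra.
rewrite (meanD mm)//; last by apply: bounded_funB => //; exact: bounded_cst.
rewrite gerDl (meanB mm)//; last exact: bounded_cst.
rewrite (mean_cst mm) subr_le0.
have sg0 a : 0 <= (sg a)^-1 by rewrite invr_ge0 likelihood_ge0.
have /le_trans := mean_likelihood_le ut rt mm mn sg0; apply.
have := @mean_likelihood_le _ _ _ (f \o rho) tU uU rU n m (fun=> 1) mn mm (fun=> ler01).
rewrite (mean_cst mm); apply: le_trans; apply: (mean_le mn).
- exact: (bounded_label ut rt (fun a => (sg a)^-1)).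
- by apply: (bounded_label uU rU (fun a => likelihood (f \o rho) n m a * 1)).
- by move=> x; rewrite /= mulr1 /sg /likelihood invf_div.
Qed.

Lemma mean_ln_likelihoodE (T : eqType) (rho : X -> T) (t : seq T) :
  uniq t -> (forall x, rho x \in t) ->
  m (fun x => ln (likelihood rho m n (rho x))) =
  \sum_(a <- t) ln (likelihood rho m n a) * m (\1_(cell rho a)).
Proof. by move=> ut rt; rewrite (mean_label ut rt (fun a => ln (likelihood rho m n a)) mm). Qed.

Lemma ln_likelihood_term_le (T : eqType) (rho : X -> T) a :
  ln (likelihood rho m n a) * m (\1_(cell rho a)) <= n (\1_(cell rho a)) - m (\1_(cell rho a)).
Proof.
have := mean_indic_ge0 (cell rho a) mm; rewrite le_eqVlt => /orP[/eqP <-|m0].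
  by rewrite mulr0 subr0 mean_indic_ge0.
have := ln_le_sub1 (likelihood_gt0 m0); rewrite -(ler_pM2r m0) => /le_trans; apply.
by rewrite mulrBl mul1r /likelihood divfK// gt_eqF.
Qed.

Lemma mean_ln_likelihood_le0 (T : eqType) (rho : X -> T) (t : seq T) :
  uniq t -> (forall x, rho x \in t) ->
  m (fun x => ln (likelihood rho m n (rho x))) <= 0.
Proof.
move=> ut rt; rewrite (mean_ln_likelihoodE ut rt).
apply: le_trans (ler_sum _ (fun a _ => ln_likelihood_term_le rho a)) _.
by rewrite sumrB !(mean_label_sum ut rt)// subrr.
Qed.

(** Strictness in [ln t <= t - 1] needs a cell charged by [m] on which the masses differ. If [m]
    does not charge the given cell, [n] has excess mass there, and equality of the total masses
    forces a difference on a charged cell. *)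
Lemma mean_ln_likelihood_lt0 (T : eqType) (rho : X -> T) (t : seq T) a :
  uniq t -> (forall x, rho x \in t) -> a \in t ->
  m (\1_(cell rho a)) != n (\1_(cell rho a)) ->
  m (fun x => ln (likelihood rho m n (rho x))) < 0.
Proof.
move=> ut rt at_ mna.
have [b bt [mb nb]] : exists2 b, b \in t &
    0 < m (\1_(cell rho b)) /\ n (\1_(cell rho b)) != m (\1_(cell rho b)).
  have [ma|] := ltP 0 (m (\1_(cell rho a))).
    by exists a => //; rewrite eq_sym.
  move=> ma; apply: contrapT => nb.
  have ma0 : m (\1_(cell rho a)) = 0 by apply/eqP; rewrite eq_le ma mean_indic_ge0.
  have : \sum_(b <- t) m (\1_(cell rho b)) < \sum_(b <- t) n (\1_(cell rho b)).
    rewrite (bigD1_seq a)//= [ltRHS](bigD1_seq a)//=; apply: ltr_leD.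
      by rewrite lt_neqAle mna ma0 mean_indic_ge0.
    rewrite big_seq_cond [leRHS]big_seq_cond; apply: ler_sum => b /andP[bt ba]; have := mean_indic_ge0 (cell rho b) mm.
    rewrite le_eqVlt => /orP[/eqP <-|mb]; first exact: mean_indic_ge0.
    rewrite leNgt; apply/negP => h; apply: nb; exists b => //; split=> //.
    by rewrite lt_eqF.
  by rewrite !(mean_label_sum ut rt)// ltxx.
rewrite (mean_ln_likelihoodE ut rt) (bigD1_seq b)//=.
apply: (@lt_le_trans _ _ (n (\1_(cell rho b)) - m (\1_(cell rho b)) +
  \sum_(i <- t | i != b) (n (\1_(cell rho i)) - m (\1_(cell rho i))))).
  apply: ltr_leD; last by apply: ler_sum => i _; exact: ln_likelihood_term_le.
  have l1 : likelihood rho m n b != 1.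
    apply: contra nb => /eqP; rewrite /likelihood => /(congr1 ( *%R^~ (m (\1_(cell rho b))))).
    by rewrite mul1r divfK => [->|]; rewrite ?eqxx ?(gt_eqF mb).
  rewrite [ltRHS](_ : _ = (likelihood rho m n b - 1) * m (\1_(cell rho b))).
    by rewrite ltr_pM2r//; exact: ln_lt_sub1 (likelihood_gt0 mb) l1.
  by rewrite mulrBl mul1r /likelihood divfK// gt_eqF.
have := mean_label_sum ut rt mm; have := mean_label_sum ut rt mn.
rewrite (bigD1_seq b)//= => h1; rewrite (bigD1_seq b)//= => h2.
by rewrite sumrB; lra.
Qed.

End RelativeEntropy.

(** * Information of the chain components along the walk *)

Section Rigidity.
Context {R : realType} {K : cantorSet R} (s : cantor_ifs K).
Local Notation dist := (@cantor_dist R K).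
Local Notation I := (ifs_idx s).
Local Notation q := (@ifs_wt R K s).
Local Notation g := (@ifs_map R K s).
Local Notation gi := (@ifs_inv R K s).
Local Notation u := (@ifs_dlog R K s).
Local Notation L := (transfer s).
Implicit Types (x y z : K) (r e c tau : R) (F G : K -> R).

Definition radius (tau : R) k : R := expR (- (tau * k%:R)).

Lemma radius_gt0 tau k : 0 < radius tau k. Proof. exact: expR_gt0. Qed.

Lemma radius_le tau k l : 0 < tau -> (k <= l)%N -> radius tau l <= radius tau k.
Proof. by move=> t0 kl; rewrite ler_expR lerN2 ler_pM2l// ler_nat. Qed.

Lemma radius_small tau r : 0 < tau -> 0 < r -> exists k0, forall k, (k0 <= k)%N -> radius tau k <= r.
Proof.
move=> t0 r0; exists (Num.truncn (- ln r / tau)).+1 => k hk.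
rewrite /radius -[leRHS](lnK r0) ler_expR lerNl.
rewrite -ler_pdivrMl// mulrC; apply/ltW; apply: lt_le_trans (truncnS_gt _) _.
by rewrite ler_nat.
Qed.

(* [v j x - B] approximates [u j x / tau] from below and is constant on the classes of
   all small radii; [B] is an offset that keeps the exponents in [nat]. *)
Lemma scale_choice tau r0 : 0 < tau -> 0 < r0 ->
  exists (B k0 : nat) (v : I -> K -> nat),
  [/\ forall j x, (v j x <= B + B)%N,
      forall j x, u j x - 3 * tau <= tau * ((v j x)%:R - B%:R),
      radius tau k0 <= r0,
      forall j k x y, (k0 <= k)%N -> chain_class (radius tau (k + v j x)) x y ->
        v j y = v j x &
      forall j k x y, (k0 <= k)%N -> chain_class (radius tau (k + B)) (g j x) y ->
        chain_class (radius tau (k + v j x)) x (gi j y)].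
Proof.
move=> t0 r00.
have [b b0 hb] := dlog_bounded s.
have t8 : 0 < tau / 8 by rewrite divr_gt0.
have [eta eta0 hd] := @ifs_dlogP _ _ s _ t8.
have [eta' eta0' hc] := dlog_cont s t8.
have [r1 r10 hr1] := chain_class_small K eta0'.
have [eta'' eta0'' hi] := @ifs_invP _ _ s _ eta0.
have [ka hka] := radius_small t0 r10.
have [kb hkb] := radius_small t0 eta0''.
have [kc hkc] := radius_small t0 r00.
(* Since [B] exceeds [b / tau] by more than 2, [arg] is nonnegative and [v] stays below [2 B]. The 1
   subtracted in [arg] leaves a margin [tau] for the three errors [tau / 8] of the last claim. *)
pose B := (Num.truncn (b / tau)).+3.
pose arg j x := u j (class_rep r1 x) / tau + (B%:R - 1).
pose v j x := Num.truncn (arg j x).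
have bt : b / tau < B%:R - 2.
  rewrite /B -[_.+3%:R]natr1 -[_.+2%:R]natr1; have := truncnS_gt (b / tau); lra.
have bt0 : 0 < b / tau by rewrite divr_gt0.
have hub j x : - (b / tau) <= u j x / tau <= b / tau.
  have := hb j x; rewrite ler_norml => /andP[h1 h2].
  by rewrite -mulNr !ler_pM2r ?invr_gt0// h1.
have arg0 j x : 0 <= arg j x.
  by rewrite /arg; have := hub j (class_rep r1 x); lra.
have uc j x : `|u j x - u j (class_rep r1 x)| <= tau / 8.
  by apply: hc; apply: hr1; exact: class_repP.
have varg j x : tau * ((v j x)%:R - B%:R) <= u j (class_rep r1 x) - tau /\
    u j (class_rep r1 x) - 2 * tau <= tau * ((v j x)%:R - B%:R).
  pose w := u j (class_rep r1 x) / tau.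
  have -> : u j (class_rep r1 x) = tau * w by rewrite mulrC divfK// gt_eqF.
  have /andP[] := truncn_itv (arg0 j x); rewrite -/(v j x) -[_.+1%:R]natr1 /arg -/w => h1 h2; split.
    by nra.
  by nra.
exists B, (maxn ka (maxn kb kc)), v; split.
- move=> j x; rewrite -(ler_nat R) natrD; have /andP[h _] := truncn_itv (arg0 j x).
  apply: le_trans h _; rewrite /arg; have := hub j (class_rep r1 x); lra.
- by move=> j x; have [_] := varg j x; have := uc j x; rewrite ler_norml; lra.
- by apply: hkc; rewrite !leq_max leqnn !orbT.
- move=> j k x y; rewrite !geq_max => /and3P[kka _ _] xy.
  rewrite /v /arg (@class_rep_eq _ _ r1 x y)//.
  apply: chain_class_mono xy; apply: hka; exact: leq_trans kka (leq_addr _ _).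
- move=> j k x y; rewrite !geq_max => /and3P[kka kkb _].
  (* The inverse map turns a chain of step [radius tau (k + B)] into one of step
     [radius tau (k + v j x)]; this is checked on a single step. *)
  apply: (chain_class_sub (S := [set y | chain_class _ x (gi j y)])) => /=; last first.
    by rewrite ifs_mapK.
  move=> y1 z1 /= xy1 yz1.
  apply: (chain_class_saturated xy1).
  have d1 : dist (gi j y1) (gi j z1) < eta.
    apply: (hi j); rewrite !ifs_invK; apply: lt_le_trans yz1 _.
    by apply: hkb; exact: leq_trans kkb (leq_addr _ _).
  have /andP[h1 _] := hd j _ _ d1.
  rewrite !ifs_invK in h1; have := le_lt_trans h1 yz1.
  rewrite -ltr_pdivlMl ?expR_gt0// => /lt_le_trans; apply.
  rewrite /radius -expRN -expRD ler_expR !natrD.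
  have x1 : `|u j x - u j (gi j y1)| <= tau / 8.
    apply: hc; apply: hr1; apply: chain_class_mono xy1; apply: hka.
    exact: leq_trans kka (leq_addr _ _).
  have [h _] := varg j x; have := uc j x.
  move: x1; rewrite !ler_norml; lra.
Qed.

End Rigidity.

Section StationaryInfo.
Context {R : realType} {K : cantorSet R} (s : cantor_ifs K).
Context (m : (K -> R) -> R) (sm : stationary_mean s m).
Local Notation I := (ifs_idx s).
Local Notation q := (@ifs_wt R K s).
Local Notation g := (@ifs_map R K s).
Local Notation gi := (@ifs_inv R K s).
Local Notation u := (@ifs_dlog R K s).
Local Notation L := (transfer s).
Implicit Types (x y z : K) (r e c : R) (F G : K -> R) (j : I).

Let mm : is_mean m := stationary_is_mean sm.

(** The pullback of [m] by [g j]: on the indicator of [A] it is the mass of the image of [A] by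
    [g j]. *)
Definition pull j F : R := m (fun y => F (gi j y)).

Lemma pull_is_mean j : is_mean (pull j).
Proof.
split=> [F G bF bG|c F bF|F G bF bG FG|c]; rewrite /pull.
- by rewrite (meanD mm)//; exact: bounded_fun_comp.
- by rewrite (meanZ mm)//; exact: bounded_fun_comp.
- by apply: (mean_le mm) => [| |x]; [exact: bounded_fun_comp|exact: bounded_fun_comp|exact: FG].
- exact: (mean_cst mm).
Qed.

Lemma mean_map_ge j F : bounded_fun F -> (forall x, 0 <= F x) ->
  q j * m (fun x => F (g j x)) <= m F.
Proof.
move=> bF F0; rewrite -(mean_transfer sm bF) -(meanZ mm); last exact: bounded_fun_comp.
apply: (mean_le mm); [|exact: bounded_transfer|].
  by apply: bounded_funM; [exact: bounded_cst|exact: bounded_fun_comp].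
move=> x; rewrite /transfer (bigD1 j)//= lerDl sumr_ge0// => i _.
by rewrite mulr_ge0// ltW// ifs_wt_gt0.
Qed.

Lemma pull_ge j (A : set K) : q j * m (\1_A) <= pull j (\1_A).
Proof.
have E : (fun x => \1_A (gi j (g j x))) = \1_A :> (K -> R).
  by apply/funext => x; rewrite ifs_mapK.
rewrite -{1}E; apply: (@mean_map_ge j (fun y => \1_A (gi j y))).
  by apply: bounded_fun_comp; exact: bounded_indic.
by move=> x; rewrite indicE.
Qed.

Lemma mean_null_map j (Z : set K) : m (\1_Z) = 0 -> m (\1_(g j @^-1` Z)) = 0.
Proof.
move=> Z0; apply/eqP; rewrite eq_le mean_indic_ge0// andbT.
rewrite -(ler_pM2l (ifs_wt_gt0 j)) mulr0 -Z0.
have := @mean_map_ge j (\1_Z) (bounded_indic Z); apply.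
by move=> x; rewrite indicE.
Qed.

(** Pointwise Shannon information of the partition into classes. As [ln 0 = 0], it vanishes on
    [null r], so radii can be compared only off that set. *)
Definition info r x : R := - ln (m (\1_(chain_class r x))).

Definition null r : set K := [set x | m (\1_(chain_class r x)) = 0].

Lemma cell_class_rep r x : cell (class_rep r) (class_rep r x) = chain_class r x.
Proof.
apply/seteqP; split=> y /= h.
  by apply/class_repE; exact/esym.
by apply/esym/class_rep_eq.
Qed.

Lemma infoE r x : info r x = - ln (m (\1_(cell (class_rep r) (class_rep r x)))).
Proof. by rewrite cell_class_rep. Qed.

Lemma bounded_info r : 0 < r -> bounded_fun (info r).
Proof.
move=> r0; have [t [ut rt _ _]] := finite_class_reps K r0.
rewrite (_ : info r = (fun x => - ln (m (\1_(cell (class_rep r) (class_rep r x)))))).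
  exact: (bounded_label ut rt (fun a => - ln (m (\1_(cell (class_rep r) a))))).
by apply/funext => x; rewrite infoE.
Qed.

Lemma info_ge0 r x : 0 <= info r x.
Proof. by rewrite oppr_ge0 ln_le0// mean_indic_le1. Qed.

Lemma mean_null r : 0 < r -> m (\1_(null r)) = 0.
Proof.
move=> r0; have [t [ut rt _ _]] := finite_class_reps K r0.
rewrite -[RHS](mean_null_cells ut rt mm); congr (m (\1_ _)).
by apply/funext => x; rewrite /null /mkset cell_class_rep.
Qed.

Lemma nullW r r' : r <= r' -> null r' `<=` null r.
Proof.
move=> rr x /= h; apply/eqP; rewrite /null eq_le mean_indic_ge0// andbT -h.
by apply: mean_indic_le => //; exact: chain_class_mono.
Qed.

Lemma class_mass_gt0 r x : ~ null r x -> 0 < m (\1_(chain_class r x)).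
Proof. by move=> /eqP h; rewrite lt_neqAle eq_sym h mean_indic_ge0. Qed.

Lemma info_mono r r' x : r <= r' -> ~ null r x -> info r' x <= info r x.
Proof.
move=> rr nx; have m0 := class_mass_gt0 nx.
have mr : m (\1_(chain_class r x)) <= m (\1_(chain_class r' x)).
  by apply: mean_indic_le => //; exact: chain_class_mono.
by rewrite lerN2 ler_ln// posrE//; exact: lt_le_trans mr.
Qed.

(** There are at most [diam K / r + 1] classes of radius [r], and [tau * k] is the logarithm of
    [1 / r]. *)
Lemma info_tail tau k : 0 < tau ->
  m (fun x => Num.max 0 (info (radius tau k) x - tau * k%:R)) <= diam K + 1.
Proof.
move=> t0; have r0 := radius_gt0 tau k.
have [t [ut rt _ st]] := finite_class_reps K r0.
rewrite (_ : (fun x => _) = (fun x => Num.max 0 (- ln (m (\1_(cell (class_rep (radius tau k))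
  (class_rep (radius tau k) x)))) - tau * k%:R))); last by apply/funext => x; rewrite infoE.
apply: le_trans (mean_entropy_tail ut rt (tau * k%:R) mm) _.
rewrite -/(radius tau k); apply: le_trans (ler_wpM2r (ltW r0) st) _.
rewrite mulrDl divfK ?gt_eqF// mul1r lerD2l.
by rewrite /radius -[leRHS]expR0 ler_expR oppr_le0 mulr_ge0// ltW.
Qed.

Lemma mean_info_le tau k : 0 < tau ->
  m (info (radius tau k)) <= tau * k%:R + (diam K + 1).
Proof.
move=> t0; apply: le_trans (lerD (lexx _) (info_tail k t0)).
have bi := bounded_info (radius_gt0 tau k).
have bm : bounded_fun (fun x => Num.max 0 (info (radius tau k) x - tau * k%:R)).
  by apply: bounded_fun_max; [exact: bounded_cst|apply: bounded_funB => //; exact: bounded_cst].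
rewrite -[X in X + _](mean_cst mm) -(meanD mm)//; last exact: bounded_cst.
apply: (mean_le mm) => // [|x]; first by apply: bounded_funD => //; exact: bounded_cst.
by rewrite -lerBlDl le_max lexx orbT.
Qed.

Section Scales.
Context (tau : R) (B k0 : nat) (v : I -> K -> nat).
Hypotheses (t0 : 0 < tau) (vB : forall j x, (v j x <= B + B)%N).
Hypothesis v_cst : forall j k x y, (k0 <= k)%N ->
  chain_class (radius tau (k + v j x)) x y -> v j y = v j x.
Hypothesis v_incl : forall j k x y, (k0 <= k)%N ->
  chain_class (radius tau (k + B)) (g j x) y ->
  chain_class (radius tau (k + v j x)) x (gi j y).

Local Notation phi k := (info (radius tau k)).

(** The label of a partition whose radius varies from cell to cell; its cells are entire classes
    because [v j] is constant on them. *)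
Definition scale_rep j k x : K := class_rep (radius tau (k + v j x)) x.

(** The Jacobian of [g j] with respect to [m] at this resolution: mass of the image of a cell over
    mass of the cell. *)
Definition jac j k x : R := likelihood (scale_rep j k) m (pull j) (scale_rep j k x).

Lemma cell_scale_rep j k x : (k0 <= k)%N ->
  cell (scale_rep j k) (scale_rep j k x) = chain_class (radius tau (k + v j x)) x.
Proof.
move=> hk; apply/seteqP; split=> y /=; last first.
  move=> xy; rewrite /cell/= /scale_rep (v_cst hk xy).
  by apply/esym/class_rep_eq.
rewrite /cell/= /scale_rep => xy.
have h1 := class_repP (radius tau (k + v j y)) y.
have h2 := class_repP (radius tau (k + v j x)) x.
have vxy : v j x = v j y by rewrite -(v_cst hk h1) -(v_cst hk h2) xy.
by apply/class_repE; rewrite -xy vxy.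
Qed.

Lemma finite_scale_rep j k : exists t : seq K, uniq t /\ forall x, scale_rep j k x \in t.
Proof.
have /choice[t ht] i : exists t : seq K, forall x, class_rep (radius tau (k + i)) x \in t.
  by have [t [_ ht _ _]] := finite_class_reps K (radius_gt0 tau (k + i)); exists t.
exists (undup (flatten [seq t i | i <- iota 0 (B + B).+1])); split; first exact: undup_uniq.
move=> x; rewrite mem_undup; apply/flatten_mapP; exists (v j x); last exact: ht.
by rewrite mem_iota add0n; exact: vB.
Qed.

Lemma bounded_jac j k (h : R -> R) : bounded_fun (fun x => h (jac j k x)).
Proof.
have [t [ut rt]] := finite_scale_rep j k.
exact: (bounded_label ut rt (fun a => h (likelihood (scale_rep j k) m (pull j) a))).
Qed.

Lemma bounded_phi_scale j k : bounded_fun (fun x => phi (k + v j x) x).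
Proof.
have [C hC] : bounded_fun (fun x => \sum_(i < (B + B).+1) phi (k + i) x).
  by apply: bounded_fun_sum => i; exact: bounded_info (radius_gt0 _ _).
exists C => x; apply: le_trans (hC x); rewrite !ger0_norm ?info_ge0//; last first.
  by rewrite sumr_ge0// => i _; exact: info_ge0.
have vl : (v j x < (B + B).+1)%N by exact: vB.
by rewrite (bigD1 (Ordinal vl))//= lerDl sumr_ge0// => i _; exact: info_ge0.
Qed.

(** By [v_incl] the preimage of the class of [g j x] lies in the cell of [x], so the mass of that
    class is at most the mass of the cell times the Jacobian. *)
Lemma phi_map_ge j k x : (k0 <= k)%N -> ~ null (radius tau (k + B + B)) x ->
  ~ null (radius tau (k + B)) (g j x) ->
  phi (k + v j x) x - ln (jac j k x) <= phi (k + B) (g j x).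
Proof.
move=> hk nx ngx; have mg := class_mass_gt0 ngx.
have ma : 0 < m (\1_(chain_class (radius tau (k + v j x)) x)).
  apply: class_mass_gt0 => h; apply: nx; apply: nullW h.
  by apply: radius_le => //; rewrite -addnA leq_add2l.
rewrite /jac /likelihood cell_scale_rep//.
have gA : m (\1_(chain_class (radius tau (k + B)) (g j x))) <=
    pull j (\1_(chain_class (radius tau (k + v j x)) x)).
  rewrite /pull; apply: (mean_le mm); first exact: bounded_indic.
    by apply: bounded_fun_comp; exact: bounded_indic.
  move=> y; rewrite !indicE ler_nat; case: (boolP (_ \in _)) => // /set_mem yc.
  by rewrite mem_set//; apply: v_incl.
have pA := lt_le_trans mg gA.
rewrite lnM ?posrE ?invr_gt0// lnV ?posrE// /info.
by rewrite opprB addrA addNr add0r lerN2 ler_ln.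
Qed.

Lemma mean_jac_le1 j k : m (jac j k) <= 1.
Proof.
have [t [ut rt]] := finite_scale_rep j k.
have := mean_likelihood_le ut rt mm (pull_is_mean j) (fun=> ler01).
rewrite (mean_cst (pull_is_mean j)); apply: le_trans; rewrite le_eqVlt; apply/orP; left.
by apply/eqP; congr m; apply/funext => x; rewrite mulr1.
Qed.

(* Minus the relative entropy of [m] with respect to [pull j] on the partition into chain
   components of radius [r]. *)
Definition kl r j : R := m (fun x => ln (likelihood (class_rep r) m (pull j) (class_rep r x))).

(** The variable partition refines the one of radius [r]. The resulting bound does not depend on
    [k], so it can be summed over scales. *)
Lemma mean_ln_jac_le r j k : (k0 <= k)%N -> 0 < r -> radius tau k <= r ->
  m (fun x => ln (jac j k x)) <= kl r j.
Proof.
move=> hk r0 hr; have [t [ut rt]] := finite_scale_rep j k.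
have [t' [ut' rt' _ _]] := finite_class_reps K r0.
have E : class_rep r \o scale_rep j k = class_rep r.
  apply/funext => x; rewrite /= /scale_rep; apply/esym/class_rep_eq.
  apply: chain_class_mono (class_repP _ x); apply: le_trans hr.
  by apply: radius_le => //; exact: leq_addr.
have := @mean_likelihood_refine _ _ m (pull j) mm (pull_is_mean j) (q j) (ifs_wt_gt0 j)
  (pull_ge j) _ _ (scale_rep j k) t (class_rep r) t' ut rt ut'.
rewrite E /kl => H; apply: le_trans (H _) _; first by move=> x; exact: rt'.
rewrite le_eqVlt; apply/orP; left; apply/eqP; congr m; apply/funext => x.
by congr (ln (likelihood _ _ _ _)); exact: (congr1 (fun h => h x) E).
Qed.

Lemma mean_phi_gain r k : (k0 <= k)%N -> 0 < r -> radius tau k <= r ->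
  \sum_j q j * m (fun x => phi (k + v j x) x) - \sum_j q j * kl r j <= m (phi (k + B)).
Proof.
move=> hk r0 hr.
have bp : bounded_fun (phi (k + B)) by exact: bounded_info (radius_gt0 _ _).
rewrite -(mean_transfer sm bp) /transfer (mean_sum mm) => [|j]; last first.
  by apply: bounded_funM; [exact: bounded_cst|exact: bounded_fun_comp].
rewrite -sumrB; apply: ler_sum => j _; rewrite -mulrBr (meanZ mm); last exact: bounded_fun_comp.
rewrite ler_pM2l ?ifs_wt_gt0//.
have := mean_ln_jac_le j hk r0 hr => h.
apply: (@le_trans _ _ (m (fun x => phi (k + v j x) x) - m (fun x => ln (jac j k x)))).
  by rewrite lerD2l lerN2.
have b1 := bounded_phi_scale j k; have b2 := bounded_jac j k (@ln R).
rewrite -(meanB mm)//.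
apply: (mean_le_ae mm (Z := null (radius tau (k + B + B)) `|` (g j @^-1` null (radius tau (k + B))))).
- exact: bounded_funB.
- exact: bounded_fun_comp.
- apply: mean_null_setU => //; first exact: mean_null (radius_gt0 _ _).
  by apply: mean_null_map; exact: mean_null (radius_gt0 _ _).
- by move=> x /not_orP[nx ngx]; exact: phi_map_ge.
Qed.

End Scales.

End StationaryInfo.

(** Both sums are differences of partial sums [W]. At the top only the terms between the shifts [v]
    and [B] survive, and monotonicity compares each with the value at [k0 + M + B], in the right
    direction for either order of [v] and [B]. The bottom terms do not grow with [M]. *)
Lemma sum_shift_le {R : realType} (phi : nat -> R) (k0 M B v N : nat) :
  (forall k, 0 <= phi k) ->
  (forall k l, (k <= l)%N -> (l <= N)%N -> phi k <= phi l) ->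
  (v <= B + B)%N -> (k0 + M + (B + B) <= N)%N ->
  \sum_(i < M) phi (k0 + i + B)%N - \sum_(i < M) phi (k0 + i + v)%N <=
  (B%:R - v%:R) * phi (k0 + M + B)%N + \sum_(k < k0 + (B + B)) phi k.
Proof.
move=> p0 pm vB MN.
pose W n := \sum_(k < n) phi k.
have WS n : W n.+1 = W n + phi n by rewrite /W big_ord_recr.
have sumW n b : \sum_(i < n) phi (k0 + i + b)%N = W (k0 + n + b)%N - W (k0 + b)%N.
  elim: n => [|n IH]; first by rewrite big_ord0 addn0 subrr.
  by rewrite big_ord_recr/= IH addnS addSn WS; ring.
have Wmono a b : (a <= b)%N -> W a <= W b.
  move=> ab; rewrite -(subnKC ab); elim: (b - a)%N => [|d IH]; first by rewrite addn0.
  by rewrite addnS WS; apply: le_trans IH _; rewrite lerDl.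
have W0 a : 0 <= W a by rewrite /W sumr_ge0.
have Wup a d : (a + d <= N)%N -> W (a + d)%N - W a <= d%:R * phi (a + d)%N.
  elim: d => [|d IH] ad; first by rewrite addn0 subrr mul0r.
  rewrite addnS WS -[d.+1%:R]natr1.
  have h1 : phi (a + d)%N <= phi (a + d).+1 by apply: pm => //; lia.
  have h2 : d%:R * phi (a + d)%N <= d%:R * phi (a + d).+1 by rewrite ler_wpM2l.
  have := IH ltac:(lia); lra.
have Wdown a d : (a + d <= N)%N -> d%:R * phi a <= W (a + d)%N - W a.
  elim: d => [|d IH] ad; first by rewrite addn0 subrr mul0r.
  rewrite addnS WS -[d.+1%:R]natr1.
  have h1 : phi a <= phi (a + d)%N by apply: pm => //; lia.
  have := IH ltac:(lia); lra.
rewrite !sumW -/(W (k0 + (B + B))%N).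
have w1 : W (k0 + v)%N <= W (k0 + (B + B))%N by apply: Wmono; rewrite leq_add2l.
have w2 := W0 (k0 + B)%N.
have [vle|vgt] := leqP v B.
  have := Wup (k0 + M + v)%N (B - v)%N.
  rewrite (_ : (k0 + M + v + (B - v))%N = (k0 + M + B)%N) ?natrB//; last by lia.
  move=> /(_ ltac:(lia)); lra.
have := Wdown (k0 + M + B)%N (v - B)%N.
rewrite (_ : (k0 + M + B + (v - B))%N = (k0 + M + v)%N) ?natrB//; [|lia|lia].
move=> /(_ ltac:(lia)); lra.
Qed.

Section Core.
Context {R : realType} {K : cantorSet R} (s : cantor_ifs K).
Context (m : (K -> R) -> R) (sm : stationary_mean s m).
Local Notation I := (ifs_idx s).
Local Notation q := (@ifs_wt R K s).
Local Notation g := (@ifs_map R K s).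
Local Notation gi := (@ifs_inv R K s).
Local Notation u := (@ifs_dlog R K s).
Local Notation L := (transfer s).
Implicit Types (x y z : K) (r e c tau : R) (F G : K -> R) (j : I).

Let mm : is_mean m := stationary_is_mean sm.

Definition entropy_gain r : R := - \sum_j q j * kl m r j.

Lemma kl_le0 r j : 0 < r -> kl m r j <= 0.
Proof.
move=> r0; have [t [ut rt _ _]] := finite_class_reps K r0.
exact: (mean_ln_likelihood_le0 mm (pull_is_mean sm j) (ifs_wt_gt0 j) (pull_ge sm j) ut rt).
Qed.

Lemma entropy_gain_gt0 r j (A : set K) : 0 < r -> saturated r A ->
  m (\1_A) != pull m j (\1_A) -> 0 < entropy_gain r.
Proof.
move=> r0 sA neq; have [t [ut rt _ _]] := finite_class_reps K r0.
have mp := pull_is_mean sm j.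
have Elab : \1_A = (fun x => \1_A (class_rep r x)) :> (K -> R).
  apply/funext => x; rewrite !indicE; congr ((nat_of_bool _)%:R).
  apply/idP/idP => /set_mem h; apply/mem_set.
    by apply: (class_repP r x) => //.
  by apply: (chain_class_sym (class_repP r x)).
have [a at_ ha] : exists2 a, a \in t &
    m (\1_(cell (class_rep r) a)) != pull m j (\1_(cell (class_rep r) a)).
  apply: contrapT => na; move/negP: neq; apply; apply/eqP.
  rewrite Elab (mean_label ut rt (\1_A) mm) (mean_label ut rt (\1_A) mp).
  rewrite big_seq [RHS]big_seq; apply: eq_bigr => a at_; congr (_ * _).
  by apply/eqP; apply/negPn/negP => h; apply: na; exists a.
have h := mean_ln_likelihood_lt0 mm mp (ifs_wt_gt0 j) (pull_ge sm j) ut rt at_ ha.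
rewrite /entropy_gain oppr_gt0 (bigD1 j)//=.
apply: (@le_lt_trans _ _ (q j * kl m r j)).
  rewrite gerDl sumr_le0// => i _.
  by rewrite mulr_ge0_le0// ?kl_le0// ltW// ifs_wt_gt0.
by rewrite pmulr_rlt0// ifs_wt_gt0.
Qed.

(** Measures in L1 how far [F] is from being invariant under the walk. *)
Definition map_osc F : R := \sum_j q j * m (fun x => `|F (g j x) - F x|).

Lemma map_osc_ge0 F : bounded_fun F -> 0 <= map_osc F.
Proof.
move=> bF; apply: sumr_ge0 => j _; rewrite mulr_ge0 ?(ltW (ifs_wt_gt0 _))//.
apply: (mean_ge0 mm) => //; apply: bounded_fun_norm; apply: bounded_funB => //.
exact: bounded_fun_comp.
Qed.

(** Stationarity replaces [F * G] by [L (F * G)], and [L F * G - L (F * G)] involves [G] only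
    through its increments along the maps. *)
Lemma mean_transfer_mul F G b : bounded_fun F -> bounded_fun G -> (forall x, `|F x| <= b) ->
  `|m (fun x => L F x * G x) - m (fun x => F x * G x)| <= b * map_osc G.
Proof.
move=> bF bG Fb.
have bFG : bounded_fun (fun x => F x * G x) by exact: bounded_funM.
rewrite -(mean_transfer sm bFG) -(meanB mm); last 2 first.
- by apply: bounded_funM => //; exact: bounded_transfer.
- exact: bounded_transfer.
have E : (fun x => L F x * G x - L (fun x => F x * G x) x) =
    (fun x => \sum_j q j * (F (g j x) * (G x - G (g j x)))).
  apply/funext => x; rewrite /transfer mulr_suml -sumrB; apply: eq_bigr => j _.
  by ring.
have bt j : bounded_fun (fun x => F (g j x) * (G x - G (g j x))).
  apply: bounded_funM; first exact: bounded_fun_comp.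
  by apply: bounded_funB => //; exact: bounded_fun_comp.
rewrite E (mean_sum mm) => [|j]; last by apply: bounded_funM => //; exact: bounded_cst.
apply: le_trans (ler_norm_sum _ _ _) _; rewrite mulr_sumr; apply: ler_sum => j _.
rewrite (meanZ mm)// normrM (gtr0_norm (ifs_wt_gt0 j)) [leRHS]mulrCA.
rewrite ler_pM2l ?ifs_wt_gt0//; apply: le_trans (mean_norm mm (bt j)) _.
have bd : bounded_fun (fun x => `|G (g j x) - G x|).
  by apply: bounded_fun_norm; apply: bounded_funB => //; exact: bounded_fun_comp.
rewrite -(meanZ mm)//; apply: (mean_le mm).
- exact: bounded_fun_norm.
- by apply: bounded_funM => //; exact: bounded_cst.
- by move=> x; rewrite normrM distrC ler_wpM2r.
Qed.

Lemma mean_drift_mul N G b : bounded_fun G -> (forall x, `|mean_dlog s x| <= b) ->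
  `|m (fun x => drift s N x * G x) - N%:R * m (fun x => mean_dlog s x * G x)|
    <= (N * N)%:R * (b * map_osc G).
Proof.
move=> bG hb; have bu := bounded_mean_dlog s.
have b0 : 0 <= b := le_trans (normr_ge0 _) (hb point).
have o0 : 0 <= b * map_osc G by rewrite mulr_ge0// map_osc_ge0.
have bi k : bounded_fun (fun x => iter k L (mean_dlog s) x * G x).
  by apply: bounded_funM => //; exact: bounded_iter_transfer.
have step k : `|m (fun x => iter k L (mean_dlog s) x * G x) -
    m (fun x => mean_dlog s x * G x)| <= k%:R * (b * map_osc G).
  elim: k => [|k IH]; first by rewrite subrr normr0 mul0r.
  have := @mean_transfer_mul (iter k L (mean_dlog s)) G b
    (bounded_iter_transfer s k bu) bG (iter_transfer_norm_le s k hb).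
  rewrite -[k.+1%:R]natr1 mulrDl mul1r => h.
  by apply: le_trans (ler_distD (m (fun x => iter k L (mean_dlog s) x * G x)) _ _) _; rewrite addrC lerD.
have -> : m (fun x => drift s N x * G x) = \sum_(k < N) m (fun x => iter k L (mean_dlog s) x * G x).
  rewrite -(mean_sum mm)//; congr m; apply/funext => x.
  by rewrite /drift mulr_suml.
rewrite mulr_natl -[X in _ - _ *+ X](card_ord N) -sumr_const -sumrB.
apply: le_trans (ler_norm_sum _ _ _) _.
have -> : (N * N)%:R * (b * map_osc G) = \sum_(k < N) N%:R * (b * map_osc G).
  by rewrite sumr_const card_ord natrM -mulrA mulr_natl.
apply: ler_sum => k _; apply: le_trans (step k) _.
by rewrite ler_wpM2r// ler_nat ltnW.
Qed.

(* The mass function of the partitions at scale [exp (- tau k)] is multiplied by [s]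
   almost as by an isometry composed with a shift of [k] by [u / tau]; each step of the
   walk loses the fixed amount [entropy_gain r] of information. *)
Lemma info_drift_le tau r : 0 < tau -> 0 < r -> exists (B k0 : nat) (C : R),
  (forall M, tau * (M%:R * entropy_gain r) <=
    m (fun x => (3 * tau - mean_dlog s x) * info m (radius tau (k0 + M + B)) x) + C) /\
  (forall k, (k0 <= k)%N -> map_osc (info m (radius tau (k + B))) <=
     2 * (m (info m (radius tau (k + B))) - m (info m (radius tau k))) + 2).
Proof.
move=> t0 r0.
have [B [k0 [v [vB vu rk0 vc vi]]]] := scale_choice s t0 r0.
pose phi k := info m (radius tau k).
have bp k : bounded_fun (phi k) by exact: (bounded_info m (radius_gt0 _ _)).
have p0 k x : 0 <= phi k x by exact: (info_ge0 sm).
pose W x := \sum_(k < k0 + (B + B)) phi k x.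
have bW : bounded_fun W by apply: bounded_fun_sum => k.
have bv j : bounded_fun (fun x => (v j x)%:R : R).
  by exists (B + B)%:R => x; rewrite ger0_norm// ler_nat.
exists B, k0, (tau * m W); split=> [M|k hk].
- set n := (k0 + M + B)%N.
  have H i : \sum_j q j * m (fun x => phi (k0 + i + v j x)%N x) + entropy_gain r <= m (phi (k0 + i + B)%N).
    have := @mean_phi_gain _ _ s m sm tau B k0 v t0 vB vc vi r (k0 + i)%N (leq_addr _ _) r0.
    by apply; apply: le_trans (radius_le t0 (leq_addr i k0)) rk0.
  have : \sum_(i < M) (\sum_j q j * m (fun x => phi (k0 + i + v j x)%N x) + entropy_gain r) <=
      \sum_(i < M) m (phi (k0 + i + B)%N) by apply: ler_sum => i _.
  rewrite big_split/= sumr_const card_ord -(mulr_natl (entropy_gain r)) exchange_big/= => H2.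
  pose D j x := \sum_(i < M) phi (k0 + i + B)%N x - \sum_(i < M) phi (k0 + i + v j x)%N x.
  have bphv j i : bounded_fun (fun x => phi (k0 + i + v j x)%N x).
    exact: (@bounded_phi_scale _ _ s m sm tau B v vB).
  have bD j : bounded_fun (D j).
    by apply: bounded_funB; apply: bounded_fun_sum => i //.
  (* Each of the [M] scales yields one [entropy_gain r]; together they must be paid by the
     accumulated change of scale [D j]. *)
  have H3 : M%:R * entropy_gain r <= \sum_j q j * m (D j).
    rewrite (eq_bigr (fun j => q j * (\sum_(i < M) m (phi (k0 + i + B)%N)) -
       \sum_(i < M) q j * m (fun x => phi (k0 + i + v j x)%N x))); last first.
      move=> j _; rewrite (meanB mm); try by apply: bounded_fun_sum => i.
      by rewrite !(mean_sum mm)// mulrBr [in X in _ - X]mulr_sumr.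
    rewrite sumrB -mulr_suml ifs_wt_sum mul1r; lra.
  have H4 j : m (D j) <= m (fun x => (B%:R - (v j x)%:R) * phi n x + W x).
    apply: (mean_le_ae mm (bD j) _ (mean_null sm (radius_gt0 tau (k0 + M + (B + B))))).
      apply: bounded_funD => //; apply: bounded_funM => //; apply: bounded_funB => //.
      exact: bounded_cst.
    move=> x nx; apply: (@sum_shift_le _ (fun k => phi k x) k0 M B (v j x) (k0 + M + (B + B))) => //.
    move=> k l kl lN; apply: (info_mono sm); first exact: radius_le.
    by move=> h; apply: nx; apply: (nullW sm) h; exact: radius_le.
  have bun j : bounded_fun (fun x => (3 * tau - u j x) * phi n x).
    apply: bounded_funM => //; apply: bounded_funB; first exact: bounded_cst.
    by have [b _ hb] := dlog_bounded s; exists b.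
  have H5 j : tau * m (D j) <= m (fun x => (3 * tau - u j x) * phi n x) + tau * m W.
    apply: (@le_trans _ _ (tau * m (fun x => (B%:R - (v j x)%:R) * phi n x + W x))).
      by rewrite ler_pM2l.
    have b1 : bounded_fun (fun x => (B%:R - (v j x)%:R) * phi n x).
      by apply: bounded_funM => //; apply: bounded_funB => //; exact: bounded_cst.
    rewrite (meanD mm)// mulrDr lerD2r -(meanZ mm)//.
    apply: (mean_le mm) => //; first by apply: bounded_funM => //; exact: bounded_cst.
    by move=> x; rewrite mulrA ler_wpM2r//; have := vu j x; lra.
  have H6 : m (fun x => (3 * tau - mean_dlog s x) * phi n x) =
      \sum_j q j * m (fun x => (3 * tau - u j x) * phi n x).
    rewrite (eq_bigr (fun j => m (fun x => q j * ((3 * tau - u j x) * phi n x)))); last first.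
      by move=> j _; rewrite (meanZ mm).
    rewrite -(mean_sum mm) => [|j]; last by apply: bounded_funM => //; exact: bounded_cst.
    congr m; apply/funext => x; under eq_bigr do rewrite mulrA.
    rewrite -mulr_suml; congr (_ * _); under eq_bigr do rewrite mulrBr.
    by rewrite sumrB -mulr_suml ifs_wt_sum mul1r.
  rewrite -/(phi n) H6; apply: le_trans (ler_wpM2l (ltW t0) H3) _.
  have -> : tau * m W = \sum_j q j * (tau * m W) by rewrite -mulr_suml ifs_wt_sum mul1r.
  rewrite -big_split/= mulr_sumr; apply: ler_sum => j _.
  by rewrite mulrCA -mulrDr ler_pM2l ?ifs_wt_gt0.
- have bnk := bp (k + B)%N.
  have bj j : bounded_fun (jac m tau v j k) by exact: (@bounded_jac _ _ s m tau B v vB j k id).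
  pose d j x := phi (k + B)%N x - phi (k + B)%N (g j x).
  have bd j : bounded_fun (d j) by apply: bounded_funB => //; exact: bounded_fun_comp.
  pose e j x := (phi (k + B)%N x - phi k x) + jac m tau v j k x.
  have be j : bounded_fun (e j) := bounded_funD (bounded_funB bnk (bp k)) (bj j).
  (* Pointwise, only the decrease of information along [g j] is under control, through
     [ln jac <= jac] and a Jacobian of mean at most 1. *)
  have H j : m (fun x => Num.max 0 (d j x)) <= m (e j).
    apply: (mean_le_ae mm (Z := null m (radius tau (k + B + B)) `|`
        (g j @^-1` null m (radius tau (k + B))))) => //.
    + by apply: bounded_fun_max => //; exact: bounded_cst.
    + apply: (mean_null_setU mm); first exact: (mean_null sm (radius_gt0 _ _)).
      by apply: (mean_null_map sm); exact: (mean_null sm (radius_gt0 _ _)).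
    move=> x /not_orP[nx ngx].
    have J0 : 0 <= jac m tau v j k x by apply: likelihood_ge0 => //; exact: (pull_is_mean sm).
    have nx' l : (l <= k + B + B)%N -> ~ null m (radius tau l) x.
      by move=> hl h; apply: nx; apply: (nullW sm) h; exact: radius_le.
    have pm l l' : (l <= l')%N -> (l' <= k + B + B)%N -> phi l x <= phi l' x.
      by move=> ll hl; apply: (info_mono sm); [exact: radius_le|exact: nx'].
    have h0 : phi k x <= phi (k + B)%N x by apply: pm; rewrite ?leq_addr.
    rewrite /e ge_max; apply/andP; split; first by rewrite addr_ge0// subr_ge0.
    have h1 := @phi_map_ge _ _ s m sm tau B k0 v t0 vB vc vi j k x hk nx ngx.
    have h2 : phi k x <= phi (k + v j x)%N x.
      by apply: pm; [exact: leq_addr|rewrite -addnA leq_add2l; exact: vB].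
    have h3 : ln (jac m tau v j k x) <= jac m tau v j k x.
      move: J0; rewrite le_eqVlt => /orP[/eqP <-|J0]; first by rewrite ln0.
      by apply: le_trans (ln_le_sub1 J0) _; rewrite gerBl.
    rewrite /d -addrA lerD2l lerNl opprD opprK.
    by apply: le_trans h1; exact: lerB.
  rewrite /map_osc.
  (* An absolute value is the signed increment plus twice the decrease; after averaging over [j] the
     signed part vanishes by stationarity. *)
  have E j : m (fun x => `|phi (k + B)%N (g j x) - phi (k + B)%N x|) <=
      (m (fun x => phi (k + B)%N (g j x)) - m (phi (k + B)%N)) + 2 * m (e j).
    apply: (@le_trans _ _ ((m (fun x => phi (k + B)%N (g j x)) - m (phi (k + B)%N)) +
       2 * m (fun x => Num.max 0 (d j x)))); last by rewrite lerD2l ler_pM2l.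
    have bm : bounded_fun (fun x => Num.max 0 (d j x)).
      by apply: bounded_fun_max => //; exact: bounded_cst.
    have bc : bounded_fun (fun x => phi (k + B)%N (g j x)) by exact: bounded_fun_comp.
    have b2 : bounded_fun (fun x => 2 * Num.max 0 (d j x)) by apply: bounded_funM => //; exact: bounded_cst.
    rewrite -(meanB mm)// -(meanZ mm)// -(meanD mm)//; last exact: bounded_funB.
    apply: (mean_le mm).
    + by apply: bounded_fun_norm; exact: bounded_funB.
    + by apply: bounded_funD => //; exact: bounded_funB.
    move=> x; rewrite /d; case: (leP 0 (phi (k + B)%N x - phi (k + B)%N (g j x))) => h.
      by rewrite distrC ger0_norm//; lra.
    by rewrite ger0_norm; lra.
  apply: le_trans (ler_sum _ (fun j _ => ler_wpM2l (ltW (ifs_wt_gt0 j)) (E j))) _.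
  have st : \sum_j q j * m (fun x => phi (k + B)%N (g j x)) = m (phi (k + B)%N).
    rewrite -[RHS](mean_transfer sm bnk) /transfer (mean_sum mm) => [|j]; last first.
      by apply: bounded_funM; [exact: bounded_cst|exact: bounded_fun_comp].
    by apply: eq_bigr => j _; rewrite (meanZ mm)//; exact: bounded_fun_comp.
  have me j : m (e j) <= m (phi (k + B)%N) - m (phi k) + 1.
    rewrite /e (meanD mm (bounded_funB bnk (bp k)) (bj j)) (meanB mm bnk (bp k)) lerD2l.
    exact: (@mean_jac_le1 _ _ s m sm tau B v vB).
  apply: (@le_trans _ _ (\sum_j (q j * m (fun x => phi (k + B)%N (g j x)) - q j * m (phi (k + B)%N)
      + q j * (2 * (m (phi (k + B)%N) - m (phi k)) + 2)))).
    apply: ler_sum => j _; rewrite mulrDr mulrBr lerD2l ler_pM2l ?ifs_wt_gt0//.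
    rewrite -[X in _ + X]mulr1 -mulrDr.
    by rewrite ler_pM2l.
  by rewrite big_split/= sumrB st -!mulr_suml ifs_wt_sum !mul1r subrr add0r.
Qed.

End Core.

Section InvariancePrinciple.
Context {R : realType} {K : cantorSet R} (s : cantor_ifs K).
Context (m : (K -> R) -> R) (sm : stationary_mean s m).
Local Notation u := (mean_dlog s).
Implicit Types (r e tau : R).

Let mm : is_mean m := stationary_is_mean sm.

(** The function [G] is nonnegative with mean [N * e]. Against [G], the information up to level
    [tau * n] costs [tau * n * (N * e)], and the part above that level has bounded mean. *)
Lemma drift_info_ge tau N e : 0 < tau -> 0 <= m u -> 0 < e ->
  (forall x, drift s N x <= N%:R * (m u + e)) ->
  exists C, forall n, - m (fun x => drift s N x * info m (radius tau n) x) <=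
    tau * n%:R * (N%:R * e) + C.
Proof.
move=> t0 mu0 e0 hN.
pose G x := N%:R * (m u + e) - drift s N x.
have bD := bounded_drift s N.
have bG : bounded_fun G by apply: bounded_funB => //; exact: bounded_cst.
have G0 x : 0 <= G x by rewrite subr_ge0.
have mG : m G = N%:R * e.
  rewrite /G (meanB mm (bounded_cst _) bD) (mean_cst mm) (mean_drift N sm).
  by rewrite -mulrBr addrAC subrr add0r.
have [C hC] := bG; exists (C * (diam K + 1)) => k.
have C0 : 0 <= C := le_trans (normr_ge0 _) (hC point).
set phi := info m (radius tau k).
have bp : bounded_fun phi := bounded_info m (radius_gt0 tau k).
have p0 x : 0 <= phi x := info_ge0 sm _ _.
have bGp : bounded_fun (fun x => G x * phi x) by exact: bounded_funM.
have bDp : bounded_fun (fun x => drift s N x * phi x) by exact: bounded_funM.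
have bm : bounded_fun (fun x => Num.max 0 (phi x - tau * k%:R)).
  by apply: bounded_fun_max; [exact: bounded_cst|apply: bounded_funB => //; exact: bounded_cst].
apply: (@le_trans _ _ (m (fun x => G x * phi x))).
  rewrite -(meanN mm bDp); apply: (mean_le mm) => //; first exact: bounded_funN.
  move=> x; rewrite /G mulrBl lerDr mulr_ge0// mulr_ge0// addr_ge0//; exact: ltW.
apply: (@le_trans _ _ (m (fun x => tau * k%:R * G x + C * Num.max 0 (phi x - tau * k%:R)))).
  apply: (mean_le mm) => //.
    by apply: bounded_funD; apply: bounded_funM => //; exact: bounded_cst.
  move=> x; apply: (@le_trans _ _ (G x * (tau * k%:R) + G x * Num.max 0 (phi x - tau * k%:R))).
    by rewrite -mulrDr ler_wpM2l// -lerBlDl le_max lexx orbT.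
  rewrite [G x * _]mulrC lerD2l ler_wpM2r ?le_max ?lexx//.
  by apply: le_trans (hC x); exact: ler_norm.
have b1 : bounded_fun (fun x => tau * k%:R * G x).
  by apply: bounded_funM => //; exact: bounded_cst.
have b2 : bounded_fun (fun x => C * Num.max 0 (phi x - tau * k%:R)).
  by apply: bounded_funM => //; exact: bounded_cst.
rewrite (meanD mm b1 b2) (meanZ mm _ bG) (meanZ mm _ bm) mG lerD2l ler_wpM2l//.
exact: (info_tail sm).
Qed.

(** If all later increments over [B] scales exceeded [tau * B + 1], the mean information would
    outgrow the bound of [mean_info_le]. *)
Lemma info_increment_le tau (B k0 M0 : nat) : 0 < tau ->
  exists2 M, (M0 <= M)%N &
    m (info m (radius tau (k0 + M + B))) - m (info m (radius tau (k0 + M))) <= tau * B%:R + 1.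
Proof.
move=> t0; apply: contrapT => nM.
pose Phi k := m (info m (radius tau k)).
have H M : (M0 <= M)%N -> Phi (k0 + M)%N + (tau * B%:R + 1) < Phi (k0 + M + B)%N.
  move=> hM; rewrite ltNge; apply/negP => h; apply: nM; exists M => //.
  by rewrite lerBlDl.
have grow i : i%:R * (tau * B%:R + 1) <= Phi (k0 + (M0 + i * B))%N.
  elim: i => [|i IH].
    rewrite mul0r; apply: (mean_ge0 mm); first exact: (bounded_info m (radius_gt0 _ _)).
    exact: (info_ge0 sm).
  have := H (M0 + i * B)%N (leq_addr _ _).
  rewrite (_ : (k0 + (M0 + i * B) + B)%N = (k0 + (M0 + i.+1 * B))%N); last by lia.
  move=> /ltW; apply: le_trans; rewrite -[i.+1%:R]natr1 mulrDl mul1r.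
  by rewrite lerD2r.
pose i := (Num.truncn (tau * (k0 + M0)%:R + (diam K + 1))).+1.
have := le_trans (grow i) (mean_info_le sm (k0 + (M0 + i * B)) t0).
rewrite addnA natrD natrM mulrDr mulrDr mulr1.
have := truncnS_gt (tau * (k0 + M0)%:R + (diam K + 1)); rewrite -/i.
move: (i%:R) (k0 + M0)%:R (B%:R) (diam K) => a b c dd; lra.
Qed.

(* If the maximal mean drift is nonnegative, the stationary mean attaining it is invariant
   under every map: otherwise the information content of the classes of radius
   [exp (- tau n)] would grow at a speed different from the one forced by the drift. *)
Lemma maximal_mean_invariant : 0 <= m u ->
  (forall e, 0 < e -> exists2 n, (0 < n)%N &
    forall x, drift s n x <= n%:R * (m u + e)) ->
  forall (j : ifs_idx s) r (A : set K), 0 < r -> saturated r A -> pull m j (\1_A) = m (\1_A).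
Proof.
move=> mu0 hmax j r A r0 sA; apply/esym/eqP/negPn/negP => neq.
have gam0 := entropy_gain_gt0 sm r0 sA neq.
set gam := entropy_gain s m r in gam0.
(* Up to constants, the rounding error [3 * tau] times the mean information [tau * n], and the
   correlation error [tau * n * e], each cost a quarter of the gain [tau * n * gam]. The remaining
   half beats the constants gathered in [C2] once [M >= M0]. *)
pose tau := gam / 12; pose e := gam / 4.
have t0 : 0 < tau by rewrite divr_gt0.
have e0 : 0 < e by rewrite divr_gt0.
have [B [k0 [C [hI hE]]]] := info_drift_le sm t0 r0.
have [N N0 hN] := hmax e e0.
have [C' hC'] := drift_info_ge t0 mu0 e0 hN.
have [b hb] := bounded_mean_dlog s.
have b0 : 0 <= b := le_trans (normr_ge0 _) (hb point).
pose H := tau * B%:R + 1.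
pose C2 := N%:R * (3 * tau * (tau * (k0 + B)%:R + (diam K + 1)) + C) +
  (tau * (k0 + B)%:R * (N%:R * e) + C') + (N * N)%:R * (b * (2 * H + 2)).
pose M0 := (Num.truncn (C2 / (N%:R * tau * gam / 2))).+1.
have [M hM hH] := info_increment_le B k0 M0 t0.
set n := (k0 + M + B)%N.
set phi := info m (radius tau n).
have bp : bounded_fun phi := bounded_info m (radius_gt0 tau n).
have bu := bounded_mean_dlog s.
have bup : bounded_fun (fun x => u x * phi x) by exact: bounded_funM.
have h1 := hI M; rewrite -/n -/phi -/gam in h1.
have E1 : m (fun x => (3 * tau - u x) * phi x) = 3 * tau * m phi - m (fun x => u x * phi x).
  rewrite -(meanZ mm _ bp) -(meanB mm)//; last by apply: bounded_funM => //; exact: bounded_cst.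
  by congr m; apply/funext => x; rewrite mulrBl.
rewrite E1 in h1.
have h2 := mean_drift_mul sm N bp hb.
have h3 := hC' n; rewrite -/phi in h3.
have h4 : map_osc s m phi <= 2 * H + 2.
  have hk : (k0 <= k0 + M)%N := leq_addr _ _.
  apply: le_trans (hE (k0 + M)%N hk) _.
  by rewrite lerD2r ler_pM2l.
have h5 := mean_info_le sm n t0; rewrite -/phi in h5.
have N0' : 0 < N%:R :> R by rewrite ltr0n.
have h2' : - (N%:R * m (fun x => u x * phi x)) <=
    (tau * n%:R * (N%:R * e) + C') + (N * N)%:R * (b * (2 * H + 2)).
  apply: (@le_trans _ _ (- m (fun x => drift s N x * phi x) + (N * N)%:R * (b * map_osc s m phi))).
    by rewrite -lerBlDl opprK addrC; apply: le_trans h2; exact: ler_norm.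
  apply: lerD => //; rewrite ler_wpM2l// ler_wpM2l//.
have hMlt : C2 / (N%:R * tau * gam / 2) < M%:R.
  by apply: lt_le_trans (truncnS_gt _) _; rewrite ler_nat.
have P0 : 0 < N%:R * tau * gam / 2 by rewrite divr_gt0// mulr_gt0// mulr_gt0.
rewrite ltr_pdivrMr// in hMlt.
have hn : n%:R = M%:R + (k0 + B)%:R :> R.
  by rewrite -natrD addnA [(M + k0)%N]addnC.
have h7 : N%:R * (tau * (M%:R * gam)) <=
   N%:R * (3 * tau * m phi - m (fun x => u x * phi x) + C) by rewrite ler_wpM2l// ltW.
have h8 : N%:R * (3 * tau * m phi) <= N%:R * (3 * tau * (tau * n%:R + (diam K + 1))).
  by rewrite ler_wpM2l ?(ltW N0')// ler_pM2l// mulr_gt0.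
have gE : gam = 12 * tau by rewrite /tau; field.
have eE : e = 3 * tau by rewrite /e /tau; field.
move: h7 h8 h2' hMlt; rewrite /C2 hn eE gE.
move: (m phi) (m _) ((N * N)%:R * _) (N%:R) (M%:R) ((k0 + B)%:R) (diam K) => a1 a2 a3 a4 a5 a6 a7.
clear; lra.
Qed.

End InvariancePrinciple.

(** * Borel measures on a Cantor set *)

Section BorelCantor.
Context {R : realType} (K : cantorSet R).
Local Notation dist := (@cantor_dist R K).
Implicit Types (x y z : K) (r : R) (A S : set K).

Lemma saturated_open r A : 0 < r -> saturated r A -> open A.
Proof.
move=> r0 sA; rewrite openE => x Ax; apply/nbhs_ballP; exists r => //= y xy.
exact: (sA x).
Qed.

Lemma saturated_measurable r A : 0 < r -> saturated r A -> measurable (A : set (borel K)).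
Proof. by move=> r0 sA; apply: sub_gen_smallest; exact: saturated_open sA. Qed.

(** Clopen initial segments of K in the order of the line. They are nested and stable under
    intersection, which makes them fit for quantiles and for uniqueness of measures. *)
Definition initial_saturated : set (set K) :=
  [set A | (exists2 r, 0 < r & saturated r A) /\
           (forall y z, A y -> pos z <= pos y -> A z)].

Definition initial_hull r x : set K := [set y | exists2 z, chain_class r x z & pos y <= pos z].

Definition initial_below r x : set K := [set y | forall z, chain_class r x z -> pos y < pos z].

(** A chain from [y] to [t] that misses [z] jumps over it in one step, and then [z] itself is within
    reach of that step. *)
Lemma chain_class_convex r x y z t : chain_class r x y -> chain_class r x t ->
  pos y <= pos z <= pos t -> chain_class r x z.
Proof.
move=> xy xt /andP[yz zt]; apply: contrapT => nz.
have : chain_class r y `<=` [set v | chain_class r x v /\ pos v < pos z].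
  apply: chain_class_sub => [v w [xv vz] vw|]; last first.
    split=> //; rewrite lt_neqAle yz andbT; apply/eqP => /val_inj yz'.
    by apply: nz; rewrite -yz'.
  have xw := chain_class_saturated xv vw; split=> //.
  rewrite ltNge; apply/negP => zw; apply: nz.
  apply: (chain_class_saturated xv); apply: le_lt_trans vw.
  by rewrite !distE !ler0_norm ?subr_le0 ?(ltW vz)// ?(le_trans (ltW vz))// lerN2 lerD2l lerN2.
move=> /(_ t)[|_]; first by apply: chain_class_trans xt; exact: chain_class_sym.
by rewrite ltNge zt.
Qed.

Lemma initial_hullP r x : 0 < r -> initial_saturated (initial_hull r x).
Proof.
move=> r0; split.
  exists r => // y y' [z xz yz] yy'.
  have [le|lt] := leP (pos y') (pos z); first by exists z.
  exists y' => //; apply: (chain_class_saturated xz); apply: le_lt_trans yy'.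
  by rewrite !distE !ler0_norm ?subr_le0 ?(ltW lt)// ?(le_trans yz (ltW lt))// lerN2 lerD2r.
by move=> y y' [z xz yz] y'y; exists z => //; exact: le_trans y'y yz.
Qed.

Lemma initial_belowE r x : initial_below r x = initial_hull r x `\` chain_class r x.
Proof.
apply/seteqP; split=> y.
  move=> h; split; first by exists x => //; exact/ltW/h.
  by move=> /h; rewrite ltxx.
move=> [[z xz yz] nxy] t xt; rewrite ltNge; apply/negP => ty; apply: nxy.
by apply: (chain_class_convex xt xz); rewrite ty.
Qed.

Lemma initial_belowP r x : 0 < r -> initial_saturated (initial_below r x).
Proof.
move=> r0; split.
  exists r => //; rewrite initial_belowE setDE; apply: saturatedI.
    move=> y y' [z xz yz] yy'.
    have [le|lt] := leP (pos y') (pos z); first by exists z.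
    exists y' => //; apply: (chain_class_saturated xz); apply: le_lt_trans yy'.
    by rewrite !distE !ler0_norm ?subr_le0 ?(ltW lt)// ?(le_trans yz (ltW lt))// lerN2 lerD2r.
  by apply: saturatedC; exact: chain_class_saturated.
by move=> y y' h y'y z xz; apply: le_lt_trans y'y _; exact: h.
Qed.

Lemma chain_classE r x : chain_class r x = initial_hull r x `\` initial_below r x.
Proof.
rewrite initial_belowE; apply/seteqP; split=> y.
  by move=> xy; split=> [|[]//]; exists y.
by move=> [h1 h2]; apply: contrapT => nxy; apply: h2.
Qed.

Lemma initial_below_sub r x : initial_below r x `<=` initial_hull r x.
Proof. by rewrite initial_belowE; exact: subDsetl. Qed.

Lemma saturated_bigcup r A (t : seq K) : saturated r A ->
  (forall x, class_rep r x \in t) ->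
  A = \big[setU/set0]_(c <- t | c \in A) chain_class r c.
Proof.
move=> sA ht; apply/seteqP; split=> x.
  move=> Ax; have Ac : class_rep r x \in A by apply: mem_set; exact: (class_repP r x) sA Ax.
  rewrite -bigcup_seq_cond; exists (class_rep r x) => /=; first by rewrite ht Ac.
  by apply: chain_class_sym; exact: class_repP.
rewrite -bigcup_seq_cond => -[c /= /andP[_ /set_mem Ac]].
exact: (chain_class_sub sA Ac).
Qed.

(** An open set is the union over n of the points whose class of radius [1 / (n + 1)] it contains.
    Each of these sets is a finite union of classes, and a class is a difference of two initial
    segments. *)
Lemma borel_initialE : (@measurable _ (borel K)) = <<s initial_saturated >>.
Proof.
apply/seteqP; split; last first.
  apply: smallest_sub; first exact: sigma_algebra_measurable.
  by move=> A [[r r0 sA] _]; exact: saturated_measurable sA.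
apply: smallest_sub; first exact: smallest_sigma_algebra.
move=> U oU.
pose rd n : R := n.+1%:R^-1.
have rd0 n : 0 < rd n by rewrite invr_gt0.
pose C n := [set x | chain_class (rd n) x `<=` U].
have sC n : saturated (rd n) (C n).
  by move=> y z Cy yz t zt; apply: Cy; apply: chain_class_trans zt; exact: chain_class_saturated yz.
have -> : U = \bigcup_n C n.
  apply/seteqP; split=> x; last by move=> [n _ /(_ x)]; apply.
  move=> Ux; have : nbhs x U by apply: open_nbhs_nbhs.
  move=> /nbhs_ballP[e /= e0 he].
  have [r r0 hr] := chain_class_small K e0.
  exists (Num.truncn r^-1) => // y xy; apply: he; apply: (hr x).
  apply: chain_class_mono xy; rewrite /rd invf_ple ?posrE//; exact/ltW/truncnS_gt.
apply: sigma_algebra_bigcup => n.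
have [t [_ ht _ _]] := finite_class_reps K (rd0 n).
rewrite (saturated_bigcup (sC n) ht).
have clU : forall A B, <<s initial_saturated >> A -> <<s initial_saturated >> B ->
   <<s initial_saturated >> (A `|` B).
  by move=> A B mA mB; exact: (@measurableU _ (g_sigma_algebraType initial_saturated)).
elim/big_ind: _ => [|A B|c _]; [|exact: clU|].
  exact: (@measurable0 _ (g_sigma_algebraType initial_saturated)).
rewrite chain_classE.
apply: (@measurableD _ (g_sigma_algebraType initial_saturated)); apply: sub_gen_smallest.
  exact: initial_hullP.
exact: initial_belowP.
Qed.

Lemma initial_saturatedI : setI_closed initial_saturated.
Proof.
move=> A B [[r r0 sA] dA] [[r' r'0 sB] dB]; split.
  exists (Num.min r r'); first by rewrite lt_min r0.
  by apply: saturatedI; [apply: saturatedW sA|apply: saturatedW sB]; rewrite ge_min lexx ?orbT.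
by move=> y z [Ay By] zy; split; [exact: dA zy|exact: dB zy].
Qed.

Lemma borel_measure_unique (mu nu : {measure set (borel K) -> \bar R}) :
  (mu setT < +oo)%E ->
  (forall r A, 0 < r -> saturated r A -> mu A = nu A) ->
  forall A : set (borel K), measurable A -> mu A = nu A.
Proof.
move=> fin h; apply: (@measure_unique _ R (borel K) initial_saturated (fun=> setT)).
- exact: borel_initialE.
- exact: initial_saturatedI.
- by move=> _; split=> //; exists 1.
- by rewrite bigcup_const//; exists point.
- by move=> A [[r r0 sA] _]; exact: (h r).
- by move=> _.
Qed.

Lemma cantor_closed (E : set K) (i : R) :
  (forall r, 0 < r -> exists2 y, E y & `|i - pos y| < r) -> exists x, pos x = i.
Proof.
move=> h; have [_ _ [clK _] _] := cantor_setP K.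
have Ki : cantor_set K i.
  apply: clK => B /nbhs_ballP[e /= e0 he]; have [y _ yi] := h e e0.
  by exists (pos y); split; [exact: posP|exact: he].
by exists (exist _ i (mem_set Ki)).
Qed.

(** The extremal point is only adherent to [E]; it belongs to [E] as soon as [E] is saturated. *)
Lemma cantor_max (E : set K) : E !=set0 ->
  exists x, (forall y, E y -> pos y <= pos x) /\ forall r, 0 < r -> exists2 y, E y & dist x y < r.
Proof.
move=> [y0 Ey0]; have [b hb] := cantor_bounded K.
have hs : has_sup [set pos y | y in E].
  split; first by exists (pos y0), y0.
  by exists b => _ [y _ <-]; apply: le_trans (hb y); exact: ler_norm.
have adh r : 0 < r -> exists2 y, E y & `|sup [set pos y | y in E] - pos y| < r.
  move=> r0; have [_ [y Ey <-] hy] := sup_adherent r0 hs; exists y => //.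
  have h : pos y <= sup [set pos y | y in E] by apply: ub_le_sup; [exact: hs.2|exists y].
  by rewrite ger0_norm ?subr_ge0//; lra.
have [x hx] := cantor_closed adh; exists x; split=> [y Ey|r r0].
  by rewrite hx; apply: ub_le_sup; [exact: hs.2|exists y].
by have [y Ey hy] := adh r r0; exists y => //; rewrite distE hx.
Qed.

Lemma cantor_min (E : set K) : E !=set0 ->
  exists x, (forall y, E y -> pos x <= pos y) /\ forall r, 0 < r -> exists2 y, E y & dist x y < r.
Proof.
move=> [y0 Ey0]; have [b hb] := cantor_bounded K.
have hs : has_inf [set pos y | y in E].
  split; first by exists (pos y0), y0.
  by exists (- b) => _ [y _ <-]; rewrite lerNl; apply: le_trans (hb y); rewrite -normrN; exact: ler_norm.
have adh r : 0 < r -> exists2 y, E y & `|inf [set pos y | y in E] - pos y| < r.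
  move=> r0; have [_ [y Ey <-] hy] := inf_adherent r0 hs; exists y => //.
  have h : inf [set pos y | y in E] <= pos y by apply: ge_inf; [exact: hs.2|exists y].
  by rewrite ler0_norm ?subr_le0//; lra.
have [x hx] := cantor_closed adh; exists x; split=> [y Ey|r r0].
  by rewrite hx; apply: ge_inf; [exact: hs.2|exists y].
by have [y Ey hy] := adh r r0; exists y => //; rewrite distE hx.
Qed.

Context (m : (K -> R) -> R) (mm : is_mean m).

(** The quantile is the least point adherent to those whose lower segment has mass at least [t]. The
    empty segment must be excluded: at [t = 0] it satisfies the right side only. *)
Lemma mean_quantile (t : R) : 0 <= t <= 1 ->
  exists x, forall A, initial_saturated A -> A !=set0 -> A x <-> t <= m (\1_A).
Proof.
move=> /andP[t0 t1].
pose E := [set y : K | t <= m (\1_[set z : K | pos z <= pos y])].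
have E0 : E !=set0.
  have [x [hx _]] := @cantor_max setT (ex_intro _ point I).
  exists x; rewrite /E/= (_ : [set z | _] = setT); last first.
    by apply/seteqP; split=> // y _; exact: hx.
  by rewrite indicT (mean_cst mm).
have [x [xmin xadh]] := cantor_min E0; exists x => A [[r r0 sA] dA] A0; split.
  move=> Ax; have [y Ey xy] := xadh r r0.
  apply: le_trans Ey _; apply: mean_indic_le => // z /= zy.
  by apply: dA zy; exact: sA xy.
move=> tA; have [y [ymax yadh]] := cantor_max A0.
have Ay : A y by have [z Az yz] := yadh r r0; apply: (sA z) => //; rewrite distC.
apply: dA Ay _; apply: xmin; rewrite /E/=; apply: le_trans tA _.
by apply: mean_indic_le => // z; exact: ymax.
Qed.

(** The uniform law on [0, 1] is pushed forward by the quantile map [Q], which is measurable because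
    the preimage of a nonempty initial segment is a half-line or the whole line. *)
Lemma mean_probability : exists mu : probability (borel K) R,
  forall r A, 0 < r -> saturated r A -> mu A = (m (\1_A))%:E.
Proof.
(* Makes [Q] total on the line; the values outside [0, 1] do not matter to the uniform law. *)
pose clamp (t : R) : R := Num.max 0 (Num.min 1 t).
have /choice[Q hQ] t : exists x, forall A, initial_saturated A -> A !=set0 ->
    A x <-> clamp t <= m (\1_A).
  by apply: mean_quantile; rewrite /clamp le_max lexx/= ge_max ler01 ge_min lexx.
have clampE t c : 0 <= c <= 1 -> (clamp t <= c) = (1 <= c) || (t <= c).
  move=> /andP[c0 c1]; rewrite /clamp ge_max c0/= ge_min.
  by [].
have mQ : measurable_fun [set: measurableTypeR R] (Q : measurableTypeR R -> borel K).
  apply: (@measurability _ _ (measurableTypeR R) (borel K) setT Q initial_saturated).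
    exact: borel_initialE.
  move=> _ [A iA <-]; rewrite setTI.
  have [->|/set0P A0] := eqVneq A set0; first by rewrite preimage_set0; exact: measurable0.
  have mA : 0 <= m (\1_A) <= 1 by rewrite mean_indic_ge0// mean_indic_le1.
  rewrite (_ : Q @^-1` A = if 1 <= m (\1_A) then setT else `]-oo, m (\1_A)]%classic); last first.
    apply/seteqP; split=> t /=.
      by move/(hQ t A iA A0); rewrite clampE//; case: ifP.
    by move=> h; apply/(hQ t A iA A0); rewrite clampE//; case: ifP h.
  by case: ifP => _; [exact: measurableT|exact: measurable_itv].
pose X : {mfun measurableTypeR R >-> borel K} := HB.pack (Q : measurableTypeR R -> borel K)
  (isMeasurableFun.Build _ _ _ _ (Q : measurableTypeR R -> borel K) mQ).
pose mu : probability (borel K) R := distribution (uniform_prob (@ltr01 R)) X.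
have mu_init A : initial_saturated A -> mu A = (m (\1_A))%:E.
  move=> iA; have [->|/set0P A0] := eqVneq A set0.
    by rewrite measure0 indic0 (mean_cst mm).
  have /andP[mA0 mA1] : 0 <= m (\1_A) <= 1 by rewrite mean_indic_ge0// mean_indic_le1.
  rewrite /mu /distribution /pushforward /= /uniform_prob integral_uniform_pdf.
  rewrite (_ : _ `&` _ = `[0, m (\1_A)]%classic); last first.
    apply/seteqP; split=> t /=; rewrite !in_itv/=.
      move=> [/(hQ t A iA A0)]; rewrite clampE ?mA0// => /orP[h1|h1] /andP[t0 t1].
        by rewrite t0 (le_trans t1).
      by rewrite t0.
    move=> /andP[t0 tA]; split; last by rewrite t0 (le_trans tA).
    by apply/(hQ t A iA A0); rewrite clampE ?mA0// tA orbT.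
  rewrite (eq_integral (fun=> 1%:E)); last first.
    move=> t; rewrite inE/= in_itv/= /uniform_pdf => /andP[t0 tA].
    by rewrite t0 (le_trans tA mA1) subr0 invr1.
  rewrite integral_cst//= mul1e lebesgue_measure_itv/= lte_fin sube0.
  by rewrite lt_neqAle mA0 andbT; case: eqP => //= <-.
clearbody mu; exists mu => r A r0 sA.
have [t [ut ht hc _]] := finite_class_reps K r0.
(* Agreement passes from initial segments to classes by difference, and then to saturated sets by
   finite additivity. *)
have mcc c : mu (chain_class r c) = (m (\1_(chain_class r c)))%:E.
  have mh : measurable (initial_hull r c : set (borel K)).
    by have [[r1 r10 s1] _] := initial_hullP c r0; exact: saturated_measurable s1.
  have mb : measurable (initial_below r c : set (borel K)).
    by have [[r1 r10 s1] _] := initial_belowP c r0; exact: saturated_measurable s1.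
  have sub := @initial_below_sub r c.
  rewrite chain_classE measureD//; last exact: le_lt_trans (probability_le1 _ mh) (ltry _).
  have -> : initial_hull r c `&` initial_below r c = initial_below r c by rewrite setIidr.
  transitivity ((m (\1_(initial_hull r c)))%:E - (m (\1_(initial_below r c)))%:E)%E.
    by congr (_ - _)%E; apply: mu_init; [exact: initial_hullP|exact: initial_belowP].
  rewrite -EFinB.
  congr (_%:E); rewrite -(meanB mm); try exact: bounded_indic.
  congr m; apply/funext => x; rewrite !indicE in_setD.
  by case: (boolP (x \in initial_below r c)) => [/set_mem/sub/mem_set ->|_]; rewrite /= ?subrr ?andbT ?subr0 ?andbF.
have lab : m (\1_A) = \sum_(c <- t | c \in A) m (\1_(chain_class r c)).
  have Elab : \1_A = (fun x => \1_A (class_rep r x)) :> (K -> R).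
    apply/funext => x; rewrite !indicE; congr ((nat_of_bool _)%:R).
    apply/idP/idP => /set_mem h; apply/mem_set; first exact: (class_repP r x).
    by apply: (chain_class_sym (class_repP r x)).
  rewrite Elab (mean_label ut ht (\1_A) mm) [RHS]big_mkcond/= big_seq [RHS]big_seq.
  apply: eq_bigr => c ct; rewrite indicE -{2}(hc c ct) cell_class_rep; case: ifP => _; rewrite ?mul1r ?mul0r//.
rewrite lab {1}(saturated_bigcup sA ht).
elim: t ut {ht lab} hc => [|c t IH] /= ut hc; first by rewrite !big_nil measure0.
have hc' c' : c' \in t -> class_rep r c' = c' by move=> h; apply: hc; rewrite inE h orbT.
have /andP[ct ut'] := ut.
rewrite !big_cons; case: ifP => cA; last exact: IH.
have mU : measurable (\big[setU/set0]_(j <- t | j \in A) chain_class r j : set (borel K)).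
  elim/big_ind: _ => [|B C|j _]; [exact: measurable0|exact: measurableU|].
  exact: saturated_measurable r0 (@chain_class_saturated _ _ r j).
rewrite measureU//.
- by rewrite EFinD; congr (_ + _)%E; [exact: mcc|exact: IH].
- exact: saturated_measurable r0 (@chain_class_saturated _ _ r c).
- rewrite -subset0 => x [cx]; rewrite -bigcup_seq_cond => -[c' /= /andP[c't _] c'x].
  have : class_rep r c = class_rep r c' by rewrite (class_rep_eq cx) (class_rep_eq c'x).
  by rewrite hc ?inE ?eqxx// hc' => // cc; move: ct; rewrite cc c't.
Qed.

End BorelCantor.

(** * Quasi-compactness of the transfer operator *)

Section Contraction.
Context {R : realType} {K : cantorSet R} (s : cantor_ifs K).
Local Notation dist := (@cantor_dist R K).
Implicit Types (x y : K) (a e r kappa : R).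

Lemma expR_le_quadratic (t : R) : t <= 1 / 2 -> expR t <= 1 + t + 2 * t ^+ 2.
Proof.
move=> t1; have h : 1 - t <= expR (- t) by have := expR_ge1Dx (- t).
have t2 : 0 < 1 - t by lra.
have -> : expR t = (expR (- t))^-1 by rewrite expRN invrK.
apply: (@le_trans _ _ (1 - t)^-1); first by rewrite lef_pV2// posrE// expR_gt0.
rewrite -[leLHS]mul1r ler_pdivrMr//.
have -> : (1 + t + 2 * t ^+ 2) * (1 - t) = 1 + t ^+ 2 * (1 - 2 * t) by ring.
by rewrite lerDl mulr_ge0 ?sqr_ge0//; lra.
Qed.

(** Expand the exponential of [a] times the log dilation: the linear term has negative mean of order
    [a], the quadratic one is of order [a ^ 2], so small exponents contract in mean. *)
Lemma word_mean_dist_contraction N kappa : 0 < kappa ->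
  (forall x, drift s N x <= - kappa) ->
  exists2 a0 : R, 0 < a0 <= 1 & forall a, 0 < a <= a0 ->
    exists2 rho : R, 0 <= rho < 1 & exists2 eta : R, 0 < eta &
      forall x y, dist x y < eta ->
        word_mean N (fun w : seq (ifs_idx s) => dist (word_map w x) (word_map w y) `^ a) <= rho * dist x y `^ a.
Proof.
move=> k0 hN.
have N0 : (0 < N)%N.
  by case: N hN => // /(_ point); rewrite /drift big_ord0 => ?; exfalso; lra.
have N0' : 0 < N%:R :> R by rewrite ltr0n.
have [B B0 hB] := word_dlog_bounded s.
(* The distortion accumulated over [N] letters then uses up half of the drift. *)
pose e := kappa / (2 * N%:R).
have e0 : 0 < e by rewrite divr_gt0// mulr_gt0.
have eN : e *+ N = kappa / 2 by rewrite /e -mulr_natr; field; rewrite gt_eqF.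
pose D := B *+ N + kappa / 2.
have D0 : 0 < D by rewrite ltr_wpDl ?divr_gt0// mulrn_wge0// ltW.
(* The second bound makes [expR_le_quadratic] applicable, the third keeps the quadratic term below
   [a * kappa / 4]. With the half lost to distortion, the factor [1 - a * kappa / 4] remains. *)
exists (Num.min 1 (Num.min (2 * D)^-1 (kappa / (8 * D ^+ 2)))).
  rewrite !lt_min ltr01 invr_gt0 mulr_gt0//= divr_gt0//=; last by rewrite mulr_gt0// exprn_gt0.
  by rewrite ge_min lexx.
move=> a /andP[a0]; rewrite !le_min => /and3P[a1 aD ak].
exists (Num.max 0 (1 - a * kappa / 4)).
  rewrite le_max lexx/= gt_max ltr01/=; have : 0 < a * kappa by rewrite mulr_gt0.
  lra.
have [eta eta0 heta] := word_dist s N e0; exists eta => // x y xy.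
have [->|nxy] := eqVneq x y.
  rewrite distxx powR0 ?gt_eqF// mulr0 (word_mean_eq (G := fun=> 0)) ?word_mean_cst// => w _.
  by rewrite distxx powR0// gt_eqF.
have d0 : 0 < dist x y by rewrite dist_gt0.
apply: (@le_trans _ _ (word_mean N (fun w : seq (ifs_idx s) => expR (a * (word_dlog w x + e *+ N)) * dist x y `^ a))).
  apply: word_mean_le => w wN; have /andP[_ h] := heta w x y wN xy.
  rewrite [a * _]mulrC expRM -powRM ?expR_ge0 ?cantor_dist_ge0//.
  by apply: ge0_ler_powR => //; rewrite ?nnegrE ?(ltW a0)// ?cantor_dist_ge0// mulr_ge0 ?expR_ge0 ?cantor_dist_ge0.
rewrite (word_mean_eq (G := fun w => dist x y `^ a * expR (a * (word_dlog w x + e *+ N)))); last first.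
  by move=> w _; rewrite mulrC.
rewrite word_meanZ mulrC; apply: ler_wpM2r; first exact: powR_ge0.
rewrite le_max; apply/orP; right.
apply: (@le_trans _ _ (word_mean N (fun w : seq (ifs_idx s) => (1 + a * (e *+ N) + 2 * (a * D) ^+ 2) + a * word_dlog w x))).
  apply: word_mean_le => w wN.
  have hw := hB w x; rewrite wN in hw.
  have hD : `|word_dlog w x + e *+ N| <= D.
    by apply: le_trans (ler_normD _ _) _; rewrite /D eN lerD// ger0_norm// ltW// divr_gt0.
  have haD : `|a * (word_dlog w x + e *+ N)| <= a * D by rewrite normrM (gtr0_norm a0) ler_pM2l.
  have aD2 : a * D <= 1 / 2 by move: aD; rewrite -[(2 * D)^-1]mul1r ler_pdivlMr ?mulr_gt0//; lra.
  have := expR_le_quadratic (le_trans (le_trans (ler_norm _) haD) aD2).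
  have : (a * (word_dlog w x + e *+ N)) ^+ 2 <= (a * D) ^+ 2.
    by rewrite -[leLHS]real_normK ?num_real// lerXn2r ?nnegrE// (le_trans (normr_ge0 _) haD).
  rewrite [a * (word_dlog w x + _)]mulrDr; lra.
rewrite word_meanD word_mean_cst word_meanZ word_mean_dlog eN.
have := hN x; rewrite -(ler_pM2l a0) => h.
have ak2 : 2 * (a * D) ^+ 2 <= a * kappa / 4.
  move: ak; rewrite ler_pdivlMr ?mulr_gt0 ?exprn_gt0// -(ler_pM2l a0) => ak.
  by rewrite exprMn; move: ak; rewrite !expr2; lra.
lra.
Qed.

End Contraction.

Section ComplexTransfer.
Context {R : realType} {K : cantorSet R} (s : cantor_ifs K).
Local Notation dist := (@cantor_dist R K).
Local Notation I := (ifs_idx s).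
Local Notation q := (@ifs_wt R K s).
Local Notation g := (@ifs_map R K s).
Implicit Types (x y : K) (a e r S H C M : R) (phi psi : K -> R[i]).

Definition ctransfer phi x : R[i] :=
  Complex (transfer s (fun y => complex.Re (phi y)) x) (transfer s (fun y => complex.Im (phi y)) x).

Definition cword_mean n (F : seq I -> R[i]) : R[i] :=
  Complex (word_mean n (fun w => complex.Re (F w))) (word_mean n (fun w => complex.Im (F w))).

Lemma complex_sum (J : Type) (t : seq J) (u v : J -> R) :
  Complex (\sum_(j <- t) u j) (\sum_(j <- t) v j) = \sum_(j <- t) Complex (u j) (v j) :> R[i].
Proof.
by elim: t => [|j t IH]; rewrite ?big_nil// !big_cons -IH.
Qed.

Lemma complex_scale (c u v : R) : Complex (c * u) (c * v) = (c%:C)%C * Complex u v.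
Proof. by apply/eqP; rewrite eq_complex /= !mul0r subr0 addr0 !eqxx. Qed.

Lemma normc_real (c : R) : normc (c%:C)%C = `|c|.
Proof. by rewrite /normc /= expr0n /= addr0 sqrtr_sqr. Qed.

Lemma normc_sum (J : Type) (t : seq J) (F : J -> R[i]) :
  normc (\sum_(j <- t) F j) <= \sum_(j <- t) normc (F j).
Proof.
elim: t => [|j t IH]; first by rewrite !big_nil normc0.
by rewrite !big_cons; apply: le_trans (le_normcD _ _) _; rewrite lerD2l.
Qed.

Lemma cword_meanS n F : cword_mean n.+1 F = \sum_j (q j)%:C%C * cword_mean n (fun w => F (j :: w)).
Proof.
rewrite /cword_mean /= complex_sum; apply: eq_bigr => j _.
by rewrite complex_scale.
Qed.

Lemma ctransferE phi x : ctransfer phi x = \sum_j (q j)%:C%C * phi (g j x).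
Proof.
rewrite /ctransfer /transfer complex_sum; apply: eq_bigr => j _.
by rewrite complex_scale; case: (phi _).
Qed.

Lemma normc_word_mean n F : normc (cword_mean n F) <= word_mean n (fun w => normc (F w)).
Proof.
elim: n F => [|n IH] F; first by rewrite /cword_mean /=; case: (F [::]).
rewrite cword_meanS; apply: le_trans (normc_sum _ _) _; apply: ler_sum => j _.
by rewrite normcM normc_real ger0_norm ?ifs_wt_ge0// ler_wpM2l ?ifs_wt_ge0.
Qed.

Lemma cword_meanB n F G : cword_mean n F - cword_mean n G = cword_mean n (fun w => F w - G w).
Proof.
rewrite /cword_mean; apply/eqP; rewrite eq_complex /=; apply/andP; split; apply/eqP.
  rewrite -[X in _ - X]mul1r -mulNr -word_meanZ -word_meanD; apply: word_mean_eq => w _.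
  by case: (F w) (G w) => ? ? [? ?] /=; rewrite mulN1r.
rewrite -[X in _ - X]mul1r -mulNr -word_meanZ -word_meanD; apply: word_mean_eq => w _.
by case: (F w) (G w) => ? ? [? ?] /=; rewrite mulN1r.
Qed.

Lemma iter_ctransfer_ReIm n phi x : iter n ctransfer phi x =
  Complex (iter n (transfer s) (fun y => complex.Re (phi y)) x)
          (iter n (transfer s) (fun y => complex.Im (phi y)) x).
Proof.
elim: n x => [|n IH] x; first by rewrite /=; case: (phi x).
by rewrite iterS /ctransfer !iterS; congr Complex; apply: eq_bigr => j _; rewrite IH.
Qed.

Lemma iter_ctransferE n phi x : iter n ctransfer phi x = cword_mean n (fun w => phi (word_map w x)).
Proof. by rewrite iter_ctransfer_ReIm !iter_transferE. Qed.

(** The sup bound and the Holder constant are kept apart because the Lasota-Yorke inequality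
    contracts only the second. *)
Definition holder_bound a S H phi : Prop :=
  (forall x, normc (phi x) <= S) /\ forall x y, normc (phi x - phi y) <= H * dist x y `^ a.

Lemma holder_boundW a S H S' H' phi : S <= S' -> H <= H' ->
  holder_bound a S H phi -> holder_bound a S' H' phi.
Proof.
move=> SS HH [h1 h2]; split=> [x|x y]; first exact: le_trans (h1 x) SS.
by apply: le_trans (h2 x y) _; rewrite ler_wpM2r// powR_ge0.
Qed.

Lemma holder_bound_ge0 a S H phi : holder_bound a S H phi -> 0 <= S.
Proof. by move=> [h _]; apply: le_trans (h point); exact: normc_ge0. Qed.

Lemma normc_iter_ctransfer n phi S : (forall x, normc (phi x) <= S) ->
  forall x, normc (iter n ctransfer phi x) <= S.
Proof.
move=> h x; rewrite iter_ctransferE; apply: le_trans (normc_word_mean _ _) _.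
by rewrite -(word_mean_cst s n S); apply: word_mean_le => w _.
Qed.

Lemma normc_iter_ctransferB n phi x y a H :
  (forall x y, normc (phi x - phi y) <= H * dist x y `^ a) ->
  normc (iter n ctransfer phi x - iter n ctransfer phi y) <=
  H * word_mean n (fun w : seq I => dist (word_map w x) (word_map w y) `^ a).
Proof.
move=> h; rewrite !iter_ctransferE cword_meanB; apply: le_trans (normc_word_mean _ _) _.
by rewrite -word_meanZ; apply: word_mean_le => w _.
Qed.

Lemma holder_bound_ctransfer a : 0 < a -> exists2 C : R, 1 <= C &
  forall S H phi, 0 <= H -> holder_bound a S H phi -> holder_bound a S (C * H) (ctransfer phi).
Proof.
move=> a0; have [M M1 hM] := ifs_lip s.
have M0 : 0 <= M by lra.
exists (M `^ a).
  by rewrite -(powRr0 M); apply: ler_powR => //; exact: ltW.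
move=> S H phi H0 [h1 h2]; split=> [x|x y].
  exact: (@normc_iter_ctransfer 1 phi).
apply: le_trans (@normc_iter_ctransferB 1 phi x y a H h2) _.
have -> : M `^ a * H * dist x y `^ a = H * (M `^ a * dist x y `^ a) by ring.
rewrite ler_wpM2l// -(word_mean_cst s 1 (M `^ a * _)).
apply: word_mean_le => -[|j [|? ?]]//= _.
rewrite -powRM ?cantor_dist_ge0//; apply: ge0_ler_powR; rewrite ?nnegrE ?cantor_dist_ge0 ?(ltW a0)//.
by rewrite mulr_ge0 ?cantor_dist_ge0.
Qed.

Section LasotaYorke.
Context (a : R) (N : nat) (rho eta : R).
Hypotheses (a0 : 0 < a) (rho0 : 0 <= rho < 1) (eta0 : 0 < eta).
Hypothesis contr : forall x y, dist x y < eta ->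
  word_mean N (fun w : seq I => dist (word_map w x) (word_map w y) `^ a) <= rho * dist x y `^ a.

(** Pairs closer than [eta] are contracted in mean; for the others the trivial bound [2 * S] is
    absorbed by [(dist x y / eta) ^ a >= 1]. *)
Lemma lasota_yorke1 S H phi : 0 <= H -> holder_bound a S H phi ->
  holder_bound a S (rho * H + 2 / eta `^ a * S) (iter N ctransfer phi).
Proof.
move=> H0 hb; have S0 := holder_bound_ge0 hb; have [h1 h2] := hb.
have e0 : 0 < eta `^ a by rewrite powR_gt0.
split=> [x|x y]; first exact: normc_iter_ctransfer.
rewrite mulrDl; have [xy|xy] := ltP (dist x y) eta.
  apply: le_trans (@normc_iter_ctransferB N phi x y a H h2) _.
  apply: ler_wpDr; first by rewrite mulr_ge0 ?powR_ge0// mulr_ge0// divr_ge0// ltW.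
  have -> : rho * H * dist x y `^ a = H * (rho * dist x y `^ a) by ring.
  by rewrite ler_wpM2l//; exact: contr.
apply: ler_wpDl; first by rewrite mulr_ge0 ?powR_ge0// mulr_ge0//; case/andP: rho0.
apply: le_trans (le_normcD _ _) _; rewrite normcN.
apply: (@le_trans _ _ (2 * S)).
  by have := normc_iter_ctransfer N h1 x; have := normc_iter_ctransfer N h1 y; lra.
have -> : 2 / eta `^ a * S * dist x y `^ a = (2 * S) * (dist x y `^ a / eta `^ a) by ring.
rewrite ler_peMr ?mulr_ge0// ler_pdivlMr// mul1r.
by apply: ge0_ler_powR; rewrite ?nnegrE ?(ltW a0) ?(ltW eta0) ?cantor_dist_ge0.
Qed.

(** The geometric series of the errors in [lasota_yorke1], that is, the fixed point of that
    recursion for [S = 1]. *)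
Definition ly_const : R := 2 / eta `^ a / (1 - rho).

Lemma ly_const_ge0 : 0 <= ly_const.
Proof.
by have /andP[? ?] := rho0; rewrite divr_ge0 ?divr_ge0 ?powR_ge0// subr_ge0 ltW.
Qed.

Lemma lasota_yorke j S H phi : 0 <= H -> holder_bound a S H phi ->
  holder_bound a S (rho ^+ j * H + ly_const * S) (iter (j * N) ctransfer phi).
Proof.
move=> H0 hb; have S0 := holder_bound_ge0 hb; have /andP[r0 r1] := rho0.
have c0 := ly_const_ge0.
elim: j => [|j IH].
  by rewrite mul0n expr0 mul1r /=; apply: holder_boundW hb => //; rewrite lerDl mulr_ge0.
rewrite mulSn iterD; apply: holder_boundW (lasota_yorke1 _ IH) => //.
  rewrite mulrDr mulrA -exprS -addrA lerD2l mulrA -mulrDl ler_wpM2r//.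
  have -> : 2 / eta `^ a = (1 - rho) * ly_const.
    by rewrite /ly_const [RHS]mulrC divfK// gt_eqF// subr_gt0.
  lra.
by apply: addr_ge0; apply: mulr_ge0 => //; exact: exprn_ge0.
Qed.

Lemma holder_bound_iter : exists2 C : R, 0 <= C & forall k S H phi, 0 <= H ->
  holder_bound a S H phi -> holder_bound a S (C * (S + H)) (iter k ctransfer phi).
Proof.
have [M M1 hM] := holder_bound_ctransfer a0; have /andP[r0 r1] := rho0.
have M0 : 0 <= M by lra.
have hMk k S H phi : 0 <= H -> holder_bound a S H phi -> holder_bound a S (M ^+ k * H) (iter k ctransfer phi).
  move=> H0 hb; elim: k => [|k IH]; first by rewrite expr0 mul1r.
  by rewrite iterS exprS -mulrA; apply: hM => //; rewrite mulr_ge0 ?exprn_ge0.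
exists (M ^+ N + ly_const); first by rewrite addr_ge0 ?ly_const_ge0// exprn_ge0.
move=> k S H phi H0 hb; have S0 := holder_bound_ge0 hb.
(* For [N = 0] the contraction hypothesis would put a positive number below [rho] times itself; K
   has no isolated point, so close distinct points exist. *)
have [N0|N0] := posnP N.
  exfalso.
  have [y xy yd] := cantor_perfect (point : K) eta0.
  have := contr yd; rewrite N0 /= leNgt => /negP; apply.
  by rewrite gtr_pMl// powR_gt0// dist_gt0.
have H1 : 0 <= M ^+ (k %% N)%N * H by rewrite mulr_ge0// exprn_ge0.
have := lasota_yorke (k %/ N)%N H1 (hMk (k %% N)%N S H phi H0 hb).
rewrite -iterD -divn_eq; apply: holder_boundW => //.
have hj : rho ^+ (k %/ N)%N <= 1 by apply: exprn_ile1 => //; exact: ltW.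
have hMN : M ^+ (k %% N)%N <= M ^+ N by rewrite ler_weXn2l// ltnW// ltn_mod.
  have h1 : rho ^+ (k %/ N)%N * (M ^+ (k %% N)%N * H) <= M ^+ N * H.
    apply: (@le_trans _ _ (1 * (M ^+ (k %% N)%N * H))); first exact: ler_wpM2r.
  by rewrite mul1r ler_wpM2r.
  apply: le_trans (lerD h1 (lexx _)) _.
  have : 0 <= M ^+ N * S by rewrite mulr_ge0 ?exprn_ge0.
  have : 0 <= ly_const * H by rewrite mulr_ge0 ?ly_const_ge0.
  lra.
Qed.

End LasotaYorke.

End ComplexTransfer.

Section SpanBox.
Context {R : realType} {V : normedModType R[i]}.

(** Coefficients are real so that compactness reduces to that of [[-1, 1]]; complex ones are
    obtained by listing both [b] and ['i *: b], as in [proj_basis]. *)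
Fixpoint span_box (bs : seq V) : set V :=
  if bs is b :: bs' then [set ((p.1)%:C)%C *: b + p.2 | p in `[(-1 : R), 1]%classic `*` span_box bs']
  else [set 0].

Lemma scale_real_continuous (b : V) : continuous (fun x : R => (x%:C)%C *: b : V).
Proof.
move=> x A /nbhs_ballP[e /= e0 he]; apply/nbhs_ballP.
move: e0 he; case: e => e e' /=; rewrite ltcE/= => /andP[/eqP -> e0] he.
have [nb nbE] : exists nb : R, `|b| = (nb%:C)%C.
  exists (complex.Re `|b|); have := normr_ge0 b; case: `|b| => u v; rewrite lecE /= => /andP[/eqP -> _] //.
have nb0 : 0 <= nb by have := normr_ge0 b; rewrite nbE lecR.
exists (e / (nb + 1)) => /=; first by rewrite divr_gt0// ltr_wpDl.
move=> y xy; apply: he; rewrite -ball_normE /= -scalerBl normrZ nbE.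
rewrite -rmorphB/= normc_def /= expr0n /= addr0 sqrtr_sqr -rmorphM/=.
change ((`|x - y| * nb)%:C%C < (e%:C)%C); rewrite ltcR.
have xy' : `|x - y| < e / (nb + 1) by exact: xy.
rewrite ltr_pdivlMr in xy'; last by rewrite ltr_wpDl.
by apply: le_lt_trans xy'; rewrite ler_wpM2l// lerDl.
Qed.

Lemma span_box_compact bs : compact (span_box bs).
Proof.
elim: bs => [|b bs IH] /=; first exact: compact_set1.
apply: continuous_compact; last by apply: compact_setX => //; exact: segment_compact.
apply: continuous_subspaceT => -[x v].
apply: (@cvgD _ _ _ _ _ (fun p : R * V => ((p.1)%:C)%C *: b) snd).
  apply: (@cvg_comp _ _ _ fst (fun x : R => (x%:C)%C *: b) _ (nbhs x)); first exact: cvg_fst.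
  exact: scale_real_continuous.
exact: cvg_snd.
Qed.

Lemma compact_closure_sub (A B : set V) : compact A -> B `<=` A -> compact (closure B).
Proof.
move=> cA BA; have clA : closed A by apply: compact_closed => //; exact: norm_hausdorff.
have -> : closure B = A `&` closure B.
  rewrite setIidr//; have := closure_subset BA.
  by rewrite -(proj1 (closure_id A) clA).
by apply: compact_closedI => //; exact: closed_closure.
Qed.

End SpanBox.

Lemma ctransfer_linear {R : realType} {K : cantorSet R} (s : cantor_ifs K) (c : R[i])
    (phi psi : K -> R[i]) x :
  ctransfer s (fun y => c * phi y + psi y) x = c * ctransfer s phi x + ctransfer s psi x.
Proof.
rewrite !ctransferE mulr_sumr -big_split; apply: eq_bigr => j _ /=.
by rewrite mulrDr mulrCA.
Qed.

Lemma class_rep_far {R : realType} {K : cantorSet R} r (x y : K) :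
  class_rep r x != class_rep r y -> r <= cantor_dist x y.
Proof.
move=> nxy; rewrite leNgt; apply/negP => h; move/eqP: nxy; apply; apply: class_rep_eq.
exact: (@chain_class_saturated _ _ r x x y (@chain_class_refl _ _ r x) h).
Qed.

Section HolderSpace.
Context {R : realType} {K : cantorSet R} (a : R).
Local Notation dist := (@cantor_dist R K).

Lemma holder_boundP S H (phi : K -> R[i]) : holder_bound a S H phi -> phi \in @holder_pred R K a.
Proof.
move=> [h1 h2]; apply/asboolP; exists (Num.max S H); split=> [x|x y].
  by apply: le_trans (h1 x) _; rewrite le_max lexx.
by apply: le_trans (h2 x y) _; rewrite ler_wpM2r ?powR_ge0// le_max lexx orbT.
Qed.

Lemma holder_boundE (phi : holder K a) : 0 < a ->
  holder_bound a (sup_norm phi) (holder_seminorm phi) phi.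
Proof.
move=> a0; split=> [x|x y]; first exact: sup_norm_ub.
have [->|nxy] := eqVneq x y.
  by rewrite subrr normc0 distxx powR0 ?gt_eqF// mulr0.
rewrite -ler_pdivrMr; first exact: holder_seminorm_ub.
by rewrite powR_gt0// dist_gt0.
Qed.

Lemma holder_norm_le (phi : holder K a) S H : 0 <= H -> holder_bound a S H phi ->
  holder_norm phi <= S + H.
Proof.
move=> H0 [h1 h2]; apply: lerD; first exact: sup_norm_le.
by apply: holder_seminorm_le => x y; have := holder_ratio_le h2 x y; rewrite (max_idPl _).
Qed.

Lemma normc_holder (phi : holder K a) : complex.Re `|phi| = holder_norm phi.
Proof. by []. Qed.

Lemma holder_le1 (phi : holder K a) : `|phi| <= 1 -> holder_norm phi <= 1.
Proof. by rewrite -[leLHS]/((holder_norm phi)%:C)%C lecR. Qed.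

End HolderSpace.

Section QuasiCompact.
Context {R : realType} {K : cantorSet R} (s : cantor_ifs K) (a : R).
Hypothesis a0 : 0 < a.
Implicit Types (r : R).
Local Notation dist := (@cantor_dist R K).
Local Notation ctransfer := (ctransfer s).

Lemma ctransfer_holder (phi : holder K a) : ctransfer phi \in @holder_pred R K a.
Proof.
have [C C1 hC] := holder_bound_ctransfer s a0.
exact: (holder_boundP (hC _ _ _ (holder_seminorm_ge0 phi) (holder_boundE phi a0))).
Qed.

Definition transfer_holder (phi : holder K a) : holder K a := Holder (ctransfer_holder phi).

Lemma transfer_holder_linear : linear transfer_holder.
Proof.
move=> c phi psi; apply/val_inj/funext => x.
exact: (ctransfer_linear s c phi psi x).
Qed.

Lemma transfer_linear : exists L : {linear holder K a -> holder K a},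
  forall phi x, L phi x = ctransfer phi x.
Proof.
pose L : {linear holder K a -> holder K a} :=
  HB.pack transfer_holder (GRing.isLinear.Build _ _ _ _ transfer_holder transfer_holder_linear).
by exists L.
Qed.

Context (L : {linear holder K a -> holder K a}).
Hypothesis LE : forall phi x, L phi x = ctransfer phi x.

Lemma iter_linE n (phi : holder K a) x : iter n L phi x = iter n ctransfer phi x.
Proof.
elim: n x => [|n IH] x //=; rewrite LE; congr (ctransfer _ x).
by apply/funext => y.
Qed.

Lemma iter_linD n (phi psi : holder K a) : iter n L (phi + psi) = iter n L phi + iter n L psi.
Proof. by elim: n => //= n ->; rewrite linearD. Qed.

Lemma iter_linZ n c (phi : holder K a) : iter n L (c *: phi) = c *: iter n L phi.
Proof. by elim: n => //= n ->; rewrite linearZ. Qed.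

Lemma iter_lin_sum n (J : Type) (t : seq J) (F : J -> holder K a) :
  iter n L (\sum_(j <- t) F j) = \sum_(j <- t) iter n L (F j).
Proof.
elim: t => [|j t IH]; last by rewrite !big_cons iter_linD IH.
by rewrite !big_nil; elim: n => //= n ->; rewrite linear0.
Qed.

Lemma class_indicator_holder r (c : K) : 0 < r ->
  (fun x => ((class_rep r x == c)%:R : R[i])) \in @holder_pred R K a.
Proof.
move=> r0; apply: (@holder_boundP _ _ a 1 (2 / r `^ a)); split=> [x|x y].
  by case: (_ == _); rewrite ?normc0 ?normc1.
have [xy|nxy] := eqVneq (class_rep r x) (class_rep r y).
  by rewrite xy subrr normc0 mulr_ge0 ?powR_ge0// divr_ge0 ?powR_ge0.
have rxy := class_rep_far nxy.
apply: (@le_trans _ _ 2).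
  apply: le_trans (le_normcD _ _) _; rewrite normcN.
  by do 2! case: (_ == _); rewrite ?normc0 ?normc1; lra.
rewrite -mulrA ler_peMr// mulrC ler_pdivlMr ?powR_gt0// mul1r.
by apply: ge0_ler_powR; rewrite ?nnegrE ?(ltW a0) ?(ltW r0) ?cantor_dist_ge0.
Qed.

Lemma bounded_op_transfer : (op_norm L < +oo)%E.
Proof.
have [C C1 hC] := holder_bound_ctransfer s a0.
apply: (@le_lt_trans _ _ (1 + C)%:E); last exact: ltry.
apply: ge_ereal_sup => _ [phi /holder_le1 phi1 <-]; rewrite lee_fin normc_holder.
have s0 := holder_seminorm_ge0 phi; have s1 := sup_norm_ge0 phi.
have := @holder_norm_le _ _ a (L phi) (sup_norm phi) (C * holder_seminorm phi) _ _.
move=> h; apply: le_trans (h _ _) _.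
- by apply: mulr_ge0 => //; lra.
- rewrite (_ : (L phi : K -> R[i]) = ctransfer phi); last by apply/funext => x; exact: LE.
  exact: hC s0 (holder_boundE phi a0).
- rewrite /holder_norm in phi1; apply: lerD; first by lra.
  by rewrite -[leRHS]mulr1 ler_wpM2l//; lra.
Qed.

Section Projection.
Context (r : R) (r0 : 0 < r) (t : seq K).
Hypotheses (ut : uniq t) (rt : forall x, class_rep r x \in t).

Definition class_indicator (c : K) : holder K a := Holder (class_indicator_holder c r0).

Definition class_proj n (phi : holder K a) : holder K a :=
  \sum_(c <- t) phi c *: iter n L (class_indicator c).

Lemma class_proj_linear n : linear (class_proj n).
Proof.
move=> z phi psi; rewrite /class_proj scaler_sumr -big_split; apply: eq_bigr => c _ /=.
transitivity ((z * phi c + psi c) *: iter n L (class_indicator c)) => //.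
by rewrite scalerDl scalerA.
Qed.

Lemma holder_sumE (J : Type) (u : seq J) (F : J -> holder K a) x :
  (\sum_(j <- u) F j) x = \sum_(j <- u) F j x.
Proof.
by elim: u => [|j u IH]; rewrite ?big_nil// !big_cons -IH.
Qed.

Lemma class_proj0E (phi : holder K a) x : class_proj 0 phi x = phi (class_rep r x).
Proof.
rewrite /class_proj holder_sumE (bigD1_seq (class_rep r x))//= big1 => [|c /negPf cx].
  rewrite addr0; transitivity (phi (class_rep r x) * (class_rep r x == class_rep r x)%:R : R[i]) => //.
  by rewrite eqxx mulr1.
transitivity (phi c * (class_rep r x == c)%:R : R[i]) => //.
by rewrite eq_sym cx mulr0.
Qed.

Lemma class_projE n (phi : holder K a) : class_proj n phi = iter n L (class_proj 0 phi).
Proof.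
rewrite /class_proj iter_lin_sum; apply: eq_bigr => c _.
by rewrite iter_linZ.
Qed.

Definition proj_basis n : seq (holder K a) :=
  flatten [seq [:: iter n L (class_indicator c); 'i%C *: iter n L (class_indicator c)] | c <- t].

Lemma class_proj_span n (phi : holder K a) : (forall x, normc (phi x) <= 1) ->
  span_box (proj_basis n) (class_proj n phi).
Proof.
move=> h; rewrite /class_proj /proj_basis; elim: (t) => [|c u IH]; first by rewrite /= big_nil.
rewrite big_cons /=.
have [re1 im1] : `|complex.Re (phi c)| <= 1 /\ `|complex.Im (phi c)| <= 1.
  have := h c; case: (phi c) => x y /=; rewrite -{1}sqrtr1 ler_sqrt// => hxy.
  have sq1 (v : R) : v ^+ 2 <= 1 -> `|v| <= 1.
    by move=> hv; rewrite -(ler_sqr (normr_ge0 _)) ?nnegrE// expr1n real_normK ?num_real.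
  by split; apply: sq1; apply: le_trans hxy; rewrite ?lerDl ?lerDr sqr_ge0.
exists (complex.Re (phi c), (complex.Im (phi c))%:C%C *: ('i%C *: iter n L (class_indicator c)) +
  \sum_(j <- u) phi j *: iter n L (class_indicator j)).
  split; first by rewrite /= in_itv/= -ler_norml.
  exists (complex.Im (phi c), \sum_(j <- u) phi j *: iter n L (class_indicator j)) => //.
  by split=> //; rewrite /= in_itv/= -ler_norml.
rewrite /= addrA scalerA -scalerDl; congr (_ *: _ + _).
by rewrite [in RHS](complexE (phi c)) [in RHS]mulrC.
Qed.

End Projection.

Section LY.
Context (N : nat) (rho eta : R).
Hypotheses (N0 : (0 < N)%N) (rho0 : 0 <= rho < 1) (eta0 : 0 < eta).
Hypothesis contr : forall x y, dist x y < eta ->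
  word_mean N (fun w : seq (ifs_idx s) => dist (word_map w x) (word_map w y) `^ a) <= rho * dist x y `^ a.

Lemma quasi_compact_transfer : quasi_compact L.
Proof.
split; first exact: bounded_op_transfer.
pose C := ly_const a rho eta.
have C0 : 0 <= C by exact: ly_const_ge0.
(* For a function of sup norm [d] and Holder constant [H], the iterate has norm at most
   [d * (1 + C) + rho ^ k * H]: the first term is 1/8, and [k] is chosen to make the second at most
   1/4. *)
pose d := (8 * (1 + C))^-1.
have d0 : 0 < d by rewrite invr_gt0 mulr_gt0//; lra.
have da0 : 0 < d `^ a^-1 by rewrite powR_gt0.
have [r r0 hr] := chain_class_small K da0.
have [t [ut rt ht _]] := finite_class_reps K r0.
(* The 1 comes from [phi], the rest from its frozen version, which differs only between points at
   distance at least [r]. *)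
pose H := 1 + 2 / r `^ a.
have H0 : 0 < H by rewrite ltr_pwDl// divr_ge0 ?powR_ge0.
have [k hk] : exists k, rho ^+ k * H <= 1 / 4.
  have /andP[rh0 rh1] := rho0.
  have : (fun k => rho ^+ k * H) @ \oo --> (0 : R).
    rewrite -[X in _ --> X](mul0r H); apply: cvgMl; apply: cvg_expr.
    by rewrite ger0_norm.
  move=> /cvgrPdist_le /(_ (1 / 4) _)[]; first by rewrite divr_gt0.
  move=> k _ /(_ k (leqnn k)) /=; rewrite sub0r normrN => h; exists k.
  exact: le_trans (ler_norm _) h.
pose Q : {linear holder K a -> holder K a} := HB.pack (class_proj r0 t (k.+1 * N)%N)
  (GRing.isLinear.Build _ _ _ _ (class_proj r0 t (k.+1 * N)%N) (class_proj_linear r0 t (k.+1 * N)%N)).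
exists (k.+1 * N)%N, Q; split; first by rewrite muln_gt0.
  rewrite /compact_operator.
  apply: (@compact_closure_sub _ _ (span_box (proj_basis r0 t (k.+1 * N)%N)) _ (@span_box_compact _ _ _)).
  move=> _ [phi /= /holder_le1 phi1 <-]; apply: class_proj_span => x.
  apply: le_trans (sup_norm_ub phi x) _; apply: le_trans phi1.
  by rewrite /holder_norm lerDl holder_seminorm_ge0.
apply: (@le_lt_trans _ _ (1 / 2)%:E); last by rewrite lte_fin; lra.
apply: ge_ereal_sup => _ [phi /holder_le1 phi1 <-]; rewrite lee_fin normc_holder.
have s0 := holder_seminorm_ge0 phi; have s1 := sup_norm_ge0 phi.
have hb := holder_boundE phi a0; rewrite /holder_norm in phi1.
pose psi := phi - class_proj r0 t 0 phi.
have psiE x : psi x = phi x - phi (class_rep r x).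
  by rewrite [LHS]/(phi x - class_proj r0 t 0 phi x) class_proj0E.
have -> : iter (k.+1 * N) L phi - class_proj r0 t (k.+1 * N) phi = iter (k.+1 * N) L psi.
  by rewrite class_projE /psi -scaleN1r -[X in _ = iter _ _ (_ + X)]scaleN1r iter_linD iter_linZ.
have hpsi : holder_bound a d H psi.
  split=> [x|x y]; rewrite !psiE.
    apply: le_trans (proj2 hb _ _) _; rewrite -[leRHS]mul1r.
    apply: ler_pM => //; [exact: powR_ge0|lra|].
    have xr : dist x (class_rep r x) < d `^ a^-1 by apply: hr; exact: class_repP.
    have -> : d = (d `^ a^-1) `^ a by rewrite -powRrM mulVf ?gt_eqF// powRr1// ltW.
    by apply: ge0_ler_powR; rewrite ?nnegrE ?(ltW a0) ?cantor_dist_ge0 ?powR_ge0// ltW.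
  have -> : phi x - phi (class_rep r x) - (phi y - phi (class_rep r y)) =
     (phi x - phi y) + (phi (class_rep r y) - phi (class_rep r x)) by ring.
  apply: le_trans (le_normcD _ _) _; rewrite mulrDl; apply: lerD.
    by apply: le_trans (proj2 hb x y) _; rewrite ler_wpM2r ?powR_ge0//; lra.
  have [xy|nxy] := eqVneq (class_rep r x) (class_rep r y).
    by rewrite xy subrr normc0 mulr_ge0 ?powR_ge0// divr_ge0 ?powR_ge0.
  have rxy := class_rep_far nxy.
  apply: (@le_trans _ _ 2).
    apply: le_trans (le_normcD _ _) _; rewrite normcN.
    have := proj1 hb (class_rep r x); have := proj1 hb (class_rep r y); lra.
  rewrite -mulrA ler_peMr// mulrC ler_pdivlMr ?powR_gt0// mul1r.
  by apply: ge0_ler_powR; rewrite ?nnegrE ?(ltW a0) ?(ltW r0) ?cantor_dist_ge0.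
have h1 := lasota_yorke a0 rho0 eta0 contr k.+1 (ltW H0) hpsi.
have h2 : holder_bound a d (rho ^+ k.+1 * H + ly_const a rho eta * d) (iter (k.+1 * N) L psi).
  by rewrite (_ : (iter (k.+1 * N) L psi : K -> R[i]) = iter (k.+1 * N) ctransfer psi);
    last by apply/funext => x; exact: iter_linE.
have /andP[rh0 rh1] := rho0.
have hk1 : 0 <= rho ^+ k.+1 * H <= 1 / 4.
  rewrite mulr_ge0 ?exprn_ge0 ?(ltW H0)//=; apply: le_trans hk.
  by rewrite ler_wpM2r ?(ltW H0)// exprS ler_piMl ?exprn_ge0// ltW.
have /andP[hk2 hk3] := hk1.
have Cd0 : 0 <= ly_const a rho eta * d by rewrite mulr_ge0// ltW.
apply: le_trans (holder_norm_le (addr_ge0 hk2 Cd0) h2) _.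
have Cd : d + ly_const a rho eta * d = 1 / 8.
  rewrite -/C -{1}[d]mul1r -mulrDl /d; field; rewrite gt_eqF//; lra.
lra.
Qed.

End LY.

End QuasiCompact.

(** * Complex ultrafilter limits and twisted Cesaro averages *)

Section ComplexUltraLimit.
Context {R : realType}.
Implicit Types (F G : nat -> R[i]) (z : R[i]).

Definition culim F : R[i] := Complex (ulim (fun n => complex.Re (F n))) (ulim (fun n => complex.Im (F n))).

Lemma Re_le_normc z : `|complex.Re z| <= normc z.
Proof.
case: z => x y /=; rewrite -sqrtr_sqr ler_sqrt ?lerDl ?sqr_ge0//.
by rewrite addr_ge0 ?sqr_ge0.
Qed.

Lemma Im_le_normc z : `|complex.Im z| <= normc z.
Proof.
case: z => x y /=; rewrite -sqrtr_sqr ler_sqrt ?lerDr ?sqr_ge0//.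
by rewrite addr_ge0 ?sqr_ge0.
Qed.

Definition cbounded F := exists B : R, forall n, normc (F n) <= B.

Lemma cbounded_Re F : cbounded F -> bounded_fun (fun n => complex.Re (F n)).
Proof. by move=> [B hB]; exists B => n; exact: le_trans (Re_le_normc _) (hB n). Qed.

Lemma cbounded_Im F : cbounded F -> bounded_fun (fun n => complex.Im (F n)).
Proof. by move=> [B hB]; exists B => n; exact: le_trans (Im_le_normc _) (hB n). Qed.

Lemma ulimZ (c : R) (u : nat -> R) : bounded_fun u -> ulim (fun n => c * u n) = c * ulim u.
Proof. by move=> bu; rewrite ulimM ?ulim_cst//; exact: bounded_cst. Qed.

Lemma culimD F G : cbounded F -> cbounded G -> culim (fun n => F n + G n) = culim F + culim G.
Proof.
move=> bF bG; rewrite /culim.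
transitivity (Complex (ulim (fun n => complex.Re (F n)) + ulim (fun n => complex.Re (G n)))
  (ulim (fun n => complex.Im (F n)) + ulim (fun n => complex.Im (G n)))) => //.
rewrite -!ulimD; try exact: cbounded_Re; try exact: cbounded_Im.
by congr Complex; congr ulim; apply/funext => n; case: (F n) (G n) => ? ? [? ?].
Qed.

Lemma culimZ z F : cbounded F -> culim (fun n => z * F n) = z * culim F.
Proof.
case: z => a b bF; have bR := cbounded_Re bF; have bI := cbounded_Im bF.
rewrite /culim; transitivity (Complex (a * ulim (fun n => complex.Re (F n)) - b * ulim (fun n => complex.Im (F n)))
  (a * ulim (fun n => complex.Im (F n)) + b * ulim (fun n => complex.Re (F n)))) => //.
have b1 (c : R) (u : nat -> R) : bounded_fun u -> bounded_fun (fun n => c * u n).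
  by move=> bu; apply: bounded_funM => //; exact: bounded_cst.
rewrite -mulNr -!ulimZ// -!ulimD; try exact: b1.
by congr Complex; congr ulim; apply/funext => n; case: (F n) => u v /=; rewrite ?mulNr.
Qed.

Lemma culim_cst z : culim (fun=> z) = z.
Proof. by rewrite /culim !ulim_cst; case: z. Qed.

(** Multiplicativity of [ulim] makes the squared modulus of the limit the limit of the squared
    moduli. *)
Lemma normc_culim F B : (forall n, normc (F n) <= B) -> normc (culim F) <= B.
Proof.
move=> h; have bF : cbounded F by exists B.
have B0 : 0 <= B := le_trans (normc_ge0 _) (h 0%N).
have bR := cbounded_Re bF; have bI := cbounded_Im bF.
rewrite /culim /normc -[leRHS](ger0_norm B0) -sqrtr_sqr ler_sqrt ?sqr_ge0//.
rewrite !expr2 -!ulimM// -ulimD; [|exact: bounded_funM|exact: bounded_funM].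
rewrite -[leRHS]ulim_cst; apply: ulim_le.
- by apply: bounded_funD; exact: bounded_funM.
- exact: bounded_cst.
move=> n; have := h n; case: (F n) => x y /=.
by rewrite -[leRHS](ger0_norm B0) -sqrtr_sqr ler_sqrt ?sqr_ge0.
Qed.

Lemma culim_near F G (B : R) : cbounded F -> cbounded G ->
  (forall n, normc (F n - G n) <= n.+1%:R^-1 * B) -> culim F = culim G.
Proof.
move=> bF bG h.
have B0 : 0 <= B by have := le_trans (normc_ge0 _) (h 0%N); rewrite invr1 mul1r.
have aux (p : R[i] -> R) : (forall z, `|p z| <= normc z) -> (forall z w, p (z - w) = p z - p w) ->
   ulim (fun n => p (F n)) = ulim (fun n => p (G n)).
  move=> pn pB; have bp H : cbounded H -> bounded_fun (fun n => p (H n)).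
    by move=> [C hC]; exists C => n; exact: le_trans (pn _) (hC n).
  have d0 : (p (F n) - p (G n)) @[n --> \oo] --> (0 : R).
    apply/norm_cvg0P; apply: (@squeeze_cvgr _ _ _ _ (fun=> 0) (fun n => n.+1%:R^-1 * B)).
    - near=> n; rewrite normr_ge0/= -pB; exact: le_trans (pn _) (h n).
    - exact: cvg_cst.
    - by rewrite -[X in _ --> X](mul0r B); apply: cvgMl; exact: cvg_harmonic.
  rewrite -[RHS]addr0 -(ulimE d0) -ulimD; [|exact: bp|].
    by congr ulim; apply/funext => n; rewrite addrC subrK.
  by apply: bounded_funB; exact: bp.
rewrite /culim; congr Complex; apply: aux.
- exact: Re_le_normc.
- by move=> [? ?] [? ?].
- exact: Im_le_normc.
- by move=> [? ?] [? ?].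
Unshelve. all: by end_near. Qed.

End ComplexUltraLimit.

Section TwistedAverage.
Context {R : realType} {K : cantorSet R} (s : cantor_ifs K).
Local Notation dist := (@cantor_dist R K).
Local Notation I := (ifs_idx s).
Local Notation ctransfer := (ctransfer s).
Implicit Types (x y : K) (phi psi : K -> R[i]) (z : R[i]).

Lemma iter_ctransferD n phi psi x : iter n ctransfer (fun y => phi y + psi y) x =
  iter n ctransfer phi x + iter n ctransfer psi x.
Proof.
elim: n x => [//|n IH] x; rewrite !iterS !ctransferE -big_split; apply: eq_bigr => j _.
by rewrite IH mulrDr.
Qed.

Lemma iter_ctransferZ n z phi x : iter n ctransfer (fun y => z * phi y) x = z * iter n ctransfer phi x.
Proof.
elim: n x => [//|n IH] x; rewrite !iterS !ctransferE mulr_sumr; apply: eq_bigr => j _.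
by rewrite IH mulrCA.
Qed.

Lemma iter_ctransfer_sum n (J : Type) (t : seq J) (F : J -> K -> R[i]) x :
  iter n ctransfer (fun y => \sum_(i <- t) F i y) x = \sum_(i <- t) iter n ctransfer (F i) x.
Proof.
elim: t => [|i t IH].
  rewrite big_nil (_ : (fun y => _) = (fun y => 0 * (0 : R[i]))).
    by rewrite (iter_ctransferZ n 0 (fun=> 0)) mul0r.
  by apply/funext => y; rewrite big_nil mul0r.
rewrite big_cons -IH -iter_ctransferD; congr (iter n ctransfer _ x).
by apply/funext => y; rewrite big_cons.
Qed.

Lemma bounded_word_mean n (F : nat -> seq I -> R) : (forall w, bounded_fun (fun k => F k w)) ->
  bounded_fun (fun k => word_mean n (F k)).
Proof.
elim: n F => [|n IH] F bF /=; first exact: bF.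
apply: bounded_fun_sum => j; apply: bounded_funM; first exact: bounded_cst.
exact: (IH (fun k w => F k (j :: w))).
Qed.

Lemma ulim_word_mean n (F : nat -> seq I -> R) : (forall w, bounded_fun (fun k => F k w)) ->
  word_mean n (fun w => ulim (fun k => F k w)) = ulim (fun k => word_mean n (F k)).
Proof.
elim: n F => [|n IH] F bF //=.
have bw j : bounded_fun (fun k => word_mean n (fun w => F k (j :: w))).
  by apply: (bounded_word_mean n (F := fun k w => F k (j :: w))).
transitivity (\sum_j ulim (fun k => ifs_wt j * word_mean n (fun w => F k (j :: w)))).
  by apply: eq_bigr => j _; rewrite ulimZ// (IH (fun k w => F k (j :: w))).
elim: (index_enum _) => [|j t IHt].
  by rewrite big_nil -[LHS](ulim_cst (0 : R)); congr ulim; apply/funext => k; rewrite big_nil.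
rewrite big_cons IHt -ulimD.
- by congr ulim; apply/funext => k; rewrite big_cons.
- by apply: bounded_funM => //; exact: bounded_cst.
- by apply: bounded_fun_sum => i; apply: bounded_funM => //; exact: bounded_cst.
Qed.

Lemma iter_ctransfer_culim n (F : nat -> K -> R[i]) x : (forall y, cbounded (fun k => F k y)) ->
  iter n ctransfer (fun y => culim (fun k => F k y)) x = culim (fun k => iter n ctransfer (F k) x).
Proof.
move=> bF; rewrite iter_ctransferE /cword_mean /culim /=; congr Complex.
  rewrite (@ulim_word_mean n (fun k w => complex.Re (F k (word_map w x)))).
    by congr ulim; apply/funext => k; rewrite iter_ctransferE.
  by move=> w; exact: cbounded_Re.
rewrite (@ulim_word_mean n (fun k w => complex.Im (F k (word_map w x)))).
  by congr ulim; apply/funext => k; rewrite iter_ctransferE.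
by move=> w; exact: cbounded_Im.
Qed.

(** The Cesaro averages of [z ^ k P ^ (k p) phi] inherit the uniform Holder bound of the iterates,
    and their ultralimit is fixed by [z P ^ p]. The third clause evaluates it where the twisted
    orbit is constant, so that it is known to be nonzero or nonconstant; the last one links it to
    real averages, for unique ergodicity. *)
Lemma twisted_average (a C : R) : (forall k S H phi, 0 <= H -> holder_bound a S H phi ->
    holder_bound a S (C * (S + H)) (iter k ctransfer phi)) ->
  forall (z : R[i]) p S H phi, normc z = 1 -> 0 <= H -> holder_bound a S H phi ->
  exists psi, [/\ holder_bound a S (C * (S + H)) psi,
    forall x, z * iter p ctransfer psi x = psi x,
    forall x c, (forall k, z ^+ k * iter (k * p) ctransfer phi x = c) -> psi x = c &
    z = 1 -> p = 1%N -> forall x, psi x =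
      Complex (ulim (fun n => cesaro s n (fun y => complex.Re (phi y)) x))
              (ulim (fun n => cesaro s n (fun y => complex.Im (phi y)) x))].
Proof.
move=> hC z p S H phi z1 H0 hb; have S0 := holder_bound_ge0 hb.
pose T k x := z ^+ k * iter (k * p) ctransfer phi x.
have zk k : normc (z ^+ k) = 1 by elim: k => [|k IH]; rewrite ?normc1// exprS normcM z1 IH mulr1.
have hT k : holder_bound a S (C * (S + H)) (T k).
  have [h1 h2] := hC (k * p)%N S H phi H0 hb; split=> [x|x y].
    by rewrite /T normcM zk mul1r.
  by rewrite /T -mulrBr normcM zk mul1r.
pose A n x : R[i] := ((n.+1%:R^-1)%:C)%C * \sum_(k < n.+1) T k x.
have normA n (F : 'I_n.+1 -> R[i]) B : (forall k, normc (F k) <= B) ->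
    normc (((n.+1%:R^-1)%:C)%C * \sum_(k < n.+1) F k) <= B.
  move=> h; rewrite normcM normc_real ger0_norm ?invr_ge0// ler_pdivrMl ?ltr0n//.
  apply: le_trans (normc_sum _ _) _.
  by rewrite mulr_natl -[in leRHS](card_ord n.+1) -sumr_const; apply: ler_sum.
have hA n : holder_bound a S (C * (S + H)) (A n).
  split=> [x|x y]; first by apply: normA => k; exact: (proj1 (hT k)).
  by rewrite /A -mulrBr -sumrB; apply: normA => k; exact: (proj2 (hT k)).
have bA x : cbounded (fun n => A n x) by exists S => n; exact: (proj1 (hA n)).
exists (fun x => culim (fun n => A n x)); split.
- split=> [x|x y]; first by apply: normc_culim => n; exact: (proj1 (hA n)).
  rewrite (_ : culim _ - culim _ = culim (fun n => A n x + (-1) * A n y)).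
    by apply: normc_culim => n; rewrite mulN1r; exact: (proj2 (hA n)).
  rewrite culimD ?culimZ ?mulN1r//.
  by exists S => n; rewrite mulN1r normcN; exact: (proj1 (hA n)).
- move=> x; have bI y : cbounded (fun n => iter p ctransfer (A n) y).
    by exists S => n; apply: normc_iter_ctransfer; exact: (proj1 (hA n)).
  rewrite iter_ctransfer_culim// -culimZ//.
  have E n : z * iter p ctransfer (A n) x = A n x + ((n.+1%:R^-1)%:C)%C * (T n.+1 x - T 0%N x).
    rewrite /A iter_ctransferZ iter_ctransfer_sum mulrCA -mulrDr; congr (_ * _).
    rewrite mulr_sumr (eq_bigr (fun k : 'I_n.+1 => T k.+1 x)); last first.
      by move=> k _; rewrite /T iter_ctransferZ -iterD mulrA -exprS mulSn.
    rewrite big_ord_recr [in RHS]big_ord_recl /=.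
    set Sm := \sum_(i < n) _; change (Sm + T n.+1 x = T 0%N x + Sm + (T n.+1 x - T 0%N x)).
    by ring.
  apply: (@culim_near _ _ _ (S + S)) => //.
    by exists S => n; rewrite normcM z1 mul1r; apply: normc_iter_ctransfer; exact: (proj1 (hA n)).
  move=> n; rewrite E addrC addKr normcM normc_real ger0_norm ?invr_ge0//.
  rewrite ler_wpM2l ?invr_ge0//; apply: le_trans (le_normcD _ _) _; rewrite normcN.
  by apply: lerD; exact: (proj1 (hT _)).
- move=> x c h; rewrite -[RHS]culim_cst; congr culim; apply/funext => n.
  rewrite /A (eq_bigr (fun=> c)) => [|k _]; last exact: h.
  rewrite sumr_const card_ord -[c *+ n.+1]mulr_natl mulrA.
  have -> : ((n.+1%:R^-1)%:C)%C * n.+1%:R = 1 :> R[i].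
    by rewrite -(rmorph_nat (real_complex R)) -rmorphM/= mulVf ?pnatr_eq0.
  by rewrite mul1r.
- move=> zE pE x; rewrite /culim; congr Complex; congr ulim; apply/funext => n.
    rewrite /A /cesaro (_ : \sum_(k < n.+1) T k x = Complex (\sum_(k < n.+1) iter k (transfer s) (fun y => complex.Re (phi y)) x)
        (\sum_(k < n.+1) iter k (transfer s) (fun y => complex.Im (phi y)) x)).
      by rewrite -complex_scale.
    rewrite complex_sum; apply: eq_bigr => k _.
    by rewrite /T zE pE expr1n mul1r muln1 iter_ctransfer_ReIm.
  rewrite /A /cesaro (_ : \sum_(k < n.+1) T k x = Complex (\sum_(k < n.+1) iter k (transfer s) (fun y => complex.Re (phi y)) x)
      (\sum_(k < n.+1) iter k (transfer s) (fun y => complex.Im (phi y)) x)).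
    by rewrite -complex_scale.
  rewrite complex_sum; apply: eq_bigr => k _.
  by rewrite /T zE pE expr1n mul1r muln1 iter_ctransfer_ReIm.
Qed.

End TwistedAverage.

(** * Peripheral spectrum *)

Section Separation.
Context {R : realType} (K : cantorSet R).
Local Notation dist := (@cantor_dist R K).
Implicit Types (x y : K) (Y Z : set K).

Definition unif_cont (f : K -> R) : Prop :=
  forall e, 0 < e -> exists2 d : R, 0 < d & forall x y, dist x y < d -> `|f x - f y| < e.

Lemma unif_cont_continuous f : unif_cont f -> continuous f.
Proof.
move=> uf x A /nbhs_ballP[e /= e0 he]; have [d d0 hd] := uf e e0.
by apply/nbhs_ballP; exists d => // y xy; apply: he; exact: hd.
Qed.

Lemma unif_cont_max f : unif_cont f -> exists x, forall y, f y <= f x.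
Proof.
move=> /unif_cont_continuous cf.
have [||x _ hx] := @compact_EVT_max K R f setT _ (@compact_cantor R K).
- by exists point.
- exact: continuous_subspaceT.
by exists x => y; apply: hx; exact: mem_set.
Qed.

Lemma unif_cont_level_closed f c : unif_cont f -> closed [set x | f x = c].
Proof.
move=> /unif_cont_continuous cf; rewrite (_ : [set x | _] = f @^-1` [set c])//.
by apply: closed_comp; [move=> x _; exact: cf|exact: closed_eq].
Qed.

(** Every point is at distance [e] from one of the two sets, and then any [d < e / 4] works around
    it; the near-covering form of compactness makes [d] uniform. *)
Lemma closed_separated Y Z : closed Y -> closed Z -> Y `&` Z = set0 ->
  \forall d \near (0 : R)^'+, forall y z, Y y -> Z z -> d <= dist y z.
Proof.
move=> cY cZ YZ.
have nc : near_covering [set: K] by apply/compact_near_coveringP; exact: compact_cantor.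
have H : \forall d \near (0 : R)^'+, forall x, setT x -> forall y z, Y y -> Z z -> dist x y < d -> d <= dist y z.
  apply: (nc R (0 : R)^'+ (fun d x => forall y z, Y y -> Z z -> dist x y < d -> d <= dist y z)) => x _.
  have aux (W : set K) : closed W -> ~ W x -> exists2 e : R, 0 < e & forall w, W w -> e <= dist x w.
    move=> cW nW; have : nbhs x (~` W) by apply: open_nbhs_nbhs; split=> //; exact: closed_openC.
    move=> /nbhs_ballP[e /= e0 he]; exists e => // w Ww; rewrite leNgt; apply/negP => h.
    exact: (he w h).
  have [Yx|nYx] := pselect (Y x).
    have nZx : ~ Z x by move=> Zx; have : (Y `&` Z) x by []; rewrite YZ.
    have [e e0 he] := aux Z cZ nZx.
    exists (ball x (e / 4), [set d : R | 0 < d < e / 4]) => /=.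
      split; first by apply: nbhsx_ballx; rewrite divr_gt0.
      near=> d; apply/andP; split; near: d; [exact: nbhs_right_gt|apply: nbhs_right_lt; rewrite divr_gt0//].
    move=> [x' d] [/= bx /andP[d0 de]] y z Yy Zz xy.
    have bx' : dist x x' < e / 4 by exact: bx.
    have := he z Zz; have := dist_triangle x' x z; have := dist_triangle y x' z; lra.
  have [e e0 he] := aux Y cY nYx.
  exists (ball x (e / 4), [set d : R | 0 < d < e / 4]) => /=.
    split; first by apply: nbhsx_ballx; rewrite divr_gt0.
    near=> d; apply/andP; split; near: d; [exact: nbhs_right_gt|apply: nbhs_right_lt; rewrite divr_gt0//].
  move=> [x' d] [/= bx /andP[d0 de]] y z Yy Zz xy.
  have bx' : dist x x' < e / 4 by exact: bx.
  have := he y Yy; have := dist_triangle x' x y; lra.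
have d_gt0 : \forall d \near (0 : R)^'+, 0 < d by exact: nbhs_right_gt.
apply: filterS2 H d_gt0 => d hd d0 y z Yy Zz.
by apply: (hd y) => //; rewrite distxx.
Unshelve. all: by end_near. Qed.

(** Below the separation scale a class meets at most one [F i], so the function can be taken
    constant on classes, hence Holder for the given exponent. *)
Lemma separating_function (a : R) (J : finType) (F : J -> set K) (v : J -> R[i]) (S : R) :
  0 < a -> 0 <= S -> (forall i, normc (v i) <= S) -> (forall i, closed (F i)) ->
  (forall i j, i != j -> F i `&` F j = set0) ->
  exists H phi, [/\ 0 <= H, holder_bound a S H phi & forall i x, F i x -> phi x = v i].
Proof.
move=> a0 S0 hv cF dF.
have sep : \forall d \near (0 : R)^'+, forall (ij : J * J), ij.1 != ij.2 ->
    forall y z, F ij.1 y -> F ij.2 z -> d <= dist y z.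
  apply: filter_forall => -[i j] /=; have [->|ij] := eqVneq i j.
    by apply: nearW => d /=.
  by have := closed_separated (cF i) (cF j) (dF i j ij); apply: filterS => d h _.
have [d [d0 hd]] : exists d : R, 0 < d /\ forall (ij : J * J), ij.1 != ij.2 ->
    forall y z, F ij.1 y -> F ij.2 z -> d <= dist y z.
  near (0 : R)^'+ => d; exists d; split; first by near: d; exact: nbhs_right_gt.
  by near: d.
have [r r0 hr] := chain_class_small K d0.
pose near_F x i := `[< exists2 y, F i y & chain_class r y x >].
pose phi x := if [pick i | near_F x i] is Some i then v i else 0.
have uniqF x i j : near_F x i -> near_F x j -> i = j.
  move=> /asboolP[y Fy yx] /asboolP[z Fz zx]; apply/eqP/negPn/negP => ij.
  have := hd (i, j) ij y z Fy Fz; rewrite leNgt => /negP; apply; apply: hr.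
  by apply: chain_class_trans yx _; exact: chain_class_sym.
have near_const x x' i : chain_class r x x' -> near_F x i -> near_F x' i.
  move=> xx' /asboolP[y Fy yx]; apply/asboolP; exists y => //.
  exact: chain_class_trans yx xx'.
have phiE x i : near_F x i -> phi x = v i.
  move=> h; rewrite /phi; case: pickP => [j hj|/(_ i)]; last by rewrite h.
  by rewrite (uniqF x j i).
have phi0 x : (forall i, ~~ near_F x i) -> phi x = 0.
  by move=> h; rewrite /phi; case: pickP => // j; rewrite (negPf (h j)).
have phi_const x x' : chain_class r x x' -> phi x = phi x'.
  move=> xx'; rewrite {1}/phi; case: pickP => [i hi|h].
    by rewrite (phiE x' i)//; exact: near_const xx' hi.
  rewrite phi0// => i; apply/negP => hi; have := h i.
  by rewrite (near_const x' x i)//; exact: chain_class_sym.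
have hS x : normc (phi x) <= S.
  by rewrite /phi; case: pickP => [i _|_]; [exact: hv|rewrite normc0].
exists (2 * S / r `^ a), phi; split.
- by rewrite divr_ge0 ?powR_ge0// mulr_ge0.
- split=> // x y; have [xy|nxy] := eqVneq (class_rep r x) (class_rep r y).
    rewrite (phi_const x y) ?subrr ?normc0; last by apply/class_repE.
    by rewrite mulr_ge0 ?powR_ge0// divr_ge0 ?powR_ge0// mulr_ge0.
  have rxy := class_rep_far nxy.
  apply: (@le_trans _ _ (2 * S)).
    apply: le_trans (le_normcD _ _) _; rewrite normcN.
    have := hS x; have := hS y; lra.
  rewrite -mulrA ler_peMr ?mulr_ge0// mulrC ler_pdivlMr ?powR_gt0// mul1r.
  by apply: ge0_ler_powR; rewrite ?nnegrE ?(ltW a0) ?(ltW r0) ?cantor_dist_ge0.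
- by move=> i x Fx; apply: phiE; apply/asboolP; exists x.
Unshelve. all: by end_near. Qed.

End Separation.

Section PeripheralSpectrum.
Context {R : realType} {K : cantorSet R} (s : cantor_ifs K).
Local Notation dist := (@cantor_dist R K).
Local Notation I := (ifs_idx s).
Local Notation q := (@ifs_wt R K s).
Local Notation g := (@ifs_map R K s).
Local Notation ctransfer := (ctransfer s).
Implicit Types (x y : K) (Y Z : set K) (phi psi : K -> R[i]) (z : R[i]).

Definition word_invariant k Y : Prop :=
  forall w : seq I, size w = k -> forall x, Y x -> Y (word_map w x).

Lemma word_map_cat (w1 w2 : seq I) x : word_map (w1 ++ w2) x = word_map w2 (word_map w1 x).
Proof. by elim: w1 x => //= j w1 IH x. Qed.

Lemma word_invariant_mul k n Y : word_invariant k Y -> word_invariant (n * k) Y.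
Proof.
move=> hY; elim: n => [|n IH] w wn x Yx; first by move/size0nil: wn => ->.
rewrite -(cat_take_drop k w) word_map_cat.
have kw : (k <= size w)%N by rewrite wn mulSn leq_addr.
apply: IH; first by rewrite size_drop wn mulSn addKn.
by apply: hY => //; rewrite size_take_min; apply/minn_idPl.
Qed.

Lemma word_invariant1 Y : (forall j x, Y x -> Y (g j x)) -> forall k, word_invariant k Y.
Proof. by move=> hY k w _; elim: w => //= j w IH x Yx; apply: IH; exact: hY. Qed.

Lemma iter_transfer_invariant k Y F c : word_invariant k Y -> (forall y, Y y -> F y = c) ->
  forall x, Y x -> iter k (transfer s) F x = c.
Proof.
move=> hY Fc x Yx; rewrite iter_transferE -[RHS](word_mean_cst s k).
by apply: word_mean_eq => w wk; apply: Fc; exact: hY.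
Qed.

Lemma iter_ctransfer_invariant k Y phi z : word_invariant k Y -> (forall y, Y y -> phi y = z) ->
  forall x, Y x -> iter k ctransfer phi x = z.
Proof.
move=> hY phiz x Yx; rewrite iter_ctransfer_ReIm.
rewrite (@iter_transfer_invariant k Y _ (complex.Re z))// => [|y /phiz ->//].
rewrite (@iter_transfer_invariant k Y _ (complex.Im z))// => [|y /phiz ->//].
by case: z {phiz}.
Qed.

(** Walks started in [Y] or in [Z] stay there; the union of the small classes meeting [Y] separates
    their Krylov limits. *)
Lemma disjoint_invariant_means Y Z : closed Y -> Y !=set0 -> closed Z -> Z !=set0 -> Y `&` Z = set0 ->
  (forall j x, Y x -> Y (g j x)) -> (forall j x, Z x -> Z (g j x)) ->
  exists m1 m2 (r : R) (A : set K), [/\ stationary_mean s m1 /\ stationary_mean s m2, 0 < r,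
    saturated r A, m1 (\1_A) = 1 & m2 (\1_A) = 0].
Proof.
move=> cY [x1 Yx1] cZ [x2 Zx2] YZ iY iZ.
have [d [d0 hd]] : exists d : R, 0 < d /\ forall y y', Y y -> Z y' -> d <= dist y y'.
  near (0 : R)^'+ => d; exists d; split; first by near: d; exact: nbhs_right_gt.
  near: d; exact: closed_separated.
have [r r0 hr] := chain_class_small K d0.
exists (krylov s (fun=> x1)), (krylov s (fun=> x2)), r.
pose A : set K := [set x | exists2 y, Y y & chain_class r y x]; exists A.
have kry x W c : W x -> (forall j x, W x -> W (g j x)) -> (forall y, W y -> (\1_A y : R) = c) ->
    krylov s (fun=> x) (\1_A) = c.
  move=> Wx iW Wc; rewrite /krylov (_ : (fun n => _) = fun=> c) ?ulim_cst//.
  apply/funext => n; rewrite /cesaro (eq_bigr (fun=> c)) => [|k _].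
    by rewrite sumr_const card_ord -[c *+ _]mulr_natl mulKf.
  by apply: iter_transfer_invariant Wx => //; exact: word_invariant1.
split=> //.
- by split; exact: krylov_stationary.
- move=> x x' [y Yy yx] xx'; exists y => //.
  by apply: (@chain_class_trans _ _ r x) => //; exact: (@chain_class_saturated _ _ r x x x' (@chain_class_refl _ _ r x) xx').
- apply: kry Yx1 iY _ => y Yy; rewrite indicE mem_set//.
  by exists y.
- apply: kry Zx2 iZ _ => y Zy; rewrite indicE memNset// => -[y' Yy' yy'].
  by have := hd y' y Yy' Zy; rewrite leNgt => /negP; apply; exact: hr.
Unshelve. all: by end_near. Qed.

Lemma max_level_invariant F c : (forall y, F y <= c) -> (forall x, transfer s F x = F x) ->
  forall j x, F x = c -> F (g j x) = c.
Proof.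
move=> Fc LF j x Fx.
have /psumr_eq0P h : \sum_i q i * (c - F (g i x)) = 0.
  rewrite (eq_bigr (fun i => c * q i - q i * F (g i x))) => [|i _]; last by rewrite mulrBr mulrC.
  by have := LF x; rewrite /transfer Fx => LFx; rewrite big_split sumrN -mulr_sumr ifs_wt_sum mulr1 /= LFx subrr.
have cF0 i : true -> 0 <= q i * (c - F (g i x)) by move=> _; rewrite mulr_ge0 ?ifs_wt_ge0// subr_ge0.
have /eqP := h cF0 j erefl.
by rewrite mulf_eq0 gt_eqF ?ifs_wt_gt0//= subr_eq0 => /eqP <-.
Qed.

Lemma normc_sqr z : normc z ^+ 2 = complex.Re z ^+ 2 + complex.Im z ^+ 2.
Proof. by case: z => u v; rewrite /normc /= sqr_sqrtr// addr_ge0 ?sqr_ge0. Qed.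

Lemma normc_unimod z : `|z| = 1 -> normc z = 1.
Proof. by case: z => u v; case. Qed.

Lemma unimod_normc z : normc z = 1 -> `|z| = 1.
Proof. by move=> h; rewrite -[LHS]/((normc z)%:C)%C h. Qed.

(** Strict convexity of the disc. [D j] is [M ^ 2] minus the real scalar product of [z] and [v j];
    it is nonnegative with mean 0, and its vanishing leaves no distance between [v j] and [z]. *)
Lemma extremal_average (v : I -> R[i]) z (M : R) : (forall j, normc (v j) <= M) ->
  \sum_j (q j)%:C%C * v j = z -> normc z = M -> forall j, v j = z.
Proof.
move=> hv hz zM; have M0 : 0 <= M by rewrite -zM normc_ge0.
pose D j : R := M ^+ 2 - (complex.Re z * complex.Re (v j) + complex.Im z * complex.Im (v j)).
have zM2 : complex.Re z ^+ 2 + complex.Im z ^+ 2 = M ^+ 2 by rewrite -zM normc_sqr.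
have vM2 j : complex.Re (v j) ^+ 2 + complex.Im (v j) ^+ 2 <= M ^+ 2.
  by rewrite -normc_sqr ler_pXn2r ?nnegrE ?normc_ge0.
have sqrBE (b c : R) : (b - c) ^+ 2 = b ^+ 2 + c ^+ 2 - 2 * (b * c) by ring.
have D0 j : 0 <= D j.
  have := vM2 j; have := zM2; rewrite /D.
  move: (complex.Re z) (complex.Im z) (complex.Re (v j)) (complex.Im (v j)) (M ^+ 2) => b c b' c' M2; clear - sqrBE => h1 h2.
  have := sqr_ge0 (b - b'); have := sqr_ge0 (c - c'); rewrite !sqrBE; lra.
have hsum : \sum_j q j * D j = 0.
  have : \sum_j q j * complex.Re (v j) = complex.Re z /\ \sum_j q j * complex.Im (v j) = complex.Im z.
    rewrite -hz; rewrite (eq_bigr (fun j => Complex (q j * complex.Re (v j)) (q j * complex.Im (v j)))).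
      by rewrite -complex_sum.
    by move=> j _; rewrite complex_scale; case: (v j).
  move=> [hR hI]; rewrite /D (eq_bigr (fun j => M ^+ 2 * q j - (complex.Re z * (q j * complex.Re (v j)) +
     complex.Im z * (q j * complex.Im (v j))))) => [|j _]; last by ring.
  by rewrite big_split sumrN big_split -!mulr_sumr hR hI ifs_wt_sum mulr1 -zM2 /=; ring.
move=> j; have /psumr_eq0P h := hsum.
have /eqP := h (fun i _ => mulr_ge0 (ifs_wt_ge0 i) (D0 i)) j erefl.
rewrite mulf_eq0 gt_eqF ?ifs_wt_gt0//= => /eqP Dj.
have := vM2 j; move: Dj zM2; rewrite /D; case: (v j) => b c; case: (z) => b' c' /= h1 h2 h3.
have h4 : (b - b') ^+ 2 + (c - c') ^+ 2 <= 0.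
  move: h1 h2 h3; move: (M ^+ 2) => M2; clear - sqrBE => h1 h2 h3; rewrite !sqrBE; lra.
have : (b - b') ^+ 2 + (c - c') ^+ 2 == 0 by rewrite eq_le h4 addr_ge0 ?sqr_ge0.
rewrite paddr_eq0 ?sqr_ge0// !sqrf_eq0 !subr_eq0 => /andP[/eqP -> /eqP ->].
by [].
Qed.

Section Contracting.
Context (a : R) (N : nat) (rho eta : R).
Hypotheses (a0 : 0 < a) (rho0 : 0 <= rho < 1) (eta0 : 0 < eta).
Hypothesis contr : forall x y, dist x y < eta ->
  word_mean N (fun w : seq I => dist (word_map w x) (word_map w y) `^ a) <= rho * dist x y `^ a.

Lemma holder_unif_cont S H phi (p : R[i] -> R) : 0 <= H -> holder_bound a S H phi ->
  (forall z z', `|p z - p z'| <= normc (z - z')) -> unif_cont (fun x => p (phi x)).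
Proof.
move=> H0 [_ hH] hp e e0.
pose d := (e / (H + 1)) `^ a^-1.
have H1 : 0 < H + 1 by lra.
exists d; first by rewrite powR_gt0// divr_gt0.
move=> x y xy; apply: le_lt_trans (hp _ _) _; apply: le_lt_trans (hH x y) _.
apply: (@le_lt_trans _ _ ((H + 1) * dist x y `^ a)); first by rewrite ler_wpM2r ?powR_ge0// lerDl.
rewrite mulrC -ltr_pdivlMr//.
apply: (@lt_le_trans _ _ (d `^ a)).
  by apply: gt0_ltr_powR; rewrite ?nnegrE ?cantor_dist_ge0 ?powR_ge0.
by rewrite -powRrM mulVf ?gt_eqF// powRr1// divr_ge0 ?ltW.
Qed.

Lemma Re_contract z z' : `|complex.Re z - complex.Re z'| <= normc (z - z').
Proof. by have := Re_le_normc (z - z'); case: z z' => ? ? [? ?]. Qed.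

Lemma Im_contract z z' : `|complex.Im z - complex.Im z'| <= normc (z - z').
Proof. by have := Im_le_normc (z - z'); case: z z' => ? ? [? ?]. Qed.

Lemma normc_contract z z' : `|normc z - normc z'| <= normc (z - z').
Proof.
rewrite ler_distl; apply/andP; split.
  have := le_normcD (z' - z) z; rewrite subrK -opprB normcN; lra.
have := le_normcD (z - z') z'; rewrite subrK; lra.
Qed.

Lemma closed_level S H phi z : 0 <= H -> holder_bound a S H phi -> closed [set x | phi x = z].
Proof.
move=> H0 hb.
rewrite (_ : [set x | _] = [set x | complex.Re (phi x) = complex.Re z] `&`
   [set x | complex.Im (phi x) = complex.Im z]).
  apply: closedI; apply: unif_cont_level_closed; apply: holder_unif_cont hb _ => //.
    exact: Re_contract.
  exact: Im_contract.
apply/seteqP; split=> x /= [].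
  by move=> ->.
by case: (phi x) (z) => ? ? [? ?] /= -> ->.
Qed.

(** The real or the imaginary part is nonconstant and again fixed; its sets of maxima and of minima
    are invariant. *)
Lemma fixed_invariant_sets S H phi x0 y0 : 0 <= H -> holder_bound a S H phi ->
  (forall x, ctransfer phi x = phi x) -> phi x0 <> phi y0 ->
  exists Y Z, [/\ closed Y /\ Y !=set0, closed Z /\ Z !=set0, Y `&` Z = set0,
    (forall j x, Y x -> Y (g j x)) & (forall j x, Z x -> Z (g j x))].
Proof.
move=> H0 hb Lphi nc.
have aux (p : R[i] -> R) : (forall z z', `|p z - p z'| <= normc (z - z')) ->
   (forall x, transfer s (fun y => p (phi y)) x = p (phi x)) -> p (phi x0) <> p (phi y0) ->
  exists Y Z, [/\ closed Y /\ Y !=set0, closed Z /\ Z !=set0, Y `&` Z = set0,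
    (forall j x, Y x -> Y (g j x)) & (forall j x, Z x -> Z (g j x))].
  move=> hp Lp np; have uf := holder_unif_cont H0 hb hp.
  have ufN : unif_cont (fun x => - p (phi x)).
    by move=> e /uf[d d0 h]; exists d => // x y /h; rewrite -opprD normrN.
  have [x1 h1] := unif_cont_max uf; have [x2 h2] := unif_cont_max ufN.
  exists [set x | p (phi x) = p (phi x1)], [set x | p (phi x) = p (phi x2)]; split.
  - by split; [exact: unif_cont_level_closed|exists x1].
  - by split; [exact: unif_cont_level_closed|exists x2].
  - apply/seteqP; split=> // x [/= e1 e2]; apply: np.
    have := h1 x0; have := h1 y0; have := h2 x0; have := h2 y0; rewrite -e1 -e2; lra.
  - by move=> j x /=; apply: (@max_level_invariant (fun y => p (phi y))).
  - move=> j x /= e; apply: oppr_inj.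
    apply: (@max_level_invariant (fun y => - p (phi y)) (- p (phi x2)) h2); last by rewrite e.
    move=> y; rewrite (_ : (fun _ => _) = (fun t => (-1) * p (phi t))); last by apply/funext => t; rewrite mulN1r.
    by rewrite transferZ Lp mulN1r.
have [eR|nR] := eqVneq (complex.Re (phi x0)) (complex.Re (phi y0)).
  apply: (aux (@complex.Im R)); first exact: Im_contract.
    by move=> x; rewrite -[in RHS]Lphi.
  by move=> eI; apply: nc; move: eR eI; case: (phi x0) (phi y0) => ? ? [? ?] /= -> ->.
apply: (aux (@complex.Re R)); first exact: Re_contract.
  by move=> x; rewrite -[in RHS]Lphi.
exact/eqP.
Qed.

Lemma contracting_word x y : x != y -> dist x y < eta -> exists2 w : seq I, size w = N &
  dist (word_map w x) (word_map w y) `^ a <= (1 + rho) / 2 * dist x y `^ a.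
Proof.
move=> nxy xy; have /andP[r0 r1] := rho0.
apply: contrapT => h.
have D0 : 0 < dist x y `^ a by rewrite powR_gt0// dist_gt0.
have : (1 + rho) / 2 * dist x y `^ a <= rho * dist x y `^ a.
  apply: le_trans (contr xy); rewrite -(word_mean_cst s N ((1 + rho) / 2 * dist x y `^ a)).
  apply: word_mean_le => w wN; rewrite leNgt; apply/negP => hw; apply: h; exists w => //; exact: ltW.
rewrite ler_pM2r//; lra.
Qed.

Lemma normcX z k : normc (z ^+ k) = normc z ^+ k.
Proof. by elim: k => [|k IH]; rewrite ?expr0 ?normc1// !exprS normcM IH. Qed.

Lemma normc1_neq0 z : normc z = 1 -> z != 0.
Proof. by move=> z1; apply/eqP => e; move: z1; rewrite e normc0 => /esym/eqP; rewrite oner_eq0. Qed.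

(** Take a root of [1 + X + ... + X^(n-1)]: it is a root of unity, and 1 is not one of its roots. *)
Lemma exists_unity_root n : (2 <= n)%N -> exists z : R[i], [/\ z ^+ n = 1, z != 1 & normc z = 1].
Proof.
move=> n2.
have sp : size (\poly_(i < n) (1 : R[i])) = n by apply: size_poly_eq; rewrite oner_eq0.
have [z rz] : exists z, root (\poly_(i < n) (1 : R[i])) z.
  by apply/closed_rootP; rewrite sp; case: n n2 {sp} => [|[|n]].
have hz : \sum_(i < n) z ^+ i = 0.
  by move: rz; rewrite /root horner_poly => /eqP; under eq_bigr do rewrite mul1r.
have zn : z ^+ n = 1 by apply/eqP; rewrite -subr_eq0 subrX1 hz mulr0.
exists z; split=> //.
  apply/eqP => e; move: hz; rewrite e; under eq_bigr do rewrite expr1n.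
  by rewrite sumr_const card_ord => /eqP; rewrite pnatr_eq0; case: n n2 {rz sp zn}.
have /eqP : normc z ^+ n = 1 by rewrite -normcX zn normc1.
rewrite pexprn_eq1 ?normc_ge0// => /orP[/eqP n0|/eqP//].
by rewrite n0 in n2.
Qed.

Lemma unity_modX (z : R[i]) n k : z ^+ n = 1 -> z ^+ (k %% n)%N = z ^+ k.
Proof. by move=> zn; rewrite {2}(divn_eq k n) exprD mulnC exprM zn expr1n mul1r. Qed.

Lemma ifs_idx_inh : exists j : I, true.
Proof.
case: (pickP (fun _ : I => true)) => [j _|h]; first by exists j.
have := ifs_wt_sum s; rewrite big_pred0 => [/eqP|j]; last exact: (h j).
by rewrite eq_sym oner_eq0.
Qed.

Lemma eigenfunction_cycle (S H : R) phi z x0 : 0 <= H -> holder_bound a S H phi -> normc z = 1 -> z != 1 ->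
  (forall x, ctransfer phi x = z * phi x) -> phi x0 != 0 ->
  exists n (F : 'I_n -> set K), [/\ (2 <= n)%N, (forall i, closed (F i) /\ F i !=set0),
    (forall i j, i != j -> F i `&` F j = set0) & forall i j x, F i x -> F (ordS i) (g j x)].
Proof.
move=> H0 hb z1 nz1 Lphi phi0; have /andP[r0 r1] := rho0.
have uf := holder_unif_cont H0 hb normc_contract.
have [x1 hx1] := unif_cont_max uf.
set M := normc (phi x1) in hx1.
have M0 : 0 < M.
  apply: lt_le_trans (hx1 x0); rewrite lt_neqAle normc_ge0 andbT eq_sym.
  by apply: contra phi0 => /eqP/eq0_normc ->.
have step x j : normc (phi x) = M -> phi (g j x) = z * phi x.
  move=> Mx; apply: (@extremal_average (fun i => phi (g i x)) _ M) => //.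
    by rewrite -ctransferE.
  by rewrite normcM z1 mul1r.
have stepM x j : normc (phi x) = M -> normc (phi (g j x)) = M.
  by move=> Mx; rewrite step// normcM z1 mul1r.
have wstep x (w : seq I) : normc (phi x) = M -> phi (word_map w x) = z ^+ size w * phi x /\
    normc (phi (word_map w x)) = M.
  elim: w x => [|j w IH] x Mx /=; first by rewrite expr0 mul1r.
  by have [-> ->] := IH _ (stepM x j Mx); rewrite step// exprSr mulrA.
have zn k : normc (z ^+ k) = 1 by rewrite normcX z1 expr1n.
(* A contracting word multiplies both values by the same unimodular number: it keeps the modulus of
   their difference while bringing the points together, so the Holder bound sends that difference to
   0. *)
have loc x y : normc (phi x) = M -> normc (phi y) = M -> dist x y < eta -> phi x = phi y.
  pose rho' := (1 + rho) / 2.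
  have rho'0 : 0 <= rho' < 1 by rewrite /rho'; apply/andP; split; lra.
  have /andP[p0 p1] := rho'0.
  have key k x' y' : normc (phi x') = M -> normc (phi y') = M -> dist x' y' < eta ->
      normc (phi x' - phi y') <= rho' ^+ k * (H * dist x' y' `^ a).
    elim: k x' y' => [|k IH] x' y' Mx My xy.
      by rewrite expr0 mul1r; apply: hb.2.
    have [->|nxy] := eqVneq x' y'.
      by rewrite subrr normc0 mulr_ge0 ?exprn_ge0// mulr_ge0 ?powR_ge0.
    have [w wN hw] := contracting_word nxy xy.
    have [ex ex'] := wstep x' w Mx; have [ey ey'] := wstep y' w My.
    have wxy : dist (word_map w x') (word_map w y') < eta.
      apply: le_lt_trans xy; rewrite leNgt; apply/negP => h.
      have D0 : 0 < dist x' y' `^ a by rewrite powR_gt0// dist_gt0.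
      have : dist x' y' `^ a < dist (word_map w x') (word_map w y') `^ a.
        by apply: gt0_ltr_powR; rewrite ?nnegrE ?cantor_dist_ge0.
      rewrite ltNge => /negP; apply; apply: le_trans hw _.
      by rewrite -[leRHS]mul1r ler_pM2r// ltW.
    have -> : normc (phi x' - phi y') = normc (phi (word_map w x') - phi (word_map w y')).
      by rewrite ex ey -mulrBr normcM zn mul1r.
    apply: le_trans (IH _ _ ex' ey' wxy) _.
    rewrite exprSr -mulrA ler_wpM2l ?exprn_ge0// mulrCA ler_wpM2l//.
  move=> Mx My xy; apply/eqP; rewrite -subr_eq0; apply/eqP/eq0_normc.
  apply/eqP; rewrite eq_le normc_ge0 andbT.
  have c0 : rho' ^+ k * (H * dist x y `^ a) @[k --> \oo] --> (0 : R).
    by rewrite -[X in _ --> X](mul0r (H * dist x y `^ a)); apply: cvgMl; apply: cvg_expr; rewrite ger0_norm.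
  apply: ler_cvg_to (cvg_cst (normc (phi x - phi y))) c0 _.
  by apply: nearW => k; exact: key.
have [j0 _] := ifs_idx_inh.
(* Pigeonhole along one orbit: two times in the same small class give equal values of [phi], hence a
   power of [z] equal to 1. *)
pose X k := word_map (nseq k j0) x1.
have XE k : phi (X k) = z ^+ k * phi x1 /\ normc (phi (X k)) = M.
  by have := wstep x1 (nseq k j0) erefl; rewrite size_nseq.
have [r rp hr] := chain_class_small K eta0.
have [t [_ ht _ _]] := finite_class_reps K rp.
have [i [k [ik /eqP]]] : exists i k, (i < k)%N /\ class_rep r (X i) == class_rep r (X k).
  apply: contrapT => h.
  have inj : {in iota 0 (size t).+1 &, injective (fun i => class_rep r (X i))}.
    move=> i k _ _ /eqP e; apply/eqP; have [ik|ki|//] := ltngtP i k; exfalso; apply: h.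
      by exists i, k.
    by exists k, i; rewrite ki eq_sym.
  have := @uniq_leq_size _ _ t (eq_ind_r is_true (iota_uniq 0 (size t).+1) (map_inj_in_uniq inj)).
  rewrite size_map size_iota => h'.
  suff : ((size t).+1 <= size t)%N by rewrite ltnn.
  by apply: h' => c /mapP[i _ ->].
move=> /class_repE Xik.
have zik : z ^+ (k - i) = 1.
  have : z ^+ i * phi x1 = z ^+ k * phi x1.
    rewrite -(proj1 (XE i)) -(proj1 (XE k)); apply: loc; try exact: (proj2 (XE _)).
    exact: hr.
  have -> : z ^+ k = z ^+ (k - i) * z ^+ i by rewrite -exprD subnK// ltnW.
  move=> /eqP; rewrite -subr_eq0.
  have phix1 : phi x1 != 0 by apply/eqP => e; move: M0; rewrite /M e normc0 ltxx.
  have zi0 : z ^+ i != 0 by apply/eqP => e; have := zn i; rewrite e normc0 => /eqP; rewrite eq_sym oner_eq0.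
  rewrite -mulrA -[X in X - _]mul1r -mulrBl mulf_eq0 mulf_eq0 (negPf zi0) (negPf phix1) !orbF subr_eq0.
  by move=> /eqP <-.
have [n prn _] := @prim_order_exists _ (k - i) z ltac:(by rewrite subn_gt0) zik.
have n0 : (0 < n)%N := prim_order_gt0 prn.
have n2 : (2 <= n)%N.
  case: n prn n0 => [|[|n]] // prn _.
  by have := prim_expr_order prn; rewrite expr1 => e; move: nz1; rewrite e eqxx.
have phix1 : phi x1 != 0 by apply/eqP => e; move: M0; rewrite /M e normc0 ltxx.
(* Since [n] is the exact order of [z], the levels are distinct and the sets disjoint. *)
exists n, (fun i : 'I_n => [set x | phi x = z ^+ i * phi x1]); split=> //.
- move=> l; split; first exact: closed_level H0 hb.
  by exists (X l); exact: (proj1 (XE l)).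
- move=> l l' ll'; apply/seteqP; split=> // x [/= -> /eqP].
  rewrite (inj_eq (mulIf phix1)) (eq_prim_root_expr prn) !modn_small// => /eqP/val_inj e.
  by rewrite e eqxx in ll'.
- move=> l j x /= e; rewrite step; last by rewrite e normcM zn mul1r.
  by rewrite e mulrA -exprS (prim_expr_mod prn).
Qed.

Context (C : R).
Hypothesis hC : forall k S H phi, 0 <= H -> holder_bound a S H phi ->
  holder_bound a S (C * (S + H)) (iter k ctransfer phi).

(** Start from a function equal to [z ^ i] on [F i], with [z] an n-th root of unity. On these sets
    its orbit twisted by [z^-1] is constant, so averaging keeps a nonzero value. *)
Lemma cycle_eigenfunction n (F : 'I_n -> set K) : (2 <= n)%N ->
  (forall i, closed (F i) /\ F i !=set0) -> (forall i j, i != j -> F i `&` F j = set0) ->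
  (forall i j x, F i x -> F (ordS i) (g j x)) ->
  exists S H phi z x0, [/\ holder_bound a S H phi, normc z = 1, z != 1,
    (forall x, ctransfer phi x = z * phi x) & phi x0 != 0].
Proof.
move=> n2 cF dF hF.
have [z [zn z1 nz]] := exists_unity_root n2.
have nzk k : normc (z ^+ k) = 1 by rewrite normcX nz expr1n.
have z0 := normc1_neq0 nz.
have [H [phi [H0 hb phiF]]] := @separating_function R K a 'I_n F (fun i => z ^+ i) 1 a0 ler01
  (fun i => eq_ind_r (fun t => is_true (t <= 1)) (lexx 1) (nzk i)) (fun i => (cF i).1) dF.
have zV : normc z^-1 = 1 by rewrite normcV nz invr1.
have [psi [hpsi psiE psiF _]] := twisted_average hC 1 zV H0 hb.
have zmod k : z ^+ (k %% n)%N = z ^+ k := unity_modX k zn.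
have iterF k i x : F i x -> iter k ctransfer phi x = z ^+ (i + k)%N.
  elim: k i x => [|k IH] i x Fx; first by rewrite addn0; exact: phiF.
  rewrite iterS ctransferE (eq_bigr (fun j => (q j)%:C%C * z ^+ (i + k.+1)%N)) => [|j _].
    rewrite -mulr_suml -[X in X * _]/(\sum_i _) -rmorph_sum ifs_wt_sum rmorph1 mul1r //.
  congr (_ * _); rewrite (IH (ordS i) _ (hF i j x Fx)) exprD /= zmod -exprD.
  by rewrite addnS addSn.
have [i0 _] : exists i : 'I_n, true by exists (Ordinal (ltnW n2)).
have [x0 Fx0] := (cF i0).2.
exists 1, (C * (1 + H)), psi, z, x0; split=> //.
- by move=> x; rewrite -(psiE x) mulrA mulfV// mul1r.
- rewrite (psiF x0 (z ^+ i0)); last first.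
    move=> k; rewrite muln1 (iterF k i0)// addnC exprD exprVn mulrA mulVf ?mul1r//.
    by rewrite expf_neq0.
  by rewrite expf_neq0.
Qed.

Lemma invariant_sets_fixed k Y Z : closed Y -> closed Z -> Y `&` Z = set0 ->
  word_invariant k Y -> word_invariant k Z ->
  exists S H psi, [/\ holder_bound a S H psi, (forall x, iter k ctransfer psi x = psi x),
    (forall x, Y x -> psi x = 1) & (forall x, Z x -> psi x = 0)].
Proof.
move=> cY cZ YZ iY iZ.
have [|||H [phi [H0 hb phiF]]] := @separating_function R K a bool (fun b => if b then Y else Z)
  (fun b => if b then 1 else 0) 1 a0 ler01.
- by case; rewrite ?normc1 ?normc0.
- by case.
- by case=> -[] // _; rewrite // setIC.
have [psi [hpsi psiE psiF _]] := twisted_average hC k (normc1 R) H0 hb.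
exists 1, (C * (1 + H)), psi; split=> //.
- by move=> x; rewrite -[RHS]psiE mul1r.
- move=> x Yx; apply: psiF => n; rewrite expr1n mul1r.
  apply: iter_ctransfer_invariant Yx => [|y Yy]; last exact: (phiF true).
  exact: word_invariant_mul.
- move=> x Zx; apply: psiF => n; rewrite expr1n mul1r.
  apply: iter_ctransfer_invariant Zx => [|y Zy]; last exact: (phiF false).
  exact: word_invariant_mul.
Qed.

End Contracting.
End PeripheralSpectrum.

(** * Spectral properties in terms of invariant and cyclic sets *)

Section SpectralCriteria.
Context {R : realType} {K : cantorSet R} (s : cantor_ifs K) (a : R).
Local Notation dist := (@cantor_dist R K).
Local Notation I := (ifs_idx s).
Local Notation q := (@ifs_wt R K s).
Local Notation g := (@ifs_map R K s).
Local Notation ctransfer := (ctransfer s).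
Implicit Types (x y : K) (Y Z : set K) (z c : R[i]) (phi psi : holder K a).

Context (N : nat) (rho eta : R).
Hypotheses (a0 : 0 < a) (rho0 : 0 <= rho < 1) (eta0 : 0 < eta).
Hypothesis contr : forall x y, dist x y < eta ->
  word_mean N (fun w : seq I => dist (word_map w x) (word_map w y) `^ a) <= rho * dist x y `^ a.
Context (L : {linear holder K a -> holder K a}).
Hypothesis LE : forall phi x, L phi x = ctransfer phi x.

Lemma holder_eq phi psi : (forall x, phi x = psi x) -> phi = psi.
Proof. by move=> h; apply/val_inj/funext. Qed.

Lemma holder_of S H (f : K -> R[i]) : holder_bound a S H f -> exists phi : holder K a, forall x, phi x = f x.
Proof. by move=> hb; exists (Holder (holder_boundP hb)). Qed.

Lemma holderZE z phi x : (z *: phi) x = z * phi x. Proof. by []. Qed.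

Lemma holder_one : exists phi : holder K a, forall x, phi x = 1.
Proof.
by apply: (@holder_of 1 0 (fun=> 1)); split=> [x|x y]; rewrite ?normc1// subrr normc0 mul0r.
Qed.

Lemma ctransfer_cst z x : ctransfer (fun=> z) x = z.
Proof. exact: (@iter_ctransfer_invariant _ _ s 1 setT (fun=> z) z). Qed.

Definition fixed_constant : Prop := forall phi, L phi = phi -> exists c, forall x, phi x = c.

Lemma holder_neq0 phi x : phi x != 0 -> phi != 0.
Proof. by apply: contra => /eqP ->. Qed.

Lemma holder_neq0P phi : phi != 0 -> exists x, phi x != 0.
Proof.
move=> phi0; apply: contrapT => h; move: phi0 => /eqP; apply; apply: holder_eq => x.
by apply: contrapT => hx; apply: h; exists x; apply/eqP.
Qed.

(** Each iteration adds [c] while the iterates stay bounded. This excludes Jordan blocks at 1, so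
    algebraic simplicity reduces to constancy of the fixed functions. *)
Lemma fixed_of_cst_defect phi c : (forall x, L phi x = phi x + c) -> L phi = phi.
Proof.
move=> h; suff c0 : c = 0 by apply: holder_eq => x; rewrite h c0 addr0.
have hk k x : iter k L phi x = phi x + c *+ k.
  elim: k x => [|k IH] x; first by rewrite mulr0n addr0.
  rewrite iterS LE (_ : ctransfer _ x = ctransfer (fun y => 1 * phi y + c *+ k) x).
    by rewrite ctransfer_linear ctransfer_cst mul1r -LE h mulrSr -addrA addrCA addrC -!addrA (addrC (c *+ k)).
  by congr (ctransfer _ x); apply/funext => y; rewrite IH mul1r.
have b k : k%:R * normc c <= sup_norm phi + sup_norm phi.
  have := normc_iter_ctransfer s k (sup_norm_ub phi) point.
  have := sup_norm_ub phi point.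
  rewrite -(iter_linE LE) hk => h1 h2.
  have -> : k%:R * normc c = normc (c *+ k).
    by rewrite -[c *+ k]mulr_natl normcM; congr (_ * _); rewrite -(rmorph_nat (real_complex R)) normc_real ger0_norm.
  have -> : c *+ k = (phi point + c *+ k) - phi point by rewrite addrC addKr.
  by apply: le_trans (le_normcD _ _) _; rewrite normcN lerD.
apply: eq0_normc; apply/eqP/negPn/negP => nc0.
have nc : 0 < normc c by rewrite lt_neqAle eq_sym nc0 normc_ge0.
have := b (Num.bound ((sup_norm phi + sup_norm phi) / normc c)).
rewrite -ler_pdivlMr// leNgt => /negP; apply.
by apply: archi_boundP; rewrite divr_ge0 ?normc_ge0 ?addr_ge0 ?sup_norm_ge0.
Qed.

Lemma simple_eigenvalueP : simple_eigenvalue L 1 <-> fixed_constant.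
Proof.
have [one oneE] := holder_one.
have Lone : L one = one.
  by apply: holder_eq => x; rewrite LE oneE -(ctransfer_cst 1 x); congr (ctransfer _ x); apply/funext.
split.
  move=> [v [v0 Lv hv]] phi Lphi.
  have f0 psi : L psi = psi -> exists c, psi = c *: v.
    by move=> Lpsi; apply: (hv 1%N); rewrite /= Lpsi scale1r subrr.
  have [c1 e1] := f0 _ Lone; have [c2 e2] := f0 _ Lphi.
  exists (c2 / c1) => x; rewrite e2 holderZE.
  have e1x : c1 * v x = 1 by rewrite -holderZE -e1 oneE.
  have c10 : c1 != 0 by apply/eqP => e; move: e1x; rewrite e mul0r => /esym/eqP; rewrite oner_eq0.
  by rewrite -[LHS]mul1r -{1}(divff c10) -[RHS]mulr1 -e1x; field.
move=> fc; exists one; split.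
- by apply: (@holder_neq0 _ point); rewrite oneE oner_eq0.
- by rewrite scale1r.
move=> n u hu; suff [c hc] : exists c, forall x, u x = c.
  by exists c; apply: holder_eq => x; rewrite holderZE oneE mulr1.
elim: n u hu => [|n IH] u hu; first by have -> : u = 0 := hu; exists 0.
have [c hc] := IH _ (eq_trans (esym (iterSr n (fun t => L t - 1 *: t) u)) hu).
apply: fc; apply: (@fixed_of_cst_defect _ c) => x.
rewrite -(hc x) -[(L u - 1 *: u) x]/(L u x - 1 * u x) mul1r addrC subrK//.
Qed.

Lemma unimodular_cycle : (exists z, [/\ normc z = 1, z != 1 & eigenvalue_of L z]) <->
  exists n (F : 'I_n -> set K), [/\ (2 <= n)%N, (forall i, closed (F i) /\ F i !=set0),
    (forall i j, i != j -> F i `&` F j = set0) & forall i j x, F i x -> F (ordS i) (g j x)].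
Proof.
have [C C0 hC] := holder_bound_iter a0 rho0 eta0 contr.
split.
  move=> [z [z1 nz1 [phi phi0 Lphi]]]; have [x0 hx0] := holder_neq0P phi0.
  apply: (eigenfunction_cycle a0 rho0 eta0 contr (holder_seminorm_ge0 phi) (holder_boundE phi a0) z1 nz1 _ hx0).
  by move=> x; rewrite -LE Lphi holderZE.
move=> [n [F [n2 cF dF hF]]].
have [S [H [f [z [x0 [hb z1 nz1 Lf f0]]]]]] := cycle_eigenfunction a0 hC n2 cF dF hF.
have [phi phiE] := holder_of hb.
have phiEf : (phi : K -> R[i]) = f by apply/funext.
exists z; split=> //; exists phi; first by apply: (@holder_neq0 _ x0); rewrite phiE.
by apply: holder_eq => x; rewrite LE holderZE phiEf Lf.
Qed.

Lemma unique_unimodularP : unique_unimodular_eigenvalue L 1 <->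
  ~ exists z, [/\ normc z = 1, z != 1 & eigenvalue_of L z].
Proof.
have [one oneE] := holder_one.
have Lone : L one = one.
  by apply: holder_eq => x; rewrite LE oneE -(ctransfer_cst 1 x); congr (ctransfer _ x); apply/funext.
split=> [h [z [z1 nz1 ez]]|h z].
  by move: nz1; rewrite (proj1 (h z)) ?eqxx//; split=> //; exact: unimod_normc.
split=> [[z1 ez]|->].
  apply/eqP/negPn/negP => nz1; apply: h; exists z; split=> //; exact: normc_unimod.
split; first by rewrite normr1.
exists one; last by rewrite Lone scale1r.
by apply: (@holder_neq0 _ point); rewrite oneE oner_eq0.
Qed.

Lemma not_fixed_constant : ~ fixed_constant -> exists Y Z, [/\ closed Y /\ Y !=set0,
  closed Z /\ Z !=set0, Y `&` Z = set0,
  (forall j x, Y x -> Y (g j x)) & (forall j x, Z x -> Z (g j x))].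
Proof.
move=> h; have [phi [Lphi nc]] : exists phi, L phi = phi /\ ~ exists c, forall x, phi x = c.
  apply: contrapT => h'; apply: h => phi Lphi; apply: contrapT => nc; apply: h'.
  by exists phi.
have [x0 hx0] : exists x, phi x <> phi point.
  by apply: contrapT => h'; apply: nc; exists (phi point) => x; apply: contrapT => hx; apply: h'; exists x.
apply: (fixed_invariant_sets a0 (holder_seminorm_ge0 phi) (holder_boundE phi a0) _ hx0).
by move=> x; rewrite -LE Lphi.
Qed.

(** Among the successive partial products applied to [v], the last nonzero one is an eigenvector. *)
Lemma eigenvector_of_product (rs : seq R[i]) (v : holder K a) : v != 0 ->
  foldr (fun r w => L w - r *: w) v rs = 0 -> exists2 r, r \in rs & eigenvalue_of L r.
Proof.
move=> v0; elim: rs => [/= e|r rs IH /= /eqP]; first by rewrite e eqxx in v0.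
rewrite subr_eq0 => /eqP e; set w := foldr _ v rs in e IH.
have [w0|w0] := eqVneq w 0; last by exists r; [rewrite mem_head|exists w].
by have [r' r'rs er'] := IH w0; exists r' => //; rewrite inE r'rs orbT.
Qed.

Definition poly_op n (p : {poly R[i]}) (v : holder K a) : holder K a :=
  \sum_(i < n) p`_i *: iter i L v.

Lemma poly_op_root n (r : R[i]) (p : {poly R[i]}) (v : holder K a) : (size p <= n)%N ->
  poly_op n.+1 (('X - r%:P) * p) v = L (poly_op n p v) - r *: poly_op n p v.
Proof.
move=> pn; rewrite /poly_op linear_sum scaler_sumr.
rewrite (eq_bigr (fun i : 'I_n.+1 => ('X * p)`_i *: iter i L v - (r * p`_i) *: iter i L v)) => [|i _]; last first.
  by rewrite mulrBl coefB coefCM scalerBl.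
rewrite big_split /= sumrN; congr (_ - _).
  rewrite big_ord_recl coefXM /= scale0r add0r; apply: eq_bigr => i _.
  by rewrite coefXM /= linearZ.
rewrite big_ord_recr /= [p`_n]nth_default// mulr0 scale0r addr0.
by apply: eq_bigr => i _; rewrite scalerA.
Qed.

Lemma poly_op_prod (rs : seq R[i]) (v : holder K a) :
  poly_op (size rs).+1 (\prod_(r <- rs) ('X - r%:P)) v = foldr (fun r w => L w - r *: w) v rs.
Proof.
elim: rs => [|r rs IH]; first by rewrite /poly_op big_nil big_ord1 coef1 eqxx scale1r.
by rewrite big_cons poly_op_root ?IH//= size_prod_XsubC.
Qed.

(** Split [1 + X + ... + X^k] into linear factors over the complex numbers; all its roots are roots
    of unity different from 1. *)
Lemma orbit_sum_eigenvalue k (v : holder K a) : v != 0 -> \sum_(i < k.+1) iter i L v = 0 ->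
  exists z, [/\ normc z = 1, z != 1 & eigenvalue_of L z].
Proof.
move=> v0 hv.
pose p : {poly R[i]} := \poly_(i < k.+1) 1.
have sp : size p = k.+1 by apply: size_poly_eq; rewrite oner_eq0.
have [rs hp] := closed_field_poly_normal p.
have lp : lead_coef p = 1 by rewrite lead_coefE sp coef_poly /= ltnSn.
move: hp; rewrite lp scale1r => hp.
have srs : size rs = k by have := sp; rewrite hp size_prod_XsubC => -[].
have [r rrs er] : exists2 r, r \in rs & eigenvalue_of L r.
  apply: eigenvector_of_product v0 _; rewrite -poly_op_prod -hp srs -[RHS]hv.
  by apply: eq_bigr => i _; rewrite coef_poly ltn_ord scale1r.
have rp : root p r by rewrite hp root_prod_XsubC.
have hr : \sum_(i < k.+1) r ^+ i = 0.
  by move: rp; rewrite /root horner_poly => /eqP; under eq_bigr do rewrite mul1r.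
have rk : r ^+ k.+1 = 1 by apply/eqP; rewrite -subr_eq0 subrX1 hr mulr0.
exists r; split=> //.
  have /eqP : normc r ^+ k.+1 = 1 by rewrite -normcX rk normc1.
  by rewrite pexprn_eq1 ?normc_ge0// => /eqP.
apply/eqP => e; move: hr; rewrite e; under eq_bigr do rewrite expr1n.
by rewrite sumr_const card_ord => /eqP; rewrite pnatr_eq0.
Qed.

Lemma spectral_gapP : quasi_compact L -> (spectral_gap L <->
  forall k, (1 <= k)%N -> ~ exists Y Z, [/\ closed Y /\ Y !=set0, closed Z /\ Z !=set0,
    Y `&` Z = set0, word_invariant s k Y & word_invariant s k Z]).
Proof.
move=> qc; have [C C0 hC] := holder_bound_iter a0 rho0 eta0 contr.
split=> [[_ gap] k k0 [Y [Z [[cY [y Yy]] [cZ [x Zx]] YZ iY iZ]]]|h].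
  have [S [H [f [hb Lf fY fZ]]]] := invariant_sets_fixed a0 hC cY cZ YZ iY iZ.
  have [phi phiE] := holder_of hb.
  have phiEf : (phi : K -> R[i]) = f by apply/funext.
  case: k k0 iY iZ Lf => // k _ iY iZ Lf.
  have Lk : iter k.+1 L phi = phi.
    by apply: holder_eq => t; rewrite (iter_linE LE) phiEf Lf.
  (* The orbit sum is fixed, hence constant by the gap. Removing its share [c / (k + 1)] from [phi],
     which takes the values 1 and 0, leaves a nonzero [v] with zero orbit sum, and so an eigenvalue
     other than 1. *)
  pose chi := \sum_(i < k.+1) iter i L phi.
  have Lchi : L chi = chi.
    rewrite /chi linear_sum big_ord_recr [RHS]big_ord_recl /= -[L (iter k L phi)]iterS Lk addrC.
    by congr (_ + _); apply: eq_bigr.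
  have [c hc] : exists c, forall t, chi t = c.
    have [chi0|chi0] := eqVneq chi 0; first by exists 0 => t; rewrite chi0.
    by have [] := gap 1 chi chi0 (normr1 _); rewrite ?scale1r.
  have [one oneE] := holder_one.
  have Lone : L one = one.
    by apply: holder_eq => t; rewrite LE oneE -(ctransfer_cst 1 t); congr (ctransfer _ t); apply/funext.
  pose v := phi - (c / k.+1%:R) *: one.
  have vE t : v t = phi t - c / k.+1%:R.
    by rewrite -[v t]/(phi t - (c / k.+1%:R) * one t) oneE mulr1.
  have v0 : v != 0.
    apply/eqP => e; have := vE y; have := vE x; rewrite e !phiE (fY y Yy) (fZ x Zx).
    rewrite -[_ x]/(0 : R[i]) -[_ y]/(0 : R[i]) sub0r => /esym/eqP; rewrite oppr_eq0 => /eqP ->.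
    by rewrite subr0 => /esym/eqP; rewrite oner_eq0.
  have hv : \sum_(i < k.+1) iter i L v = 0.
    rewrite (eq_bigr (fun i : 'I_k.+1 => iter i L phi - (c / k.+1%:R) *: one)) => [|i _]; last first.
      have iL : iter i L one = one by elim: (i : nat) => //= n ->.
      by rewrite /v -[X in phi + X]scaleNr iter_linD iter_linZ iL scaleNr.
    rewrite big_split /= sumr_const card_ord; apply: holder_eq => t.
    rewrite -[LHS]/(chi t + _) hc.
    have -> : (- ((c / k.+1%:R) *: one) *+ k.+1) = (- c) *: one.
      by rewrite mulNrn scalerMnl -[(c / _) *+ _]mulr_natr divfK ?pnatr_eq0// scaleNr.
    by transitivity (c + (- c) * one t); rewrite // oneE mulr1 subrr.
  have [z [z1 nz1 [w w0 Lw]]] := orbit_sum_eigenvalue v0 hv.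
  have [e _] := gap z w w0 (unimod_normc z1) Lw.
  by rewrite e eqxx in nz1.
split=> // z phi phi0 z1 Lphi.
have ez : z = 1.
  apply/eqP/negPn/negP => nz1.
  have [n [F [n2 cF dF hF]]] := proj1 unimodular_cycle
    (ex_intro _ z (And3 (normc_unimod z1) nz1 (ex_intro2 _ _ phi phi0 Lphi))).
  apply: (h n (ltnW n2)); case: n n2 F cF dF hF => [|[|n]]// _ F cF dF hF.
  have iter_ordS (w : seq I) (i : 'I_n.+2) x : F i x -> F (iter (size w) (@ordS n.+2) i) (word_map w x).
    by elim: w i x => //= j w IH i x Fx; rewrite -iterS iterSr; apply: IH; exact: hF.
  have ordS_cycle (i : 'I_n.+2) : iter n.+2 (@ordS n.+2) i = i.
    have e k : (iter k (@ordS n.+2) i : nat) = ((i + k) %% n.+2)%N.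
      elim: k => [|k IH]; first by rewrite addn0 modn_small.
      by rewrite iterS /= IH -[((i + k) %% n.+2).+1]addn1 modnDml addn1 addnS.
    by apply/val_inj; rewrite /= -[LHS]/((iter n.+2 (@ordS n.+2) i : nat)) e modnDr modn_small.
  (* A full turn of the cycle brings each of its sets back into itself. *)
  exists (F ord0), (F ord_max); split=> //; first exact: dF.
    by move=> w wn x Fx; have := iter_ordS w _ _ Fx; rewrite wn ordS_cycle.
  by move=> w wn x Fx; have := iter_ordS w _ _ Fx; rewrite wn ordS_cycle.
split=> //; apply: contrapT => nc.
have [] : ~ fixed_constant -> False.
  move=> /not_fixed_constant[Y [Z [cY cZ YZ iY iZ]]]; apply: (h 1%N) => //.
  by exists Y, Z; split=> //; exact: word_invariant1.
by move=> fc; apply: nc; apply: fc; rewrite Lphi ez scale1r.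
Qed.

End SpectralCriteria.

Section UniformAverages.
Context {R : realType} {K : cantorSet R} (s : cantor_ifs K).
Local Notation dist := (@cantor_dist R K).
Local Notation I := (ifs_idx s).
Local Notation q := (@ifs_wt R K s).
Local Notation g := (@ifs_map R K s).
Implicit Types (x y : K) (F G : K -> R) (A : set K).

Lemma unif_cont_cst (c : R) : unif_cont (fun _ : K => c).
Proof. by move=> e e0; exists 1 => // x y _; rewrite subrr normr0. Qed.

Lemma unif_contD F G : unif_cont F -> unif_cont G -> unif_cont (fun x => F x + G x).
Proof.
move=> uF uG e e0; have e2 : 0 < e / 2 by rewrite divr_gt0.
have [d d0 hd] := uF _ e2; have [d' d'0 hd'] := uG _ e2.
exists (Num.min d d'); first by rewrite lt_min d0.
move=> x y; rewrite lt_min => /andP[/hd h /hd' h'].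
have -> : F x + G x - (F y + G y) = (F x - F y) + (G x - G y) by ring.
by apply: le_lt_trans (ler_normD _ _) _; lra.
Qed.

Lemma unif_contZ (c : R) F : unif_cont F -> unif_cont (fun x => c * F x).
Proof.
move=> uF e e0; have c0 : 0 < `|c| + 1 by rewrite ltr_wpDl.
have [d d0 hd] := uF (e / (`|c| + 1)) (divr_gt0 e0 c0).
exists d => // x y /hd h; rewrite -mulrBr normrM.
apply: (@le_lt_trans _ _ ((`|c| + 1) * `|F x - F y|)); first by rewrite ler_wpM2r// lerDl.
by rewrite mulrC -ltr_pdivlMr.
Qed.

Lemma unif_cont_sum (J : Type) (t : seq J) (F : J -> K -> R) : (forall j, unif_cont (F j)) ->
  unif_cont (fun x => \sum_(j <- t) F j x).
Proof.
move=> uF; elim: t => [|j t IH].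
  rewrite (_ : (fun x => _) = fun=> 0); first exact: unif_cont_cst.
  by apply/funext => x; rewrite big_nil.
rewrite (_ : (fun x => _) = fun x => F j x + \sum_(j <- t) F j x); first exact: unif_contD.
by apply/funext => x; rewrite big_cons.
Qed.

Lemma unif_cont_map j F : unif_cont F -> unif_cont (fun x => F (g j x)).
Proof.
move=> uF e /uF[d d0 hd]; have [M M1 hM] := ifs_lip s; have M0 : 0 < M by lra.
exists (d / M); first by rewrite divr_gt0.
move=> x y xy; apply: hd; apply: le_lt_trans (hM _ _ _) _.
by rewrite mulrC -ltr_pdivlMr.
Qed.

Lemma unif_cont_transfer F : unif_cont F -> unif_cont (transfer s F).
Proof.
by move=> uF; apply: unif_cont_sum => j; apply: unif_contZ; exact: unif_cont_map.
Qed.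

Lemma unif_cont_iter_transfer k F : unif_cont F -> unif_cont (iter k (transfer s) F).
Proof. by move=> uF; elim: k => //= k IH; exact: unif_cont_transfer. Qed.

Lemma unif_cont_dlog j : unif_cont (@ifs_dlog R K s j).
Proof.
move=> e e0; have [d d0 hd] := dlog_cont s (divr_gt0 e0 (ltr0n _ 2)).
by exists d => // x y /(hd j); lra.
Qed.

Lemma unif_cont_mean_dlog : unif_cont (mean_dlog s).
Proof. by apply: unif_cont_sum => j; apply: unif_contZ; exact: unif_cont_dlog. Qed.

Lemma unif_cont_indic r A : 0 < r -> saturated r A -> unif_cont (\1_A).
Proof.
move=> r0 sA e e0; exists r => // x y xy; rewrite !indicE.
suff -> : (x \in A) = (y \in A) by rewrite subrr normr0.
by apply/idP/idP; rewrite !inE => h; [exact: (sA x)|apply: (sA y) => //; rewrite distC].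
Qed.

Lemma unif_cont_bounded F : unif_cont F -> bounded_fun F.
Proof.
move=> uF; have [x hx] := unif_cont_max uF.
have [y hy] := unif_cont_max (unif_contZ (-1) uF).
exists (`|F x| + `|F y|) => z; have := hx z; have := hy z; rewrite !mulN1r.
have := ler_norm (F x); have := lerNnormlW (lexx `|F y|).
have := normr_ge0 (F x); have := normr_ge0 (F y).
by rewrite ler_norml; lra.
Qed.

Lemma unif_cont_measurable F : unif_cont F -> measurable_fun [set: borel K] (F : borel K -> R).
Proof.
move=> /unif_cont_continuous cF; apply: (measurability _ (measurable_realfun.RGenOpens.measurableE R)).
move=> _ [U [a [b ->]] <-]; rewrite setTI; apply: sub_gen_smallest.
by apply: open_comp => [x _|]; [exact: cF|exact: interval_open].
Qed.

Lemma ifs_map_saturated j r A : 0 < r -> saturated r A ->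
  exists2 r' : R, 0 < r' & saturated r' (g j @^-1` A).
Proof.
move=> r0 sA; have [M M1 hM] := ifs_lip s; have M0 : 0 < M by lra.
exists (r / M); first by rewrite divr_gt0.
move=> x y /= Ax xy; apply: (sA _ _ Ax); apply: le_lt_trans (hM _ _ _) _.
by rewrite mulrC -ltr_pdivlMr.
Qed.

Lemma ifs_map_measurable j : measurable_fun [set: borel K] (g j : borel K -> borel K).
Proof.
apply: (@measurability _ _ (borel K) (borel K) setT (g j) (@initial_saturated R K)).
  exact: borel_initialE.
move=> _ [A [[r r0 sA] _] <-]; rewrite setTI.
by have [r' r'0 h] := ifs_map_saturated j r0 sA; exact: saturated_measurable h.
Qed.

Section FixedConstant.
Context (a : R) (N : nat) (rho eta : R).
Hypotheses (a0 : 0 < a) (rho0 : 0 <= rho < 1) (eta0 : 0 < eta).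
Hypothesis contr : forall x y, dist x y < eta ->
  word_mean N (fun w : seq I => dist (word_map w x) (word_map w y) `^ a) <= rho * dist x y `^ a.
Context (L : {linear holder K a -> holder K a}).
Hypothesis LE : forall phi x, L phi x = ctransfer s phi x.

(** The averages are equicontinuous and converge along [oo_ultra] at finitely many representatives,
    so one [n] is good everywhere. A single [n] for each [e] is enough: a stationary measure gives a
    function and its averages the same integral. *)
Lemma cesaro_uniform : fixed_constant L -> forall r A, 0 < r -> saturated r A ->
  exists c : R, forall e : R, 0 < e -> exists n, forall x, `|cesaro s n (\1_A) x - c| <= e.
Proof.
move=> fc r A r0 sA; have [C C0 hC] := holder_bound_iter a0 rho0 eta0 contr.
pose f x : R[i] := Complex (\1_A x) 0.
have fb : holder_bound a 1 (1 / r `^ a) f.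
  have fn x : normc (f x) = \1_A x by rewrite /f -[Complex _ _]/((\1_A x : R)%:C)%C normc_real ger0_norm// indicE.
  split=> [x|x y]; first by rewrite fn indicE; case: (_ \in _).
  have [xy|xy] := ltP (dist x y) r.
    suff -> : f x = f y by rewrite subrr normc0 mulr_ge0 ?powR_ge0// divr_ge0 ?powR_ge0.
    rewrite /f !indicE; suff -> : (x \in A) = (y \in A) by [].
    by apply/idP/idP; rewrite !inE => h; [exact: (sA x)|apply: (sA y) => //; rewrite distC].
  apply: (@le_trans _ _ 1); last first.
    rewrite mulrAC mul1r ler_pdivlMr ?powR_gt0// mul1r.
    by apply: ge0_ler_powR; rewrite ?nnegrE ?(ltW a0) ?(ltW r0) ?cantor_dist_ge0.
  have -> : f x - f y = ((\1_A x - \1_A y : R)%:C)%C.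
    by apply/eqP; rewrite eq_complex /= subr0 !eqxx.
  rewrite normc_real !indicE.
  by case: (_ \in _); case: (_ \in _); rewrite ?subrr ?subr0 ?sub0r ?normrN ?normr1 ?normr0.
have H0 : 0 <= 1 / r `^ a by rewrite divr_ge0 ?powR_ge0.
have [psi [hpsi psiE _ psiF]] := twisted_average hC 1 (normc1 R) H0 fb.
have [phi phiE] := holder_of hpsi.
have phiEf : (phi : K -> R[i]) = psi by apply/funext.
have [c hc] : exists c, forall x, phi x = c.
  by apply: fc; apply: holder_eq => x; rewrite LE phiEf -[in RHS]psiE mul1r.
exists (complex.Re c) => e e0.
have ul x : ulim (fun n => cesaro s n (\1_A) x) = complex.Re c.
  by rewrite -(hc x) phiE (psiF erefl erefl x).
set H := C * (1 + 1 / r `^ a) in hpsi.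
have Hg : 0 <= H by rewrite mulr_ge0// addr_ge0.
have equi n x y : `|cesaro s n (\1_A) x - cesaro s n (\1_A) y| <= H * dist x y `^ a.
  rewrite /cesaro -mulrBr -sumrB normrM ger0_norm ?invr_ge0//.
  rewrite ler_pdivrMl ?ltr0n//; apply: le_trans (ler_norm_sum _ _ _) _.
  rewrite mulr_natl -[in leRHS](card_ord n.+1) -sumr_const; apply: ler_sum => k _.
  have := (hC k _ _ _ H0 fb).2 x y; apply: le_trans; apply: le_trans (Re_le_normc _).
  by rewrite !iter_ctransfer_ReIm /=.
have [d d0 hd] : exists2 d : R, 0 < d & forall x y, dist x y < d -> H * dist x y `^ a < e / 2.
  exists ((e / 2 / (H + 1)) `^ a^-1); first by rewrite powR_gt0// divr_gt0 ?divr_gt0 ?ltr_wpDl.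
  move=> x y xy; have H1 : 0 < H + 1 by lra.
  apply: (@le_lt_trans _ _ ((H + 1) * dist x y `^ a)); first by rewrite ler_wpM2r ?powR_ge0// lerDl.
  rewrite mulrC -ltr_pdivlMr//.
  apply: (@lt_le_trans _ _ (((e / 2 / (H + 1)) `^ a^-1) `^ a)).
    by apply: gt0_ltr_powR; rewrite ?nnegrE ?cantor_dist_ge0 ?powR_ge0.
  by rewrite -powRrM mulVf ?gt_eqF// powRr1// divr_ge0 ?divr_ge0 ?ltW.
have [r' r'0 hr'] := chain_class_small K d0.
have [t [_ ht _ _]] := finite_class_reps K r'0.
have near_t : \forall n \near oo_ultra, forall x, x \in t -> `|cesaro s n (\1_A) x - complex.Re c| < e / 2.
  elim: (t) => [|x t' IH]; first by apply: (@filterS _ oo_ultra _ setT) => //; exact: filterT.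
  have hx : \forall n \near oo_ultra, `|cesaro s n (\1_A) x - complex.Re c| < e / 2.
    have cv := @ulim_cvg R _ (bounded_cesaro s (fun=> x) (bounded_indic A)).
    have e2 : 0 < e / 2 by rewrite divr_gt0.
    have h : \forall n \near oo_ultra, `|ulim (fun n => cesaro s n (\1_A) x) - cesaro s n (\1_A) x| < e / 2.
      by move/cvgrPdist_lt : cv; apply.
    by apply: (@filterS _ oo_ultra _ [set n | `|ulim (fun n => cesaro s n (\1_A) x) - cesaro s n (\1_A) x| < e / 2] _ _ h) => n /=; rewrite ul distrC.
  apply: (@filterS2 _ oo_ultra _ _ _ _ _ hx IH) => n h1 h2 y; rewrite inE => /orP[/eqP ->//|]; exact: h2.
have [n hn] := filter_ex near_t.
exists n => x; have h1 := hn _ (ht x).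
have h2 : dist x (class_rep r' x) < d by apply: hr'; exact: class_repP.
have h3 := equi n x (class_rep r' x); have h4 := hd _ _ h2.
have -> : cesaro s n (\1_A) x - complex.Re c = (cesaro s n (\1_A) x - cesaro s n (\1_A) (class_rep r' x)) +
  (cesaro s n (\1_A) (class_rep r' x) - complex.Re c) by ring.
apply: le_trans (ler_normD _ _) _; lra.
Qed.

End FixedConstant.

(** If the maximal mean of [mean_dlog s] is negative, its uniform upper bound makes some drift
    negative at every point. Otherwise the maximal mean is invariant, and its Borel version
    contradicts the hypothesis. *)
Lemma contracting_drift :
  ~ (exists mu : probability (borel K) R, forall j (A : set (borel K)), measurable A ->
      mu (g j @^-1` A) = mu A) ->
  exists N (kappa : R), 0 < kappa /\ forall x, drift s N x <= - kappa.
Proof.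
move=> ninv; have [m sm hm] := maximal_stationary_mean s.
have mm := stationary_is_mean sm.
have [mu0|mu0] := ltP (m (mean_dlog s)) 0.
  have [|n n0 hn] := hm (- m (mean_dlog s) / 2); first by lra.
  exists n, (n%:R * (- m (mean_dlog s) / 2)); split.
    by rewrite mulr_gt0 ?ltr0n//; lra.
  by move=> x; apply: le_trans (hn x) _; rewrite -mulrN ler_wpM2l//; lra.
exfalso; apply: ninv.
have [mu hmu] := mean_probability mm; exists mu => j A mA.
pose X : {mfun borel K >-> borel K} := HB.pack (g j : borel K -> borel K)
  (isMeasurableFun.Build _ _ _ _ (g j : borel K -> borel K) (ifs_map_measurable j)).
symmetry.
apply: (@borel_measure_unique R K mu (distribution mu X)) => //.
  by apply: le_lt_trans (probability_le1 mu _) _; [exact: measurableT|exact: ltry].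
move=> r B r0 sB; have [r' r'0 sB'] := ifs_map_saturated j r0 sB.
transitivity ((m (\1_B))%:E); first exact: hmu sB.
transitivity ((m (\1_(g j @^-1` B)))%:E); last by symmetry; exact: hmu sB'.
congr EFin; rewrite -(maximal_mean_invariant sm mu0 hm j r'0 sB') /pull; congr m; apply/funext => y.
rewrite !indicE; suff -> : (y \in B) = (ifs_inv j y \in g j @^-1` B) by [].
by apply/idP/idP; rewrite !inE /= ifs_invK.
Qed.

End UniformAverages.

(** * Local dilation of diffeomorphisms *)

Section DiffeoData.
Context {R : realType} {K : cantorSet R}.
Local Notation dist := (@cantor_dist R K).
Implicit Types (x y : K) (g : K -> K).

Definition has_dlog g x (l : R) : Prop := forall e : R, 0 < e -> exists2 d : R, 0 < d &
  forall y, dist x y < d ->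
    expR (l - e) * dist x y <= dist (g x) (g y) <= expR (l + e) * dist x y.

(* Uses that K has no isolated point; it makes log |g'| independent of the local extension
   of g. *)
Lemma has_dlog_unique g x (l l' : R) : has_dlog g x l -> has_dlog g x l' -> l = l'.
Proof.
wlog suff H : l l' / has_dlog g x l -> has_dlog g x l' -> l <= l'.
  by move=> hl hl'; apply/eqP; rewrite eq_le !H.
move=> hl hl'; rewrite leNgt; apply/negP => ll'.
have e0 : 0 < (l - l') / 4 by lra.
have [d d0 hd] := hl _ e0; have [d' d'0 hd'] := hl' _ e0.
have [|y xy] := @cantor_perfect R K x (Num.min d d'); first by rewrite lt_min d0.
rewrite lt_min => /andP[/hd /andP[h _] /hd' /andP[_ h']].
have := le_trans h h'; rewrite ler_pM2r ?dist_gt0// ler_expR; lra.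
Qed.

Section Chart.
Context (I : set R) (gt : R -> R) (g : K -> K).
Hypotheses (oI : open I) (iI : is_interval I) (dI : C1_diffeo_on I gt).
Hypothesis gtE : forall y : K, I (val y) -> gt (val y) = val (g y).

Let chart_dlog (t : R) : R := ln `|derive1 gt t|.

Lemma chart_derive (t : R) : I t -> is_derive t 1 gt (derive1 gt t).
Proof.
move=> It; have [[hd _] _ _] := dI; rewrite derive1E; apply: DeriveDef => //; exact: hd.
Qed.

Lemma chart_derive_neq0 (t : R) : I t -> derive1 gt t != 0.
Proof.
move=> It; have [_ oJ [h hK [hd _]]] := dI.
have dg := chart_derive It.
have dh : is_derive (gt t) 1 h (derive1 h (gt t)).
  by rewrite derive1E; apply: DeriveDef => //; apply: hd; exists t.
have dc := is_derive1_comp dh dg.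
have di : is_derive t 1 (h \o gt) 1.
  apply: near_eq_is_derive (is_derive_id t 1).
  have : nbhs t I by exact: open_nbhs_nbhs.
  by apply: filterS => v Iv /=; rewrite hK// inE.
have e : derive1 h (gt t) * derive1 gt t = 1.
  by have := @derive_val _ _ _ _ _ _ _ dc; have := @derive_val _ _ _ _ _ _ _ di; move=> -> <-.
by apply/eqP => e0; move: e; rewrite e0 mulr0 => /esym/eqP; rewrite oner_eq0.
Qed.

Lemma chart_dlog_continuous (t : R) : I t -> chart_dlog v @[v --> t] --> chart_dlog t.
Proof.
move=> It; have [[_ cd] _ _] := dI.
rewrite continuous_open_subspace// in cd.
have ct : derive1 gt v @[v --> t] --> derive1 gt t by apply: cd; rewrite inE.
have nt : `|derive1 gt v| @[v --> t] --> `|derive1 gt t| by apply: cvg_norm.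
apply: cvg_comp nt _.
by apply: continuous_ln; rewrite normr_gt0 chart_derive_neq0.
Qed.

(** The intermediate point [c] may lie in a gap of K: this is where the local extension of the map
    to an interval enters. *)
Lemma chart_mvt (s t : R) : I s -> I t -> exists c : R, [/\ I c, Num.min s t <= c <= Num.max s t &
  `|gt s - gt t| = expR (chart_dlog c) * `|s - t|].
Proof.
wlog st : s t / s <= t => [H|] Is It.
  have [st|ts] := leP s t; first by have := H s t st Is It; rewrite (min_idPl st) (max_idPr st).
  have [c [Ic c1 c2]] := H t s (ltW ts) It Is.
  by exists c; split=> //; [move: c1; rewrite (min_idPl (ltW ts)) (max_idPr (ltW ts))|rewrite distrC c2 distrC].
have sI (v : R) : v \in `[s, t] -> I v by rewrite in_itv/= => /andP[sv vt]; apply: (iI Is It); rewrite sv.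
have [||c cst hc] := @MVT_segment R gt (derive1 gt) s t st.
- by move=> v vst; apply: chart_derive; apply: sI; exact: subset_itv_oo_cc vst.
- apply: derivable_within_continuous => v vst; apply: ex_derive; apply: chart_derive; exact: sI.
exists c; split; first exact: sI.
  by rewrite (min_idPl st) (max_idPr st); move: cst; rewrite in_itv.
rewrite distrC hc normrM [`|s - t|]distrC lnK// posrE normr_gt0.
by apply: chart_derive_neq0; exact: sI.
Qed.

Lemma chart_dlogP x0 (e : R) : I (val x0) -> 0 < e -> exists2 d : R, 0 < d & forall x y,
  dist x0 x < d -> dist x0 y < d -> I (val x) /\
    expR (chart_dlog (val x) - e) * dist x y <= dist (g x) (g y)
      <= expR (chart_dlog (val x) + e) * dist x y.
Proof.
move=> Ix e0; have e2 : 0 < e / 2 by rewrite divr_gt0.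
have cd := chart_dlog_continuous Ix.
have nI : nbhs (val x0) I by exact: open_nbhs_nbhs.
have /nbhs_ballP[d /= d0 hd] : \forall v \near val x0, I v /\ `|chart_dlog (val x0) - chart_dlog v| < e / 2.
  by near=> v; split; near: v => //; move/cvgrPdist_lt : cd; apply.
exists d => // x y x0x x0y.
have [Ixx hx] : I (val x) /\ `|chart_dlog (val x0) - chart_dlog (val x)| < e / 2 by exact: hd.
have [Iyy hy] : I (val y) /\ `|chart_dlog (val x0) - chart_dlog (val y)| < e / 2 by exact: hd.
split=> //; have [c [Ic hc cE]] := chart_mvt Ixx Iyy.
have [_ hcd] : I c /\ `|chart_dlog (val x0) - chart_dlog c| < e / 2.
  apply: hd; change (`|val x0 - c| < d).
  have /andP[c1 c2] := hc; move: x0x x0y; rewrite /cantor_dist.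
  move: (val x0) (val x) (val y) c1 c2; clear=> a b b' c1 c2.
  rewrite !ltr_distl => /andP[h1 h2] /andP[h3 h4].
  move: c1 c2; case: (leP b b') => _ c1 c2; apply/andP; split; lra.
have dE : dist (g x) (g y) = expR (chart_dlog c) * dist x y by rewrite /cantor_dist -!gtE.
have [k1 k2] : chart_dlog (val x) - e <= chart_dlog c /\ chart_dlog c <= chart_dlog (val x) + e.
  move: hx hcd; move: (chart_dlog _) (chart_dlog _) (chart_dlog _) => b b' b''; clear.
  by rewrite !ltr_distl => /andP[? ?] /andP[? ?]; split; lra.
by rewrite dE; apply/andP; split; apply: ler_wpM2r; rewrite ?cantor_dist_ge0// ler_expR.
Unshelve. all: by end_near. Qed.

End Chart.

Definition dlog_bounds g (u : K -> R) (e eta : R) : Prop := forall x y, dist x y < eta ->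
  expR (u x - e) * dist x y <= dist (g x) (g y) <= expR (u x + e) * dist x y.

Lemma near_compact_pairs (B : R -> K -> K -> Prop) :
  (forall x0, exists2 d : R, 0 < d & forall x y, dist x0 x < d -> dist x0 y < d -> forall eta, 0 < eta < d -> B eta x y) ->
  \forall eta \near (0 : R)^'+, forall x y, dist x y < eta -> B eta x y.
Proof.
move=> H.
have nc : near_covering [set: K] by apply/compact_near_coveringP; exact: compact_cantor.
have : \forall eta \near (0 : R)^'+, forall x, setT x -> forall y, dist x y < eta -> B eta x y.
  apply: (nc R (0 : R)^'+ (fun eta x => forall y, dist x y < eta -> B eta x y)) => x0 _.
  have [d d0 hd] := H x0.
  exists (ball x0 (d / 2), [set eta : R | 0 < eta < d / 2]) => /=.
    split; first by apply: nbhsx_ballx; rewrite divr_gt0.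
    near=> eta; apply/andP; split; near: eta; [exact: nbhs_right_gt|apply: nbhs_right_lt; rewrite divr_gt0//].
  move=> [x eta] [/= bx /andP[eta0 etad]] y xy.
  have bx' : dist x0 x < d / 2 by exact: bx.
  apply: hd; first by lra.
    by have := dist_triangle x x0 y; lra.
  by apply/andP; split; lra.
by apply: filterS => eta h x y; exact: h.
Unshelve. all: by end_near. Qed.

(** [u] is chosen point by point, without a common chart. By [has_dlog_unique] it agrees near each
    point with the log derivative of one chart, and compactness gives a uniform radius. *)
Lemma C1_diffeo_dlog g : C1_diffeo g -> exists u : K -> R, forall e : R, 0 < e ->
  \forall eta \near (0 : R)^'+, dlog_bounds g u e eta.
Proof.
move=> [_ hg].
have ex x : exists l, has_dlog g x l.
  have [I [gt [oI iI Ix dI gtE]]] := hg x.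
  exists (ln `|derive1 gt (val x)|) => e e0.
  have [d d0 hd] := chart_dlogP oI iI dI gtE Ix e0.
  by exists d => // y xy; apply: (hd x y _ xy).2; rewrite distxx.
have [u hu] := choice ex.
exists u => e e0.
apply: (@near_compact_pairs (fun _ x y => expR (u x - e) * dist x y <= dist (g x) (g y) <=
  expR (u x + e) * dist x y)) => x0.
have [I [gt [oI iI Ix dI gtE]]] := hg x0.
have [d d0 hd] := chart_dlogP oI iI dI gtE Ix e0.
exists d => // x y x0x x0y _ _; have [Ixx] := hd x y x0x x0y.
suff -> : ln `|derive1 gt (val x)| = u x by [].
apply: has_dlog_unique (hu x) => e' e'0.
have [d' d'0 hd'] := chart_dlogP oI iI dI gtE Ixx e'0.
by exists d' => // y' xy'; apply: (hd' x y' _ xy').2; rewrite distxx.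
Qed.

Lemma C1_diffeo_inverse g : C1_diffeo g -> exists h : K -> K, [/\ cancel g h, cancel h g &
  forall e : R, 0 < e -> \forall eta \near (0 : R)^'+, forall x y, dist (g x) (g y) < eta -> dist x y < e].
Proof.
move=> [[_ [h [gh hg ch]]] _]; exists h; split=> // e e0.
have H : \forall eta \near (0 : R)^'+, forall x y, dist x y < eta -> dist (h x) (h y) < e.
  apply: (@near_compact_pairs (fun _ x y => dist (h x) (h y) < e)) => x0.
  have e2 : 0 < e / 2 by rewrite divr_gt0.
  have /nbhs_ballP[d /= d0 hd] : nbhs x0 (h @^-1` ball (h x0) (e / 2)).
    by apply: ch; exact: nbhsx_ballx.
  exists d => // x y x0x x0y _ _.
  have h1 : dist (h x0) (h x) < e / 2 by exact: hd.
  have h2 : dist (h x0) (h y) < e / 2 by exact: hd.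
  by have := dist_triangle (h x0) (h x) (h y); rewrite (distC (h x) (h x0)); lra.
by apply: filterS H => eta hh x y xy; rewrite -(gh x) -(gh y); exact: hh.
Qed.

Lemma C1_diffeo_family (J : finType) (g : J -> K -> K) : (forall j, C1_diffeo (g j)) ->
  exists (h : J -> K -> K) (u : J -> K -> R), [/\ forall j, cancel (g j) (h j),
    forall j, cancel (h j) (g j),
    forall e : R, 0 < e -> exists2 eta : R, 0 < eta & forall j x y, dist x y < eta ->
      expR (u j x - e) * dist x y <= dist (g j x) (g j y) <= expR (u j x + e) * dist x y &
    forall e : R, 0 < e -> exists2 eta : R, 0 < eta &
      forall j x y, dist (g j x) (g j y) < eta -> dist x y < e].
Proof.
move=> hg.
have [u hu] := choice (fun j => C1_diffeo_dlog (hg j)).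
have [h hh] := choice (fun j => C1_diffeo_inverse (hg j)).
have pick (B : J -> R -> Prop) : (forall j, \forall eta \near (0 : R)^'+, B j eta) ->
    exists2 eta : R, 0 < eta & forall j, B j eta.
  move=> hB; have hB' : \forall eta \near (0 : R)^'+, forall j, B j eta by exact: filter_forall.
  near (0 : R)^'+ => eta; exists eta; first by near: eta; exact: nbhs_right_gt.
  by near: eta.
exists h, u; split.
- by move=> j; have [] := hh j.
- by move=> j; have [] := hh j.
- by move=> e e0; apply: (pick (fun j eta => dlog_bounds (g j) (u j) e eta)) => j; exact: hu.
- move=> e e0; apply: (pick (fun j eta => forall x y, dist (g j x) (g j y) < eta -> dist x y < e)) => j.
  by have [_ _ h3] := hh j; exact: h3.
Unshelve. all: by end_near. Qed.

End DiffeoData.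

(** * The random map as a finite family *)

Section FiniteAlphabet.
Context {R : realType} {d : measure_display} {T : measurableType d}.
Context (p : probability T R) (P : probability (pathSpace T) R).
Hypotheses (finT : finite_set [set: T]) (bern : is_bernoulli p P).
Implicit Types (t : T) (w : pathSpace T).

(* The points of T that no measurable set separates from [t]: T is finite, but its
   sigma-algebra need not be discrete. *)
Definition atom t : set T := [set t' | forall A, measurable A -> A t -> A t'].

Lemma atom_refl t : atom t t. Proof. by []. Qed.

Lemma atom_sym t t' : atom t t' -> atom t' t.
Proof.
move=> h A mA At'; apply: contrapT => nAt.
exact: (h (~` A) (measurableC mA) nAt).
Qed.

Lemma atom_trans t' t t'' : atom t t' -> atom t' t'' -> atom t t''.
Proof. by move=> h h' A mA At; apply: h' => //; exact: h. Qed.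

Lemma atom_eq t t' : atom t t' -> atom t = atom t'.
Proof.
by move=> h; apply/seteqP; split=> u; apply: atom_trans => //; exact: atom_sym.
Qed.

(** Each point outside the atom is excluded by one measurable set, and finitely many such sets
    suffice. *)
Lemma atom_measurable t : measurable (atom t).
Proof.
have /choice[A hA] t' : exists A : set T, ~ atom t t' -> [/\ measurable A, A t & ~ A t'].
  have [h|h] := pselect (atom t t'); first by exists setT.
  have [A hA] : exists A, ~ (measurable A -> A t -> A t') by exact/existsNP.
  by exists A => _; move/not_implyP : hA => [? /not_implyP[? ?]].
have -> : atom t = \bigcap_(t' in ~` atom t) A t'.
  apply/seteqP; split=> u.
    by move=> tu t' /hA[mA At _]; exact: tu.
  move=> h; apply: contrapT => ntu; have [_ _] := hA _ ntu; apply.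
  exact: h.
apply: fin_bigcap_measurable; first exact: sub_finite_set finT.
by move=> t' /hA[].
Qed.

Lemma finite_union_negligible (F : T -> set T) (D : set T) : (forall t, D t -> p.-negligible (F t)) ->
  p.-negligible (\bigcup_(t in D) F t).
Proof.
move=> hF; have [s hs] := (finite_seqP _).1 finT.
pose G k := if `[< D (nth point s k) >] then F (nth point s k) else set0.
have : p.-negligible (\bigcup_k G k).
  apply: negligible_bigcup => k; rewrite /G; case: asboolP => [/hF//|_].
  exact: negligible_set0.
apply: negligibleS => u [t Dt Ftu].
have ts : t \in s by have : [set: T] t by []; rewrite hs.
exists (index t s) => //; rewrite /G nth_index//.
by rewrite asboolT.
Qed.

Lemma atom_partition : exists (n : nat) (E : 'I_n -> set T), [/\ forall j, exists t, E j = atom t,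
  forall i j t, E i t -> E j t -> i = j, forall j, (0 < p (E j))%E &
  p.-negligible (~` \bigcup_(j in setT) E j)].
Proof.
have [s hs] := (finite_seqP _).1 finT.
pose rep t : T := xget point (atom t).
have repP t : atom t (rep t) by apply: (@xgetPex _ point (atom t)); exists t.
have rep_eq t t' : atom t t' -> rep t = rep t' by move=> /atom_eq h; rewrite /rep h.
pose c := [seq u <- undup [seq rep u | u <- s] | (0 < p (atom u))%E].
have uc : uniq c by rewrite filter_uniq// undup_uniq.
have inc t : t \in c -> rep t = t /\ (0 < p (atom t))%E.
  rewrite mem_filter mem_undup => /andP[h /mapP[u _ e]]; split=> //.
  by rewrite e; apply: rep_eq; apply: atom_sym; exact: repP.
exists (size c), (fun j => atom (nth point c j)); split.
- by move=> j; exists (nth point c j).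
- move=> i j t hi hj; apply/val_inj/eqP; rewrite -(nth_uniq point _ _ uc)//=.
  have [e1 _] := inc _ (mem_nth point (ltn_ord i)); have [e2 _] := inc _ (mem_nth point (ltn_ord j)).
  rewrite -e1 -e2; apply/eqP; apply: rep_eq; apply: atom_trans hi _; exact: atom_sym.
- by move=> j; have [_] := inc _ (mem_nth point (ltn_ord j)).
- pose D := [set t : T | p (atom t) = 0].
  have : p.-negligible (\bigcup_(t in D) atom t).
    apply: finite_union_negligible => t Dt; exists (atom t); split=> //; exact: atom_measurable.
  apply: negligibleS => u hu; exists u; last exact: atom_refl.
  apply/eqP/negPn/negP => pu; apply: hu.
  have uinc : rep u \in c.
    rewrite mem_filter mem_undup; apply/andP; split.
      by rewrite -(atom_eq (repP u)) lt_neqAle eq_sym pu measure_ge0.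
    by apply/mapP; exists u => //; have : [set: T] u by []; rewrite hs.
  exists (Ordinal (eq_ind_r is_true uinc (index_mem (rep u) c))) => //=.
  by rewrite nth_index//; apply: atom_sym; exact: repP.
Qed.

Lemma coord_measurable i (A : set T) : measurable A -> measurable [set w : pathSpace T | A (w i)].
Proof. by move=> mA; apply: sub_gen_smallest; exists i, A. Qed.

Lemma cylinder_measurable n (A : nat -> set T) : (forall i, measurable (A i)) ->
  measurable [set w : pathSpace T | forall i, (i < n)%N -> A i (w i)].
Proof.
move=> mA; rewrite (_ : [set w | _] = \bigcap_(i in `I_n) [set w : pathSpace T | A i (w i)]).
  by apply: fin_bigcap_measurable => [|i _]; [exact: finite_II|exact: coord_measurable].
by apply/seteqP; split=> w /=.
Qed.

Lemma coord_probability i (A : set T) : measurable A -> P [set w : pathSpace T | A (w i)] = p A.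
Proof.
move=> mA; have := @bern i.+1 (fun k => if k == i then A else setT).
rewrite big_ord_recr /= eqxx big1 => [|k _]; last by rewrite ifN ?probability_setT// neq_ltn ltn_ord.
rewrite mul1e => <-; last by move=> k; case: ifP.
congr (P _); apply/seteqP; split=> w /=; first by move=> Aw k _; case: eqP => [->|].
by move=> /(_ i (ltnSn i)); rewrite eqxx.
Qed.

Lemma coord_negligible i (A : set T) : p.-negligible A -> P.-negligible [set w : pathSpace T | A (w i)].
Proof.
move=> [B [mB B0 AB]]; exists [set w : pathSpace T | B (w i)]; split.
- exact: coord_measurable.
- by rewrite coord_probability.
- by move=> w /= /AB.
Qed.

(** The sets saturated for letterwise equivalence form a sigma-algebra that contains the coordinate
    cylinders. *)
Lemma path_measurable_atoms (A : set (pathSpace T)) : measurable A ->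
  forall w w' : pathSpace T, (forall i, atom (w i) (w' i)) -> A w -> A w'.
Proof.
pose S : set (set (pathSpace T)) := [set A | forall w w', (forall i, atom (w i) (w' i)) -> A w -> A w'].
suff : (@measurable _ (pathSpace T)) `<=` S by apply.
apply: smallest_sub.
  split.
  - by [].
  - move=> B SB w w' ww' [_ nBw]; split=> // Bw'; apply: nBw; apply: SB Bw' => i; exact: atom_sym.
  - by move=> F SF w w' ww' [k _ Fw]; exists k => //; apply: SF Fw.
by move=> _ [i [B [mB ->]]] w w' ww' /= Bw; exact: ww'.
Qed.

Context (K : cantorSet R) (f : pathSpace T -> K -> K).

Lemma path_map_measurable x : measurable_fun [set: pathSpace T * borel K]
    (fun z : pathSpace T * borel K => f z.1 z.2 : borel K) ->
  measurable_fun [set: pathSpace T] (fun w => f w x : borel K).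
Proof.
by move=> mf; exact: (measurable_fun_pair1 (x : borel K) mf).
Qed.

Lemma singleton_measurable (x : K) : measurable ([set x] : set (borel K)).
Proof.
rewrite -[X in measurable X]setCK; apply: measurableC; apply: sub_gen_smallest.
rewrite openE => y /eqP yx; apply/nbhs_ballP; exists (cantor_dist y x) => /=; first by rewrite dist_gt0.
move=> z yz zx; have : cantor_dist y z < cantor_dist y x by exact: yz.
by rewrite zx ltxx.
Qed.

(* The a.e. identity [f w = g (w 0)] says nothing on a given path, so [w 0] is transplanted
   into a good path, which stays good because measurable sets are unions of atoms. *)
Lemma finite_structure : random_C1_diffeos P f ->
  exists (n : nat) (E : 'I_n -> set T) (G : 'I_n -> K -> K), [/\ forall j, measurable (E j),
    forall i j t, E i t -> E j t -> i = j, forall j, (0 < p (E j))%E, forall j, C1_diffeo (G j) &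
    {ae P, forall w, exists j, E j (w 0%N) /\ f w = G j}].
Proof.
move=> [[mf [g hg]] hd]; have [n [E [hE dE pE nE]]] := atom_partition.
have mE j : measurable (E j) by have [t ->] := hE j; exact: atom_measurable.
have [N [mN N0 hN]] : {ae P, forall w, [/\ f w = g (w 0%N), C1_diffeo (f w) & exists j, E j (w 0%N)]}.
  have h3 : {ae P, forall w, exists j, E j (w 0%N)}.
    have := coord_negligible 0 nE; apply: negligibleS => w /= h; contradict h.
    by have [j _ Ej] := h; exists j.
  by apply: filterS3 hg hd h3 => w.
have good w : ~ N w -> [/\ f w = g (w 0%N), C1_diffeo (f w) & exists j, E j (w 0%N)].
  by move=> nNw; apply: contrapT => h; apply: nNw; apply: hN.
have /choice[W hW] j : exists w : pathSpace T, E j (w 0%N) /\ ~ N w.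
  apply: contrapT => h.
  have sub : [set w : pathSpace T | E j (w 0%N)] `<=` N.
    by move=> w Ew; apply: contrapT => nN; apply: h; exists w.
  have := le_measure P; move=> /(_ [set w : pathSpace T | E j (w 0%N)] N).
  rewrite !inE => /(_ (coord_measurable 0 (mE j)) mN sub).
  have N0' : (P N <= 0)%E by rewrite le_eqVlt; apply/orP; left; apply/eqP; exact: N0.
  move=> hle; have := le_trans (hle : (P [set w : pathSpace T | E j (w 0%N)] <= P N)%E) N0'.
  by rewrite coord_probability// leNgt pE.
exists n, E, (fun j => f (W j)); split=> //.
- by move=> j; have [_ /good[]] := hW j.
exists N; split=> // w /= h; apply: contrapT => nNw; apply: h.
have [fw _ [j Ew]] := good w nNw; exists j; split=> //.
have [EW nNW] := hW j.
pose w' : pathSpace T := fun i => if i == 0%N then w 0%N else W j i.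
have ww' i : atom (W j i) (w' i).
  rewrite /w'; case: eqP => [->|_]; last exact: atom_refl.
  have [t et] := hE j; rewrite et in Ew EW.
  exact: atom_trans (atom_sym EW) Ew.
have nNw' : ~ N w' by exact: (path_measurable_atoms (measurableC mN) ww').
have [fw' _ _] := good w' nNw'.
rewrite fw -[w 0%N]/(w' 0%N) -fw'; apply/funext => x.
have mA : measurable [set v : pathSpace T | f v x = f (W j) x].
  have := path_map_measurable x mf measurableT (singleton_measurable (f (W j) x)).
  by rewrite setTI.
exact: (path_measurable_atoms mA ww').
Qed.

End FiniteAlphabet.

(** * Integrals up to null sets *)

Section IntegralFacts.
Context {R : realType}.
Import HBNNSimple.
Local Open Scope ereal_scope.

Lemma aeS d (T1 : measurableType d) (m : {measure set T1 -> \bar R}) (Q1 Q2 : T1 -> Prop) :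
  (forall z, Q1 z -> Q2 z) -> {ae m, forall z, Q1 z} -> {ae m, forall z, Q2 z}.
Proof. by move=> h; apply: negligibleS => z /= nQ /h. Qed.

Lemma ae_conj d (T1 : measurableType d) (m : {measure set T1 -> \bar R}) (Q1 Q2 : T1 -> Prop) :
  {ae m, forall z, Q1 z} -> {ae m, forall z, Q2 z} -> {ae m, forall z, Q1 z /\ Q2 z}.
Proof. by move=> h1 h2; exact: filterI. Qed.

Lemma measure_of_pushforward d d' (T1 : measurableType d) (T2 : measurableType d')
    (m : {measure set T1 -> \bar R}) (f : T1 -> T2) : measurable_fun [set: T1] f ->
  exists nu : {measure set T2 -> \bar R}, forall A, nu A = m (f @^-1` A).
Proof.
by move=> mf; exists (measure_function_pushforward__canonical__measure_function_Measure m mf).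
Qed.

Lemma invariant_ge0_integral d (T1 : measurableType d) (m : {measure set T1 -> \bar R}) (S : T1 -> T1) :
  measurable_fun [set: T1] S -> (forall A, measurable A -> m (S @^-1` A) = m A) ->
  forall F : T1 -> \bar R, measurable_fun [set: T1] F -> (forall z, 0 <= F z) ->
  \int[m]_z F (S z) = \int[m]_z F z.
Proof.
move=> mS hS F mF F0.
rewrite -[LHS]/(\int[m]_(z in S @^-1` setT) (F \o S) z) -ge0_integral_pushforward//.
have [nu hnu] := measure_of_pushforward m mS.
transitivity (\int[nu]_z F z); first by congr integral; apply/funext => A; rewrite hnu.
by apply: eq_measure_integral => A mA _; rewrite hnu hS.
Qed.

(* No measurability is assumed: [Lip (f w)] and [Llip (fiter f n w) x] are measurable only
   up to a null set, and the integral of the library is a supremum over simple functions. *)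
Lemma integral_ae_le d (T1 : measurableType d) (m : {measure set T1 -> \bar R}) (f g : T1 -> \bar R) :
  (forall z, 0 <= f z) -> (forall z, 0 <= g z) -> {ae m, forall z, f z <= g z} ->
  \int[m]_z f z <= \int[m]_z g z.
Proof.
move=> f0 g0 [N [mN N0 hN]].
rewrite (ge0_integralTE _ f0) (ge0_integralTE _ g0).
apply: ge_ereal_sup => _ [h hf <-].
(* A simple function below [f], set to 0 on the exceptional null set, lies below [g] and loses no
   integral. *)
pose h' := proj_nnsfun h (measurableC mN).
apply: (@le_trans _ _ (sintegral m h')); last first.
  apply: ereal_sup_ubound; exists h' => // z; rewrite /h' /= /proj_nnsfun/=.
  have [Nz|nNz] := pselect (N z).
    by rewrite mindicE memNset ?mulr0//; exact: g0.
  rewrite mindicE mem_set// mulr1; apply: le_trans (hf z) _.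
  by apply: contrapT => h1; apply: nNz; apply: hN.
rewrite -!integralT_nnsfun.
apply: ae_ge0_le_integral => //.
- by move=> z _; rewrite lee_fin.
- exact/measurable_EFinP.
- by move=> z _; rewrite lee_fin.
- exact/measurable_EFinP.
exists N; split=> // z /= hz; apply: contrapT => nNz; apply: hz => _.
by rewrite /h' /= mindicE mem_set// mulr1.
Qed.

Lemma integral_ae_eq d (T1 : measurableType d) (m : {measure set T1 -> \bar R}) (f g : T1 -> \bar R) :
  {ae m, forall z, f z = g z} -> \int[m]_z f z = \int[m]_z g z.
Proof.
move=> fg; rewrite integralE [RHS]integralE; congr (_ - _); apply/eqP; rewrite eq_le; apply/andP; split.
all: apply: integral_ae_le => //; apply: filterS fg => z e.
all: by rewrite ?funeposE ?funenegE e.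
Qed.

End IntegralFacts.

(** * From random paths to finite words *)

Section RandomIfs.
Context {R : realType} {d : measure_display} {T : measurableType d}.
Context (p : probability T R) (P : probability (pathSpace T) R).
Context (K : cantorSet R) (f : pathSpace T -> K -> K) (s : cantor_ifs K).
Local Notation dist := (@cantor_dist R K).
Local Notation I := (ifs_idx s).
Local Notation q := (@ifs_wt R K s).
Local Notation g := (@ifs_map R K s).
Local Notation u := (@ifs_dlog R K s).
Local Notation shift := (@path_shift _ T).
Context (E : I -> set T).
Hypotheses (bern : is_bernoulli p P) (mE : forall j, measurable (E j)).
Hypothesis dE : forall i j t, E i t -> E j t -> i = j.
Hypothesis pE : forall j, p (E j) = (q j)%:E.
Hypothesis mf : measurable_fun [set: pathSpace T * borel K]
  (fun z : pathSpace T * borel K => f z.1 z.2 : borel K).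
Hypothesis fE : {ae P, forall w, exists j, E j (w 0%N) /\ f w = g j}.
Implicit Types (w : pathSpace T) (x y : K) (F : K -> R) (mu : probability (borel K) R).

Lemma shift_measurable : measurable_fun [set: pathSpace T] shift.
Proof.
apply: (@measurability _ _ (pathSpace T) (pathSpace T) setT shift (@coord_cylinders _ T)) => //.
move=> _ [_ [i [A [mA ->]]] <-]; rewrite setTI.
exact: (coord_measurable i.+1 mA).
Qed.

Definition path_cylinders : set (set (pathSpace T)) :=
  [set C | exists n A, (forall i, measurable (A i)) /\
     C = [set w | forall i, (i < n)%N -> A i (w i)]].

Lemma path_cylinderE : @measurable _ (pathSpace T) = <<s path_cylinders >>.
Proof.
apply/seteqP; split; last first.
  apply: smallest_sub; first exact: sigma_algebra_measurable.
  by move=> _ [n [A [mA ->]]]; exact: cylinder_measurable.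
apply: smallest_sub; first exact: smallest_sigma_algebra.
move=> _ [i [A [mA ->]]]; apply: sub_gen_smallest.
exists i.+1, (fun k => if k == i then A else setT); split; first by move=> k; case: ifP.
apply/seteqP; split=> w /=; first by move=> Aw k _; case: eqP => [->|].
by move=> /(_ i (ltnSn i)); rewrite eqxx.
Qed.

Lemma path_cylinderI : setI_closed path_cylinders.
Proof.
move=> _ _ [n [A [mA ->]]] [m [B [mB ->]]].
exists (maxn n m), (fun i => (if (i < n)%N then A i else setT) `&` (if (i < m)%N then B i else setT)).
split; first by move=> i; apply: measurableI; case: ifP.
apply/seteqP; split=> w /=.
  by move=> [hA hB] i _; split; case: ifP => // h; [exact: hA|exact: hB].
move=> h; split=> i hi; have := h i; rewrite leq_max hi ?orbT /= => /(_ erefl) [] //.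
Qed.

(** Independence of the first letter from the shifted path: as functions of [C], both sides are
    finite measures that agree on finite cylinders, a generating family stable under
    intersection. *)
Lemma head_shift_probability (B : set T) (C : set (pathSpace T)) : measurable B -> measurable C ->
  P ([set w | B (w 0%N)] `&` shift @^-1` C) = (p B * P C)%E.
Proof.
move=> mB mC.
have mB0 := coord_measurable 0 mB.
have [nu hnu] := measure_of_pushforward (mrestr P mB0) shift_measurable.
have pB0 : (0 <= fine (p B))%R by rewrite fine_ge0.
have pBE : (fine (p B))%:E = p B by rewrite fineK// fin_num_measure.
pose nu' := mscale (NngNum pB0) P.
have h : nu C = nu' C.
  apply: (@measure_unique _ R (pathSpace T) path_cylinders (fun=> setT)) => //.
  - exact: path_cylinderE.
  - exact: path_cylinderI.
  - move=> _; exists 0%N, (fun=> setT); split=> //.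
    by apply/seteqP; split.
  - by apply/seteqP; split=> // w _; exists 0%N.
  - move=> _ [n [A [mA ->]]]; rewrite hnu -[RHS]/((fine (p B))%:E * P _)%E pBE /mrestr bern//.
    have -> : (p B * \prod_(i < n) p (A i) = \prod_(i < n.+1) p (if val i is k.+1 then A k else B))%E.
      by rewrite big_ord_recl.
    rewrite -(@bern n.+1 (fun i => if i is k.+1 then A k else B)); last by case.
    congr (P _); apply/seteqP; split=> w /=.
      by move=> [hA Bw] [_|i]//= hi; exact: hA.
    by move=> hw; split=> [i hi|]; [exact: (hw i.+1)|exact: (hw 0%N)].
  - move=> _; rewrite hnu /mrestr/=; apply: le_lt_trans (ltry 1); apply: probability_le1.
    by apply: measurableI => //; rewrite preimage_setT; exact: measurableT.
by move: h; rewrite hnu -[RHS]/((fine (p B))%:E * P _)%E pBE /mrestr => <-; rewrite setIC.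
Qed.

Lemma shift_probability (C : set (pathSpace T)) : measurable C -> P (shift @^-1` C) = P C.
Proof.
move=> mC; have := @head_shift_probability setT C measurableT mC.
rewrite (_ : [set w | _] = setT) ?setTI => [->|]; last by apply/seteqP; split.
by rewrite probability_setT mul1e.
Qed.

Lemma ae_shift (Q : pathSpace T -> Prop) : {ae P, forall w, Q w} -> {ae P, forall w, Q (shift w)}.
Proof.
move=> [N [mN N0 hN]]; exists (shift @^-1` N); split.
- by rewrite -[X in measurable X]setTI; exact: shift_measurable.
- by rewrite shift_probability.
- by move=> w /= hw; exact: hN.
Qed.

Lemma iter_shiftE n w i : iter n shift w i = w (i + n)%N.
Proof. by elim: n i => [|n IH] i; rewrite ?addn0// iterS /path_shift IH addSnnS. Qed.

Lemma ae_path : {ae P, forall w, forall n, exists j, E j (w n) /\ f (iter n shift w) = g j}.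
Proof.
apply: ae_foralln => n.
have : {ae P, forall w, exists j, E j (iter n shift w 0%N) /\ f (iter n shift w) = g j}.
  elim: n => [//|n IH]; have := ae_shift IH; apply: filterS => w.
  by rewrite iterSr.
by apply: filterS => w; rewrite iter_shiftE add0n.
Qed.

Lemma fiter_word w : (forall n, exists j, E j (w n) /\ f (iter n shift w) = g j) ->
  forall n, exists v : seq I, [/\ size v = n, (forall i, (i < n)%N -> forall j0, E (nth j0 v i) (w i)) &
    forall x, fiter f n w x = word_map v x].
Proof.
move=> hw; elim=> [|n [v [vn Ev hv]]]; first by exists [::].
have [j [Ej fj]] := hw n.
exists (rcons v j); split.
- by rewrite size_rcons vn.
- move=> i; rewrite ltnS leq_eqVlt => /orP[/eqP ->|hi] j0; rewrite nth_rcons vn.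
    by rewrite ltnn eqxx.
  by rewrite hi; exact: Ev.
- by move=> x /=; rewrite hv fj -cats1 word_map_cat.
Qed.

(** The cylinder of a word has positive probability, so it meets every almost sure event; this is
    how almost sure invariance reaches all words. *)
Lemma word_cylinder (v : seq I) (Q : pathSpace T -> Prop) : {ae P, forall w, Q w} ->
  exists w, Q w /\ forall i, (i < size v)%N -> forall j0, E (nth j0 v i) (w i).
Proof.
move=> [N [mN N0 hN]]; have [j0 _] := ifs_idx_inh s.
pose A i := E (nth j0 v i).
pose C := [set w : pathSpace T | forall i, (i < size v)%N -> A i (w i)].
have mC : measurable C by apply: cylinder_measurable => i; exact: mE.
have PC : (0 < P C)%E.
  rewrite bern; last by move=> i; exact: mE.
  rewrite (eq_bigr (fun i : 'I_(size v) => (q (nth j0 v i))%:E)) => [|i _]; last exact: pE.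
  rewrite prodEFin lte_fin; apply: prodr_gt0 => i _; exact: ifs_wt_gt0.
have [w [Cw nNw]] : exists w, C w /\ ~ N w.
  apply: contrapT => h.
  have sub : C `<=` N by move=> w Cw; apply: contrapT => nN; apply: h; exists w.
  have N0' : (P N <= 0)%E by rewrite le_eqVlt; apply/orP; left; apply/eqP; exact: N0.
  have hle : (P C <= P N)%E by apply: le_measure => //; rewrite inE.
  by have := le_trans hle N0'; rewrite leNgt PC.
exists w; split; first by apply: contrapT => h; apply: nNw; exact: hN.
move=> i hi j1; rewrite (set_nth_default j0)//; exact: Cw.
Qed.

Lemma ae_ifs_map (Q : (K -> K) -> Prop) : {ae P, forall w, Q (f w)} <-> forall j, Q (g j).
Proof.
split=> [h j|h]; last first.
  by apply: aeS fE => w [j [_ ->]].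
have h' : {ae P, forall w, Q (f w) /\ exists j, E j (w 0%N) /\ f w = g j} by exact: filterI.
have [w [[Qw [i [Ei fi]]] hw]] := word_cylinder [:: j] h'.
by have e : i = j := dE Ei (hw 0%N isT j); rewrite -e -fi.
Qed.

Lemma set_invariantP k Y : set_invariant P f k Y <-> word_invariant s k Y.
Proof.
split=> [h v vk x Yx|h]; last first.
  apply: aeS ae_path => w hw _ [x Yx <-].
  by have [v [vk _ ->]] := fiter_word hw k; exact: h.
have h' := ae_conj h ae_path.
have [w [[Yw hw] Ew]] := word_cylinder v h'.
have [v' [v'k Ev' hv']] := fiter_word hw k.
have [j0 _] := ifs_idx_inh s.
have -> : v = v'.
  apply: (@eq_from_nth _ j0); first by rewrite vk v'k.
  by move=> i hi; apply: dE (Ew i hi j0) (Ev' i _ j0); rewrite -vk.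
by rewrite -hv'; apply: Yw; exists x.
Qed.

(** The shape met on rectangles of the skew product: a function of the first letter times an event
    of the shifted path, which are independent. *)
Lemma label_integral (c : I -> R) (C : set (pathSpace T)) (h : pathSpace T -> \bar R) :
  measurable C -> (forall j, 0 <= c j) ->
  {ae P, forall w, forall j, E j (w 0%N) -> f w = g j -> h w = (c j * \1_C (shift w))%:E} ->
  (\int[P]_w h w = (\sum_j q j * c j)%:E * P C)%E.
Proof.
move=> mC c0 hh.
pose B j : set (pathSpace T) := [set w | E j (w 0%N)] `&` shift @^-1` C.
have mB j : measurable (B j).
  apply: measurableI; first exact: (coord_measurable 0 (mE j)).
  by rewrite -[X in measurable X]setTI; exact: shift_measurable.
rewrite (@integral_ae_eq _ _ _ P h (fun w => (\sum_(j : I) (c j * \1_(B j) w)%:E)%E)); last first.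
  apply: aeS (ae_conj fE hh) => w [[j [Ej fj]] /(_ j Ej fj) ->].
  rewrite (bigD1 j)//= big1 => [|i ij]; last first.
    rewrite indicE memNset ?mulr0// => -[Ei _]; move/eqP : ij; apply; exact: dE Ei Ej.
  rewrite adde0 !indicE; congr (_ * _)%:E; congr (_%:R); congr nat_of_bool.
  by apply/idP/idP; rewrite !inE /B /=; [move=> ?; split|case].
rewrite ge0_integral_sum//; last 2 first.
- by move=> j; apply/measurable_EFinP; apply: measurable_funM => //; exact: measurable_indic.
- by move=> j w _; rewrite lee_fin mulr_ge0// indicE.
transitivity (\sum_(j : I) ((q j * c j)%:E * P C))%E; last first.
  rewrite -ge0_sume_distrl => [|j _]; last by rewrite lee_fin mulr_ge0 ?ifs_wt_ge0.
  by rewrite sumEFin.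
apply: eq_bigr => j _.
rewrite (eq_integral (fun w => (c j)%:E * (\1_(B j) w)%:E)%E) => [|w _]; last by rewrite EFinM.
rewrite ge0_integralZl//; last 2 first.
- by apply/measurable_EFinP; exact: measurable_indic.
- by rewrite lee_fin.
rewrite integral_indic// setIT.
transitivity ((c j)%:E * ((q j)%:E * P C))%E; last by rewrite muleA EFinM; congr (_ * _)%E; rewrite muleC.
by congr (_ * _)%E; rewrite -pE; exact: head_shift_probability.
Qed.

Lemma label_mean (c : I -> R) (h : pathSpace T -> \bar R) :
  {ae P, forall w, forall j, E j (w 0%N) -> f w = g j -> h w = (c j)%:E} ->
  (\int[P]_w h w = (\sum_j q j * c j)%:E)%E.
Proof.
move=> hh.
have part (c' : I -> R) (h' : pathSpace T -> \bar R) : (forall j, 0 <= c' j) ->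
    {ae P, forall w, forall j, E j (w 0%N) -> f w = g j -> h' w = (c' j)%:E} ->
    (\int[P]_w h' w = (\sum_j q j * c' j)%:E)%E.
  move=> c0 hh'; rewrite (@label_integral c' setT)//; first by rewrite probability_setT mule1.
  by apply: aeS hh' => w h1 j Ej fj; rewrite (h1 j Ej fj) indicE in_setT mulr1.
rewrite integralE.
rewrite (part (fun j => Num.max (c j) 0)) => [|j|]; last 2 first.
- by rewrite le_max lexx orbT.
- by apply: aeS hh => w h1 j Ej fj; rewrite funeposE (h1 j Ej fj) EFin_max.
rewrite (part (fun j => Num.max (- c j) 0)) => [|j|]; last 2 first.
- by rewrite le_max lexx orbT.
- by apply: aeS hh => w h1 j Ej fj; rewrite funenegE (h1 j Ej fj) EFin_max.
rewrite -EFinB -sumrB; congr EFin; apply: eq_bigr => j _; rewrite -mulrBr; congr (_ * _).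
by case: (leP (c j) 0) => h1; case: (leP (- c j) 0) => h2; lra.
Qed.

Lemma transfer_integral F x : (\int[P]_w (F (f w x))%:E = (transfer s F x)%:E)%E.
Proof. by apply: (@label_mean (fun j => F (g j x))); apply: aeW => w j _ ->. Qed.

Lemma koopmanE phi x : koopman P f phi x = ctransfer s phi x.
Proof.
rewrite /koopman /ctransfer /Rintegral.
by rewrite (transfer_integral (fun y => complex.Re (phi y))) (transfer_integral (fun y => complex.Im (phi y))).
Qed.

Definition skew (z : pathSpace T * borel K) : pathSpace T * borel K := (shift z.1, f z.1 z.2 : borel K).

Lemma skew_measurable : measurable_fun [set: pathSpace T * borel K] skew.
Proof.
apply: measurable_fun_pair; last exact: mf.
by apply: measurableT_comp; [exact: shift_measurable|exact: measurable_fst].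
Qed.

Lemma uc_integrable mu F : unif_cont F -> mu.-integrable [set: borel K] (EFin \o F).
Proof.
move=> uF; apply: measurable_bounded_integrable.
- exact: measurableT.
- by apply: le_lt_trans (probability_le1 mu _) _; [exact: measurableT|exact: ltry].
- exact: unif_cont_measurable.
- have [B hB] := unif_cont_bounded uF; exists B; split; first exact: num_real.
  by move=> M BM x _ /=; apply: le_trans (hB x) _; exact: ltW.
Qed.

(** Used only on uniformly continuous functions, for which measurability and integrability are
    automatic. *)
Definition uc_int mu F : R := \int[mu]_x F x.

Lemma uc_intE mu F : unif_cont F -> (\int[mu]_x (F x)%:E)%E = (uc_int mu F)%:E.
Proof. by move=> uF; rewrite fineK//; apply: integrable_fin_num => //; exact: uc_integrable. Qed.

Lemma uc_intD mu F G : unif_cont F -> unif_cont G -> uc_int mu (fun x => F x + G x) = uc_int mu F + uc_int mu G.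
Proof. by move=> uF uG; apply: RintegralD => //; exact: uc_integrable. Qed.

Lemma uc_intZ mu (c : R) F : unif_cont F -> uc_int mu (fun x => c * F x) = c * uc_int mu F.
Proof. by move=> uF; apply: RintegralZl => //; exact: uc_integrable. Qed.

Lemma uc_int_cst mu (c : R) : uc_int mu (fun=> c) = c.
Proof.
transitivity (c * fine (mu setT)); first exact: Rintegral_cst.
by rewrite probability_setT mulr1.
Qed.

Lemma uc_int_le mu F G : unif_cont F -> unif_cont G -> (forall x, F x <= G x) -> uc_int mu F <= uc_int mu G.
Proof. by move=> uF uG FG; apply: le_Rintegral => //; exact: uc_integrable. Qed.

Lemma uc_int_sum mu (J : Type) (t : seq J) (F : J -> K -> R) : (forall j, unif_cont (F j)) ->
  uc_int mu (fun x => \sum_(j <- t) F j x) = \sum_(j <- t) uc_int mu (F j).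
Proof.
move=> uF; elim: t => [|j t IH].
  by rewrite big_nil -[RHS](uc_int_cst mu); congr uc_int; apply/funext => x; rewrite big_nil.
rewrite big_cons -IH -uc_intD//; last exact: unif_cont_sum.
by congr uc_int; apply/funext => x; rewrite big_cons.
Qed.

Lemma uc_int_indic mu r (A : set K) : 0 < r -> saturated r A -> mu A = (uc_int mu (\1_A))%:E.
Proof.
move=> r0 sA; rewrite -uc_intE; last exact: unif_cont_indic sA.
by rewrite integral_indic ?setIT//; exact: saturated_measurable sA.
Qed.

Lemma uc_int_transfer mu F : stationary P f mu -> unif_cont F -> uc_int mu (transfer s F) = uc_int mu F.
Proof.
move=> st.
have ge0 G : unif_cont G -> (forall x, 0 <= G x) -> uc_int mu (transfer s G) = uc_int mu G.
  move=> uG G0; apply: EFin_inj; rewrite -!uc_intE//; last exact: unif_cont_transfer.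
  have mG : measurable_fun [set: borel K] (fun x : borel K => (G x)%:E).
    by apply/measurable_EFinP; exact: unif_cont_measurable.
  have mG2 : measurable_fun [set: pathSpace T * borel K] (fun z : pathSpace T * borel K => (G z.2)%:E).
    exact: (measurableT_comp mG measurable_snd).
  have mG3 : measurable_fun [set: pathSpace T * borel K] (fun z : pathSpace T * borel K => (G (f z.1 z.2))%:E).
    exact: (measurableT_comp mG mf).
  have e1 : (\int[P \x mu]_z (G z.2)%:E = \int[mu]_y (G y)%:E)%E.
    rewrite (fubini_tonelli2 (fun z : pathSpace T * borel K => (G z.2)%:E))// => [|z]; last by rewrite lee_fin.
    apply: eq_integral => y _.
    rewrite /fubini_G /=; transitivity ((G y)%:E * P setT)%E; first by apply: integral_cst; exact: measurableT.
    by rewrite probability_setT mule1.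
  rewrite -e1 -(@invariant_ge0_integral R _ _ (P \x mu)%E skew skew_measurable st _ mG2) => [|z]; last by rewrite lee_fin.
  rewrite (fubini_tonelli2 (fun z : pathSpace T * borel K => (G (skew z).2)%:E))// => [|z]; last by rewrite lee_fin.
  by apply: eq_integral => y _; rewrite -transfer_integral.
(* Adding a bound reduces to nonnegative functions, where Tonelli applies. *)
move=> uF; have [B hB] := unif_cont_bounded uF.
have uB : unif_cont (fun x => F x + B) by apply: unif_contD => //; exact: unif_cont_cst.
have := ge0 _ uB; rewrite uc_intD//; last exact: unif_cont_cst.
rewrite (_ : transfer s _ = fun x => transfer s F x + B); last first.
  by apply/funext => x; rewrite transferD; congr (_ + _); rewrite /transfer -mulr_suml ifs_wt_sum mul1r.
rewrite uc_intD; [|exact: unif_cont_transfer|exact: unif_cont_cst].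
move=> h; apply: (addIr (uc_int mu (fun=> B))); apply: h => x.
by have := lerNnormlW (hB x); lra.
Qed.

Lemma uc_int_iter_transfer mu k F : stationary P f mu -> unif_cont F ->
  uc_int mu (iter k (transfer s) F) = uc_int mu F.
Proof.
move=> st uF; elim: k => //= k IH; rewrite uc_int_transfer//; exact: unif_cont_iter_transfer.
Qed.

Lemma uc_int_cesaro mu n F : stationary P f mu -> unif_cont F -> uc_int mu (cesaro s n F) = uc_int mu F.
Proof.
move=> st uF; rewrite /cesaro uc_intZ; last by apply: unif_cont_sum => k; exact: unif_cont_iter_transfer.
rewrite (@uc_int_sum mu 'I_n.+1 (index_enum 'I_n.+1) (fun k => iter k (transfer s) F)); last first.
  by move=> k; exact: unif_cont_iter_transfer.
rewrite (eq_bigr (fun=> uc_int mu F)) => [|k _]; last exact: uc_int_iter_transfer.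
by rewrite sumr_const card_ord -[uc_int mu F *+ _]mulr_natl mulKf.
Qed.

Lemma uc_int_drift mu n : stationary P f mu -> uc_int mu (drift s n) = n%:R * uc_int mu (mean_dlog s).
Proof.
move=> st.
have um k : unif_cont (iter k (transfer s) (mean_dlog s)).
  by apply: unif_cont_iter_transfer; exact: unif_cont_mean_dlog.
rewrite /drift (@uc_int_sum mu 'I_n (index_enum 'I_n) (fun k => iter k (transfer s) (mean_dlog s)))//.
rewrite (eq_bigr (fun=> uc_int mu (mean_dlog s))) => [|k _].
  by rewrite sumr_const card_ord -[uc_int _ _ *+ _]mulr_natl.
by apply: uc_int_iter_transfer => //; exact: unif_cont_mean_dlog.
Qed.

Lemma transfer_indic_integral mu (A : set (borel K)) : measurable A ->
  (\int[mu]_x (transfer s (\1_A) x)%:E = \sum_(j : I) (q j)%:E * mu (g j @^-1` A))%E.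
Proof.
move=> mA.
have mgA j : measurable (g j @^-1` A : set (borel K)).
  by rewrite -[X in measurable X]setTI; exact: ifs_map_measurable.
rewrite (eq_integral (fun x : borel K => (\sum_(j : I) ((q j)%:E * (\1_(g j @^-1` A) x)%:E))%E)) => [|x _]; last first.
  by rewrite /transfer -sumEFin; apply: eq_bigr => j _; rewrite EFinM.
rewrite ge0_integral_sum//; last 2 first.
- by move=> j; apply: emeasurable_funM => //; apply/measurable_EFinP; exact: measurable_indic.
- by move=> j x _; rewrite -EFinM lee_fin mulr_ge0 ?ifs_wt_ge0// indicE.
apply: eq_bigr => j _; rewrite ge0_integralZl//.
- by rewrite integral_indic ?setIT.
- by apply/measurable_EFinP; exact: measurable_indic.
- by rewrite lee_fin ifs_wt_ge0.
Qed.

Lemma skew_rectangle mu (C : set (pathSpace T)) (A : set (borel K)) : measurable C -> measurable A ->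
  ((P \x mu) (skew @^-1` (C `*` A)) = P C * \int[mu]_x (transfer s (\1_A) x)%:E)%E.
Proof.
move=> mC mA.
have mX : measurable (skew @^-1` (C `*` A)).
  by rewrite -[X in measurable X]setTI; apply: skew_measurable => //; exact: measurableX.
have mI : measurable_fun [set: pathSpace T * borel K] (fun z : pathSpace T * borel K => (\1_(skew @^-1` (C `*` A)) z : R)%:E).
  by apply/measurable_EFinP; exact: measurable_indic.
rewrite -[LHS](_ : \int[P \x mu]_z (\1_(skew @^-1` (C `*` A)) z)%:E = _)%E; last first.
  by rewrite integral_indic ?setIT.
rewrite (fubini_tonelli2 (fun z : pathSpace T * borel K => (\1_(skew @^-1` (C `*` A)) z)%:E))//.
have mt : measurable_fun [set: borel K] (fun x : borel K => (transfer s (\1_A) x)%:E).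
  apply/measurable_EFinP; apply: measurable_sum => j; apply: measurable_funM => //.
  have mgA : measurable (g j @^-1` A : set (borel K)).
    by rewrite -[X in measurable X]setTI; exact: ifs_map_measurable.
  have := @measurable_indic _ (borel K) R setT _ mgA; exact.
rewrite muleC -ge0_integralZr//; last first.
  by move=> x _; rewrite lee_fin sumr_ge0// => j _; rewrite mulr_ge0 ?ifs_wt_ge0// indicE.
apply: eq_integral => y _; rewrite /fubini_G.
rewrite (@label_integral (fun j => \1_A (g j y)) C)//.
apply: aeW => w j _ fw; rewrite indicE [in RHS]indicE indicE -natrM mulnb.
congr (_%:R%:E); congr nat_of_bool.
apply/idP/andP => [|[]]; rewrite !inE /skew /= fw; [by case|by []].
Qed.

(** Invariance of [mu] under the transfer operator holds on saturated sets, where [mu] is [m], and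
    extends by uniqueness. Independence of the first letter then gives invariance of the product on
    rectangles, which determine it. *)
Lemma stationary_of_mean m mu : stationary_mean s m ->
  (forall r A, 0 < r -> saturated r A -> mu A = (m (\1_A))%:E) -> stationary P f mu.
Proof.
move=> sm hmu; have mm := stationary_is_mean sm.
have tA (A : set (borel K)) : measurable A -> (\int[mu]_x (transfer s (\1_A) x)%:E = mu A)%E.
  have [nu hnu] := measure_of_pushforward (P \x mu)%E skew_measurable.
  have [nu2 hnu2] := measure_of_pushforward nu (@measurable_snd _ _ (pathSpace T) (borel K)).
  have nu2E B : measurable B -> nu2 B = (\int[mu]_x (transfer s (\1_B) x)%:E)%E.
    move=> mB; rewrite hnu2 hnu (_ : snd @^-1` B = setT `*` B); last by apply/seteqP; split=> z /=; [|case].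
    transitivity (P setT * \int[mu]_x (transfer s (\1_B) x)%:E)%E; last by rewrite probability_setT mul1e.
    by apply: skew_rectangle => //; exact: measurableT.
  move=> mA; rewrite -nu2E//; symmetry.
  apply: (@borel_measure_unique R K mu nu2) => //.
    by apply: le_lt_trans (probability_le1 mu _) _; [exact: measurableT|exact: ltry].
  move=> r B r0 sB; rewrite nu2E; last exact: saturated_measurable sB.
  rewrite transfer_indic_integral; last exact: saturated_measurable sB.
  transitivity ((m (\1_B))%:E); first exact: hmu sB.
  rewrite -(mean_transfer sm); last exact: bounded_indic.
  rewrite /transfer (mean_sum mm) => [|j]; last first.
    by apply: bounded_funM; [exact: bounded_cst|apply: bounded_fun_comp; exact: bounded_indic].
  rewrite -sumEFin; apply: eq_bigr => j _.
  rewrite (meanZ mm); last by apply: bounded_fun_comp; exact: bounded_indic.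
  rewrite EFinM; congr (_ * _)%E.
  have [r' r'0 sB'] := ifs_map_saturated j r0 sB.
  by symmetry; exact: hmu sB'.
move=> X mX; have [nu hnu] := measure_of_pushforward (P \x mu)%E skew_measurable.
transitivity (nu X); first by rewrite hnu.
symmetry; apply: product_measure_unique => // C A mC mA.
rewrite hnu; transitivity (P C * \int[mu]_x (transfer s (\1_A) x)%:E)%E; first exact: skew_rectangle.
by rewrite tA.
Qed.

Lemma uniquely_ergodicP a N (rho eta : R) (L : {linear holder K a -> holder K a}) :
  0 < a -> 0 <= rho < 1 -> 0 < eta ->
  (forall x y, dist x y < eta ->
    word_mean N (fun w : seq I => dist (word_map w x) (word_map w y) `^ a) <= rho * dist x y `^ a) ->
  (forall phi x, L phi x = ctransfer s phi x) ->
  fixed_constant L <-> uniquely_ergodic P f.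
Proof.
move=> a0 rho0 eta0 contr LE; split=> [fc|[mu st uni]].
  have sm := krylov_stationary s (fun=> point).
  have [mu hmu] := mean_probability (stationary_is_mean sm).
  exists mu; first exact: stationary_of_mean sm hmu.
  move=> nu st A mA; symmetry; have st' := stationary_of_mean sm hmu.
  apply: (@borel_measure_unique R K mu nu) mA => //.
    by apply: le_lt_trans (probability_le1 mu _) _; [exact: measurableT|exact: ltry].
  move=> r B r0 sB; have uB := unif_cont_indic r0 sB.
  transitivity ((uc_int mu (\1_B))%:E); first exact: uc_int_indic sB.
  transitivity ((uc_int nu (\1_B))%:E); last by symmetry; exact: uc_int_indic sB.
  congr EFin; have [c hc] := cesaro_uniform a0 rho0 eta0 contr LE fc r0 sB.
  suff key lam : stationary P f lam -> uc_int lam (\1_B) = c by rewrite !key.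
  move=> sl; apply/eqP; rewrite -subr_eq0 -normr_le0; apply/ler_addgt0Pl => e e0; rewrite addr0.
  have [n hn] := hc e e0.
  have uces : unif_cont (cesaro s n (\1_B)).
    by apply: unif_contZ; apply: unif_cont_sum => k; exact: unif_cont_iter_transfer.
  rewrite -(uc_int_cesaro n sl uB) ler_distl; apply/andP; split.
    rewrite -(uc_int_cst lam (c - e)); apply: uc_int_le => //; first exact: unif_cont_cst.
    by move=> x; have := hn x; rewrite ler_distl => /andP[].
  rewrite -(uc_int_cst lam (c + e)); apply: uc_int_le => //; first exact: unif_cont_cst.
  by move=> x; have := hn x; rewrite ler_distl => /andP[].
apply: contrapT => /(not_fixed_constant a0 LE)[Y [Z [[cY Y0] [cZ Z0] YZ iY iZ]]].
have [m1 [m2 [r [A [[sm1 sm2] r0 sA e1 e2]]]]] := disjoint_invariant_means cY Y0 cZ Z0 YZ iY iZ.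
have [mu1 h1] := mean_probability (stationary_is_mean sm1).
have [mu2 h2] := mean_probability (stationary_is_mean sm2).
have mA : measurable (A : set (borel K)) := saturated_measurable r0 sA.
have : mu1 A = mu2 A.
  by rewrite (uni mu1 (stationary_of_mean sm1 h1))// (uni mu2 (stationary_of_mean sm2 h2)).
rewrite (h1 r A r0 sA) (h2 r A r0 sA) e1 e2; case=> /eqP; by rewrite oner_eq0.
Qed.

Lemma word_Lip_on (v : seq I) x (e : R) : 0 < e -> \forall r \near (0 : R)^'+,
  ((expR (word_dlog v x - e))%:E <= Lip_on (ball x r) (word_map v) <= (expR (word_dlog v x + e))%:E)%E.
Proof.
move=> e0; set n := size v.
(* One third of [e] covers the distortion of the word, two thirds the variation of [word_dlog] in
   the ball; [n.+1] avoids a division by 0 for the empty word. *)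
pose e1 : R := e / (3 * n.+1%:R).
have e10 : 0 < e1 by rewrite divr_gt0// mulr_gt0.
have e1n : e1 *+ n <= e / 3.
  have n1 : n.+1%:R^-1 * n%:R <= 1 :> R by rewrite mulrC ler_pdivrMr ?ltr0n// mul1r ler_nat.
  rewrite -[e1 *+ n]mulr_natr /e1 invfM mulrA -mulrA ler_piMr//.
  by rewrite divr_ge0// ltW.
have [eta eta0 h] := word_dist s n e10.
have wd z z' : dist z z' < eta -> word_dlog v z <= word_dlog v z' + 2 * (e / 3).
  move=> zz; have [->|nzz] := eqVneq z z'; first by rewrite lerDl mulr_ge0 ?divr_ge0 ?ltW.
  have /andP[h1 _] := h v z z' erefl zz.
  have /andP[_ h2] := h v z' z erefl (eq_ind_r (fun t => is_true (t < eta)) zz (distC z' z)).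
  rewrite (distC z' z) (distC (word_map v z')) in h2.
  by have := le_trans h1 h2; rewrite ler_pM2r ?dist_gt0// ler_expR; lra.
have d_lt : \forall r \near (0 : R)^'+, r < eta / 2 by apply: nbhs_right_lt; rewrite divr_gt0.
have d_gt : \forall r \near (0 : R)^'+, 0 < r by exact: nbhs_right_gt.
apply: filterS2 d_lt d_gt => r reta r0; apply/andP; split.
  (* The lower bound needs a second point in the ball, since pairs of equal points contribute 0. *)
  have [y xy yr] := @cantor_perfect R K x r r0.
  apply: (@le_trans _ _ (dist (word_map v x) (word_map v y) / dist x y)%:E); last first.
    apply: ereal_sup_ubound; exists (x, y) => //; split=> /=; first exact: ballxx.
    exact: yr.
  have xye : dist x y < eta by lra.
  have /andP[h1 _] := h v x y erefl xye.
  rewrite lee_fin ler_pdivlMr ?dist_gt0//; apply: le_trans h1.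
  by rewrite ler_pM2r ?dist_gt0// ler_expR; lra.
apply: ge_ereal_sup => _ [[y z] [/= by_ bz] <-].
have y1 : dist x y < r by exact: by_.
have z1 : dist x z < r by exact: bz.
have yz : dist y z < eta by have := dist_triangle x y z; rewrite (distC y x); lra.
have yx : dist y x < eta by rewrite distC; lra.
rewrite lee_fin; have [->|nyz] := eqVneq y z.
  by rewrite -[mdist z z]/(dist z z) distxx invr0 mulr0 expR_ge0.
rewrite ler_pdivrMr; last by rewrite -[mdist y z]/(dist y z) dist_gt0.
have /andP[_ h2] := h v y z erefl yz; apply: le_trans h2 _.
by rewrite ler_wpM2r ?cantor_dist_ge0// ler_expR; have := wd y x yx; lra.
Qed.

Lemma word_Llip (v : seq I) x : Llip (word_map v) x = (expR (word_dlog v x))%:E.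
Proof.
apply: cvg_lim => //; apply/fine_cvgP; split.
  have := word_Lip_on v x (@ltr01 R); apply: filterS => r /andP[h1 h2].
  by rewrite fin_numElt (lt_le_trans _ h1) ?ltNyr//= (le_lt_trans h2) ?ltry.
apply/cvgrPdist_lt => eps eps0.
have ce : expR t @[t --> word_dlog v x] --> expR (word_dlog v x) by exact: continuous_expR.
move/cvgrPdist_lt : ce => /(_ eps eps0) /nbhs_ballP[dl /= dl0 hd].
have e0 : 0 < dl / 2 by rewrite divr_gt0.
have hm : `|expR (word_dlog v x) - expR (word_dlog v x - dl / 2)| < eps.
  apply: hd; rewrite /ball/= opprD addrA subrr add0r opprK ger0_norm ?ltW//; lra.
have hp : `|expR (word_dlog v x) - expR (word_dlog v x + dl / 2)| < eps.
  apply: hd; rewrite /ball/= opprD addrA subrr add0r normrN ger0_norm ?ltW//; lra.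
have := word_Lip_on v x e0; apply: filterS => r /andP[] /=.
case: (Lip_on _ _) => [t||]//; rewrite !lee_fin => h1 h2 /=.
move: hm hp h1 h2; rewrite !ltr_distlC.
move=> /andP[e1 _] /andP[_ e2] e3 e4.
by rewrite (lt_le_trans e1 e3) (le_lt_trans e4 e2).
Qed.

(** A measurable function whose Birkhoff sums under [skew] are almost surely the logarithms
    [lne (Llip (fiter f n w) x)]. *)
Definition path_dlog (z : pathSpace T * borel K) : R := \sum_j \1_(E j) (z.1 0%N) * u j z.2.

Lemma path_dlog_measurable : measurable_fun [set: pathSpace T * borel K] path_dlog.
Proof.
apply: measurable_sum => j; apply: measurable_funM.
  have := @measurable_indic _ (pathSpace T * borel K)%type R setT
    ([set w : pathSpace T | E j (w 0%N)] `*` [set: borel K]).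
  move=> /(_ (measurableX (coord_measurable 0 (mE j)) measurableT)).
  rewrite (_ : \1__ = fun z : pathSpace T * borel K => \1_(E j) (z.1 0%N) : R)//.
  apply/funext => z; rewrite !indicE; congr (_%:R); congr nat_of_bool.
  by apply/idP/idP; rewrite !inE /=; [case|split].
have mu_ : measurable_fun [set: borel K] (u j : borel K -> R).
  by apply: unif_cont_measurable; exact: unif_cont_dlog.
exact: (measurableT_comp mu_ measurable_snd).
Qed.

Lemma path_dlogE w j x : E j (w 0%N) -> path_dlog (w, x) = u j x.
Proof.
move=> Ej; rewrite /path_dlog (bigD1 j)//= big1 => [|i ij].
  by rewrite addr0 indicE mem_set// mul1r.
by rewrite indicE memNset ?mul0r// => Ei; move/eqP : ij; apply; exact: dE Ei Ej.
Qed.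

Lemma path_dlog_bounded : exists B : R, forall z, `|path_dlog z| <= B.
Proof.
have [B B0 hB] := dlog_bounded s.
exists (\sum_(j : I) B) => z; apply: le_trans (ler_norm_sum _ _ _) _; apply: ler_sum => j _.
rewrite normrM; apply: le_trans (hB j z.2); rewrite ler_piMl//.
by rewrite indicE; case: (_ \in _); rewrite ?normr1 ?normr0.
Qed.

Lemma iter_skewE n w x : iter n skew (w, x) = (iter n shift w, fiter f n w x).
Proof. by elim: n => //= n ->. Qed.

Lemma fiter_dlog w : (forall n, exists j, E j (w n) /\ f (iter n shift w) = g j) ->
  forall n x, lne (Llip (fiter f n w) x) = (\sum_(k < n) path_dlog (iter k skew (w, x)))%:E.
Proof.
move=> hw n x.
suff [v [hv1 hv2]] : exists v : seq I, (forall y, fiter f n w y = word_map v y) /\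
    forall y, word_dlog v y = \sum_(k < n) path_dlog (iter k skew (w, y)).
  have -> : fiter f n w = word_map v by apply/funext.
  by rewrite word_Llip lne_EFin ?expR_gt0// expRK hv2.
elim: n => [|n [v [h1 h2]]]; first by exists [::]; split=> // y; rewrite big_ord0.
have [j [Ej fj]] := hw n; exists (rcons v j); split=> y.
  by rewrite /= h1 fj -cats1 word_map_cat.
have dlog_rcons v' y' : word_dlog (rcons v' j) y' = word_dlog v' y' + u j (word_map v' y').
  by elim: v' y' => [|i v' IH] y' /=; rewrite ?addr0 ?add0r// IH addrA.
rewrite dlog_rcons big_ord_recr h2 /=; congr (_ + _).
rewrite iter_skewE (@path_dlogE _ j) ?h1//.
by rewrite iter_shiftE add0n.
Qed.

Lemma product_finite mu : ((P \x mu) [set: pathSpace T * borel K] < +oo)%E.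
Proof.
by rewrite probability_setT ltry.
Qed.

Lemma path_dlog_integrable mu : (P \x mu)%E.-integrable [set: pathSpace T * borel K] (EFin \o path_dlog).
Proof.
apply: measurable_bounded_integrable => //.
- exact: product_finite.
- exact: path_dlog_measurable.
- have [B hB] := path_dlog_bounded; exists B; split; first exact: num_real.
  by move=> M BM x _ /=; apply: le_trans (hB x) _; exact: ltW.
Qed.

Lemma iter_skew_measurable n : measurable_fun [set: pathSpace T * borel K] (iter n skew).
Proof.
elim: n => [|n IH]; first exact: measurable_id.
exact: (measurableT_comp skew_measurable IH).
Qed.

Lemma iter_skew_integral mu n : stationary P f mu ->
  (\int[P \x mu]_z (path_dlog (iter n skew z))%:E = \int[P \x mu]_z (path_dlog z)%:E)%E.
Proof.
move=> st; have inv A : measurable A -> (P \x mu)%E (iter n skew @^-1` A) = (P \x mu)%E A.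
  elim: n => [//|n IH] mA; rewrite -[RHS]IH// -[RHS]st//.
    by congr (_ _); apply/seteqP; split=> z /=; rewrite -iterSr.
  by rewrite -[X in measurable X]setTI; exact: iter_skew_measurable.
have mU : measurable_fun [set: pathSpace T * borel K] (EFin \o path_dlog).
  by apply/measurable_EFinP; exact: path_dlog_measurable.
rewrite integralE [RHS]integralE; congr (_ - _)%E.
  rewrite -(@invariant_ge0_integral R _ _ (P \x mu)%E (iter n skew) (iter_skew_measurable n) inv (EFin \o path_dlog)^\+%E)//; last exact: measurable_funepos.
  by apply: eq_integral => z _; rewrite !funeposE.
rewrite -(@invariant_ge0_integral R _ _ (P \x mu)%E (iter n skew) (iter_skew_measurable n) inv (EFin \o path_dlog)^\-%E)//; last exact: measurable_funeneg.
by apply: eq_integral => z _; rewrite !funenegE.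
Qed.

Lemma path_dlog_integral mu : (\int[P \x mu]_z (path_dlog z)%:E = (uc_int mu (mean_dlog s))%:E)%E.
Proof.
rewrite -uc_intE; last exact: unif_cont_mean_dlog.
rewrite -(integral21_prod_meas1 (path_dlog_integrable mu)); apply: eq_integral => y _.
rewrite /fubini_G /= (@label_mean (fun j => u j y))//.
by apply: aeW => w j Ej _; rewrite (path_dlogE _ Ej).
Qed.

Lemma ae_fst mu (Q : pathSpace T -> Prop) : {ae P, forall w, Q w} ->
  {ae (P \x mu)%E, forall z : pathSpace T * borel K, Q z.1}.
Proof.
move=> [N [mN N0 hN]]; exists (N `*` setT); split.
- exact: measurableX.
- transitivity (P N * mu setT)%E; first by apply: product_measure1E => //; exact: measurableT.
  by transitivity (0 * mu setT)%E; [congr (_ * _)%E; exact: N0|rewrite mul0e].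
- by move=> z /= hz; split=> //; exact: hN.
Qed.

(** All Birkhoff terms have the same integral, so the sequence defining the exponent is constant
    from [n = 1] on. *)
Lemma lyapunovE mu : stationary P f mu -> lyapunov P f mu = (uc_int mu (mean_dlog s))%:E.
Proof.
move=> st; rewrite /lyapunov; apply: lim_near_cst => //; exists 1%N => // n /= n0.
rewrite (@integral_ae_eq _ _ _ (P \x mu)%E _ (fun z => (\sum_(k < n) (path_dlog (iter k skew z))%:E)%E)); last first.
  apply: aeS (ae_fst mu ae_path) => -[w x] /= hw.
  by rewrite (fiter_dlog hw) sumEFin.
have ik k : (P \x mu)%E.-integrable [set: pathSpace T * borel K] (fun z => (path_dlog (iter k skew z))%:E).
  apply: measurable_bounded_integrable => //.
  - exact: product_finite.
  - by apply: (measurableT_comp path_dlog_measurable); exact: iter_skew_measurable.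
  - have [B hB] := path_dlog_bounded; exists B; split; first exact: num_real.
    by move=> M BM x _ /=; apply: le_trans (hB _) _; exact: ltW.
rewrite integral_sum//.
rewrite (eq_bigr (fun=> (uc_int mu (mean_dlog s))%:E)) => [|k _]; last first.
  by rewrite iter_skew_integral// path_dlog_integral.
rewrite sumEFin -EFinM sumr_const card_ord -[uc_int _ _ *+ _]mulr_natl mulKf//.
by rewrite pnatr_eq0 -lt0n.
Qed.

(** [N] times the exponent of a stationary measure is the integral of [drift s N], so [- kappa / N]
    bounds all exponents at once and the supremum stays negative. *)
Lemma mostly_contractingP N (kappa : R) : 0 < kappa -> (forall x, drift s N x <= - kappa) ->
  mostly_contracting P f.
Proof.
move=> k0 hN.
have N0 : (0 < N)%N by rewrite lt0n; apply/eqP => e; have := hN point; rewrite e /drift big_ord0; lra.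
split.
  have [M M1 hM] := ifs_lip s.
  apply: (@le_lt_trans _ _ (\int[P]_w (ln M)%:E)%E); last first.
    rewrite -[X in (X < _)%E](_ : ((ln M)%:E * P setT)%E = _); last by symmetry; apply: integral_cst; exact: measurableT.
    by rewrite probability_setT mule1 ltry.
  have lM : 0 <= ln M by rewrite ln_ge0.
  apply: integral_ae_le => [w|w|].
  - by rewrite le_max lexx.
  - by rewrite lee_fin.
  apply: aeS fE => w [j [_ ->]]; rewrite ge_max lee_fin lM/=.
  have M0 : 0 < M by lra.
  have LM : (Lip (g j) <= M%:E)%E.
    apply: ge_ereal_sup => _ [[x y] _ <-]; rewrite lee_fin /=.
    have [->|nxy] := eqVneq x y; first by rewrite -[mdist y y]/(dist y y) distxx invr0 mulr0 ltW.
    by rewrite ler_pdivrMr; [exact: hM|rewrite -[mdist x y]/(dist x y) dist_gt0].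
  have [L0|L0] := leP (Lip (g j)) 0%E; first by rewrite le0_lneNy// leNye.
  by rewrite -lne_EFin// lee_lne// in_itv/= leey andbT ltW.
apply: (@le_lt_trans _ _ (- kappa / N%:R)%:E); last first.
  by rewrite lte_fin mulNr oppr_lt0 divr_gt0// ltr0n.
apply: ge_ereal_sup => _ [mu st <-]; rewrite lyapunovE// lee_fin ler_pdivlMr ?ltr0n// mulrC.
rewrite -(uc_int_drift N st) -(uc_int_cst mu (- kappa)); apply: uc_int_le => //.
  rewrite /drift; apply: unif_cont_sum => k; apply: unif_cont_iter_transfer; exact: unif_cont_mean_dlog.
exact: unif_cont_cst.
Qed.

Lemma common_invariantP : (exists mu : probability (borel K) R, forall j (A : set (borel K)),
    measurable A -> mu (g j @^-1` A) = mu A) -> exists mu, common_invariant P f mu.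
Proof.
move=> [mu hmu]; exists mu.
exact: ((ae_ifs_map (fun h : K -> K => forall A : set (borel K), measurable A -> pushforward mu (h : borel K -> borel K) A = mu A)).2 hmu).
Qed.

End RandomIfs.

Lemma alphabet_weights_sum (R : realType) (d : measure_display) (T : measurableType d)
    (p : probability T R) (P : probability (pathSpace T) R) n (E : 'I_n -> set T) :
  is_bernoulli p P -> (forall j, measurable (E j)) -> (forall i j t, E i t -> E j t -> i = j) ->
  {ae P, forall w, exists j, E j (w 0%N)} -> \sum_j fine (p (E j)) = 1.
Proof.
move=> bern mE dE aeE.
have tE : trivIset [set: 'I_n] E.
  by apply/trivIsetP => i j _ _ ij; apply/seteqP; split=> // t [Ei Ej]; move/eqP : ij; apply; exact: dE Ei Ej.
pose U := \big[setU/set0]_(j < n) E j.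
have mU : measurable U by apply: bigsetU_measurable => j _; exact: mE.
have UE t : U t <-> exists j, E j t.
  rewrite /U -bigcup_seq; split=> [[j _ Ej]|[j Ej]]; first by exists j.
  by exists j => //=; rewrite mem_index_enum.
have pU : p U = 1%E.
  rewrite -(coord_probability bern 0 mU); have [N [mN N0 hN]] := aeE.
  have mC := coord_measurable 0 mU.
  have sub : ~` [set w : pathSpace T | U (w 0%N)] `<=` N.
    by move=> w /= nU; apply: hN => h; apply: nU; apply/UE.
  have N0' : (P N <= 0)%E by rewrite le_eqVlt; apply/orP; left; apply/eqP; exact: N0.
  have hle : (P (~` [set w : pathSpace T | U (w 0%N)]) <= P N)%E.
    by apply: le_measure => //; rewrite inE//; exact: measurableC.
  have := le_trans hle N0'; rewrite probability_setC// => h.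
  apply/eqP; rewrite eq_le probability_le1//=.
  by move: h; rewrite leeBlDr ?fin_num_measure// add0e.
apply: EFin_inj; rewrite -sumEFin -pU (measure_bigsetU_ord p xpredT mE tE).
by apply: eq_bigr => j _; rewrite fineK// fin_num_measure.
Qed.

Theorem proposition17 (R : realType) (d : measure_display)
    (T : measurableType d) (p : probability T R) (P : probability (pathSpace T) R)
    (K : cantorSet R) (f : pathSpace T -> K -> K) :
  finite_set [set: T] ->
  is_bernoulli p P ->
  random_C1_diffeos P f ->
  ~ (exists mu : probability (borel K) R, common_invariant P f mu) ->
  mostly_contracting P f /\
  exists2 a0 : R, 0 < a0 &
    forall a : R, 0 < a <= a0 ->
      exists2 L : {linear holder K a -> holder K a}, koopman_on P f L &
        [/\ quasi_compact L,
            simple_eigenvalue L 1 <-> uniquely_ergodic P f,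
            unique_unimodular_eigenvalue L 1 <-> aperiodic P f &
            spectral_gap L <-> mingled P f].
Proof.
move=> finT bern rf ninv; have [[mf _] _] := rf.
have [n [E [G [mE dE pE dG fE]]]] := finite_structure finT bern rf.
have wtE j : p (E j) = (fine (p (E j)))%:E by rewrite fineK// fin_num_measure.
have wt0 j : 0 < fine (p (E j)) by rewrite -lte_fin -wtE.
have wt1 : \sum_j fine (p (E j)) = 1.
  by apply: alphabet_weights_sum bern mE dE _; apply: aeS fE => w [j [Ej _]]; exists j.
have [h [u [Gh hG uP hP]]] := C1_diffeo_family dG.
pose s := CantorIfs wt0 wt1 Gh hG uP hP.
have [N [kappa [k0 hN]]] : exists N (kappa : R), 0 < kappa /\ forall x, drift s N x <= - kappa.
  apply: contracting_drift => inv; apply: ninv.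
  exact: (@common_invariantP _ _ _ p P K f s E bern mE dE wtE fE inv).
split; first exact: (@mostly_contractingP _ _ _ p P K f s E bern mE dE wtE mf fE N kappa k0 hN).
have N0 : (0 < N)%N by rewrite lt0n; apply/eqP => e; have := hN point; rewrite e /drift big_ord0; lra.
have [a0 /andP[a00 _] hcontr] := word_mean_dist_contraction k0 hN.
exists a0 => // a aa0; have /andP[apos _] := aa0.
have [rho rho01 [eta eta0 contr]] := hcontr a aa0.
have [L LE] := transfer_linear s apos.
exists L; first by move=> phi x; rewrite LE (@koopmanE _ _ _ p P K f s E bern mE dE wtE fE).
have qc := quasi_compact_transfer apos LE N0 rho01 eta0 contr.
have ue := @uniquely_ergodicP _ _ _ p P K f s E bern mE dE wtE mf fE a N rho eta L apos rho01 eta0 contr LE.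
have aeP := @ae_ifs_map _ _ _ p P K f s E bern mE dE wtE fE.
have siP := @set_invariantP _ _ _ p P K f s E bern mE dE wtE fE.
split=> //.
- exact: iff_trans (simple_eigenvalueP LE) ue.
- apply: iff_trans (unique_unimodularP LE) _.
  have [c1 c2] := unimodular_cycle apos rho01 eta0 contr LE.
  split=> [nc [m [F [m2 cF dF hF]]]|nc ez].
    apply: nc; apply: c2; exists m, F; split=> // i j x Fx.
    by have := (aeP (fun t => t @` F i `<=` F (ordS i))).1 (hF i) j; apply; exists x.
  apply: nc; have [m [F [m2 cF dF hF]]] := c1 ez; exists m, F; split=> // i.
  by apply: (aeP (fun t => t @` F i `<=` F (ordS i))).2 => j _ [x Fx <-]; exact: hF.
- apply: iff_trans (spectral_gapP apos rho01 eta0 contr LE qc) _.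
  split=> hm k k1 [Y [Z [cY cZ YZ iY iZ]]]; apply: (hm k k1); exists Y, Z; split=> //.
  + exact: (siP k Y).1 iY.
  + exact: (siP k Z).1 iZ.
  + exact: (siP k Y).2 iY.
  + exact: (siP k Z).2 iZ.
Qed.
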